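(* Let $\mathcal{D}=(d_1,\ldots,d_m)$ be positive integers with $\sum_i d_i=N$ and $2\mathcal{D}=(2d_1,\ldots,2d_m)$. In $\mathrm{Fl}_{2\mathcal{D}}(\mathbb{R}^{2N})$ the double Schubert varieties $\sigma_{DI}$, $I\in\mathrm{OSP}(\mathcal{D})$, are (integer) cycles, and their classes $[\sigma_{DI}]$ generate a free $\mathbb{Z}$-submodule of $H^*(\mathrm{Fl}_{2\mathcal{D}}(\mathbb{R}^{2N});\mathbb{Z})$. Rationally, the classes $[\sigma_{DI}]$, $I\in \mathrm{OSP}(\mathcal{D})$, form a basis of $H^*(\mathrm{Fl}_{2\mathcal{D}}(\mathbb{R}^{2N});\mathbb{Q})$.
   Context: For positive integers $\mathcal{E}=(e_1,\ldots,e_m)$ with sum $M$, $\mathrm{Fl}_{\mathcal{E}}(\mathbb{R}^M)$ is the manifold of flags $F_1\subset\cdots\subset F_m=\mathbb{R}^M$ with $\dim F_i=e_1+\cdots+e_i$, and $\mathrm{OSP}(\mathcal{E})$ is the set of ordered set partitions $I=(I_1,\ldots,I_m)$ of $\{1,\ldots,M\}$ with $|I_j|=e_j$. With $E_k$ the span of the first $k$ standard basis vectors, the Schubert cell is $\Omega_I=\{F_\bullet:\dim (F_i\cap E_k)=|\{l\in I_1\cup\cdots\cup I_i:\ l\le k\}| \text{ for all } i,k\}$ and the Schubert variety is its closure $\sigma_I=\overline{\Omega_I}$. The Schubert cells give a cell decomposition (a stratification by contractible strata). After cooriented choices, the Vassiliev complex has as $k$-cochains the integer combinations of cells of codimension $k$,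 with differential given by the incidence coefficients; its cohomology is $H^*(\mathrm{Fl}_{\mathcal{E}}(\mathbb{R}^M);\mathbb{Z})$. $\sigma_I$ is called a cycle if $\Omega_I$ is a cocycle of this complex; equivalently, $\sigma_I$ has a fundamental cohomology class, and $[\sigma_I]\in H^{\operatorname{codim}\sigma_I}$ denotes this class (defined up to sign, the sign depending on the coorientation). For $I\in\mathrm{OSP}(\mathcal{D})$, the doubled ordered set partition $DI\in\mathrm{OSP}(2\mathcal{D})$ is obtained by replacing each $i\in I_j$ by the two elements $2i-1,2i\in (DI)_j$; $\sigma_{DI}$ is called a double Schubert variety. *)

(* Defs.v *)
From HB Require Import structures.
From mathcomp Require Import all_boot all_order all_algebra.
From mathcomp Require Import zify.
From mathcomp Require Import all_classical all_reals all_analysis.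

Set Implicit Arguments.
Unset Strict Implicit.
Unset Printing Implicit Defensive.

Import Order.TTheory GRing.Theory Num.Theory.
Import numFieldNormedType.Exports.

Local Open Scope classical_set_scope.
Local Open Scope ring_scope.

Definition stdsimplex (R : realType) (n : nat) : set 'rV[R]_n.+1 :=
  [set x | (forall j, 0 <= x 0 j) /\ \sum_j x 0 j = 1].
Arguments stdsimplex R n : clear implicits.

Section Faces.
Variables (R : realType) (n : nat) (i : 'I_n.+2).

Definition face_row (x : 'rV[R]_n.+1) : 'rV[R]_n.+2 :=
  \row_j oapp (x 0) 0 (unlift i j).

Lemma face_row_subproof (x : stdsimplex R n) :
  face_row (set_val x) \in stdsimplex R n.+1.
Proof.
have /= [x_ge0 x_sum] := set_valP x; apply/mem_set; split => [j|].
  by rewrite mxE; case: (unlift i j) => [k|] //=; exact: x_ge0.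
rewrite (bigD1_ord i) //= mxE unlift_none /= add0r -[RHS]x_sum.
by apply: eq_bigr => k _; rewrite mxE liftK.
Qed.

Definition face (x : stdsimplex R n) : stdsimplex R n.+1 :=
  exist _ (face_row (set_val x)) (face_row_subproof x).

End Faces.

Section Cohomology.
Variables (R : realType) (T : topologicalType).

Definition simplices (n : nat) (U : set T) : set (stdsimplex R n -> T) :=
  [set s | continuous s /\ range s `<=` U].

(* A cochain on a subset U of T is represented by a function on all maps from
   the simplex to T; only its values on [simplices n U] are meaningful, and
   everything below only looks at those. *)
Definition cochain (A : Type) (n : nat) : Type := (stdsimplex R n -> T) -> A.

Definition vanishes_on (A : nmodType) n (U : set T) (c : cochain A n) : Prop :=
  forall s, simplices U s -> c s = 0.

Definition coboundary (A : pzRingType) n (c : cochain A n) : cochain A n.+1 :=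
  fun s => \sum_(i < n.+2) (-1) ^+ i * c (s \o face i).

(* Z^n(U, V; A) and B^n(U, V; A), for V a subset of U, so that
   H^n(U, V; A) = Z^n(U, V; A) / B^n(U, V; A); H^n(U; A) is the case V = set0. *)
Definition cocycle (A : pzRingType) (U V : set T) n (c : cochain A n) : Prop :=
  vanishes_on V c /\ vanishes_on U (coboundary c).

Definition is_coboundary (A : pzRingType) (U V : set T) n :
    cochain A n -> Prop :=
  match n with
  | 0 => fun c => vanishes_on U c
  | n'.+1 => fun c => exists b : cochain A n', vanishes_on V b /\
                        forall s, simplices U s -> c s = coboundary b s
  end.

Definition cohomologous (A : pzRingType) (U V : set T) n
    (c c' : cochain A n) : Prop :=
  is_coboundary U V (fun s => c s - c' s).

(* H^n(U, V; Z) is infinite cyclic, generated by the class of theta. *)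
Definition generates (U V : set T) n (theta : cochain int n) : Prop :=
  cocycle U V theta /\
  forall c : cochain int n, cocycle U V c ->
    exists! a : int, cohomologous U V c (fun s => a * theta s).

(* Linear independence and spanning in the graded module
   H^*(X; A) = (+)_k H^k(X; A), for the family of classes indexed by S whose
   member of index j is the class of c (deg j) j, of degree deg j. *)
Definition classes_free (A : pzRingType) (X : set T) (J : finType) (S : {set J})
    (deg : J -> nat) (c : forall k, J -> cochain A k) : Prop :=
  forall a : J -> A,
    (forall k, is_coboundary X set0
       (fun s => \sum_(j in S | deg j == k) a j * c k j s)) ->
    forall j, j \in S -> a j = 0.

Definition classes_span (A : pzRingType) (X : set T) (J : finType) (S : {set J})
    (deg : J -> nat) (c : forall k, J -> cochain A k) : Prop :=
  forall (k : nat) (z : cochain A k), cocycle X set0 z ->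
    exists a : J -> A, cohomologous X set0 z
       (fun s => \sum_(j in S | deg j == k) a j * c k j s).

End Cohomology.

(* {1, ..., M} is encoded as 'I_M = {0, ..., M - 1}. *)
Definition OSP (m M : nat) (e : 'I_m -> nat) :
    {set {ffun 'I_m -> {set 'I_M}}} :=
  [set I : {ffun 'I_m -> {set 'I_M}} | [&& [forall j, #|I j| == e j],
               [forall i, forall j, (i != j) ==> [disjoint I i & I j]]
             & \bigcup_j I j == [set: 'I_M]%SET]]%SET.

Definition twice (m : nat) (e : 'I_m -> nat) : 'I_m -> nat :=
  fun j => (2 * e j)%N.

(* Position i (0-based) is replaced by 2i and 2i + 1. *)
Definition doubled (m N : nat) (I : {ffun 'I_m -> {set 'I_N}}) :
    {ffun 'I_m -> {set 'I_(2 * N)}} :=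
  [ffun j => [set l : 'I_(2 * N) | [exists i in I j, (l == 2 * i :> nat)%N
                                     || (l == (2 * i).+1 :> nat)%N]]%SET].

Lemma doubled_OSP (m N : nat) (d : 'I_m -> nat) I :
  I \in OSP N d -> doubled I \in OSP (2 * N) (twice d).
Proof.
have half_lt (l : 'I_(2 * N)) : (l./2 < N)%N by rewrite ltn_half_double -mul2n.
pose h (l : 'I_(2 * N)) : 'I_N := Ordinal (half_lt l).
have dbl_lt (p : 'I_N * bool) : (2 * p.1 + p.2 < 2 * N)%N.
  by case: p => [[i iN]] [] /=; rewrite !mul2n -?muln2 ?addn0; lia.
pose f p : 'I_(2 * N) := Ordinal (dbl_lt p).
have in_doubled j l : (l \in doubled I j) = (h l \in I j).
  rewrite ffunE inE; apply/existsP/idP => [[i /andP[iI]]|hI].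
    move=> l_i; suff -> : h l = i by [].
    by apply: val_inj => /=; case/orP: l_i => /eqP ->; lia.
  exists (h l); rewrite hI /=.
  by have := odd_double_half l; case: (odd l); lia.
have f_inj : injective f.
  move=> [i b] [i' b'] /(congr1 val) /= ii'.
  have bb' : b = b' by case: b b' ii' => -[]; lia.
  by congr pair => //; apply: val_inj; move: ii'; rewrite /= bb'; lia.
rewrite !inE => /and3P[/forallP cardI /forallP disjI /eqP coverI].
apply/and3P; split.
- apply/forallP => j; apply/eqP; rewrite /twice -(eqP (cardI j)).
  have -> : doubled I j = (f @: finset.setX (I j) [set: bool])%SET.
    apply/setP => l; rewrite in_doubled; apply/idP/imsetP => [hI|].
      exists (h l, odd l); first by rewrite !inE hI.
      by apply: val_inj => /=; have := odd_double_half l; lia.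
    case=> -[i b]; rewrite !inE andbT => /= iI ->.
    by suff -> : h (f (i, b)) = i by []; apply: val_inj; case: b => /=; lia.
  by rewrite card_imset // cardsX cardsT card_bool mulnC.
- apply/forallP => i; apply/forallP => j; apply/implyP => ij.
  rewrite disjoint_subset; apply/fintype.subsetP => l.
  rewrite in_doubled !inE in_doubled => hI.
  have /forallP/(_ j)/implyP/(_ ij) := disjI i.
  by rewrite disjoint_subset => /fintype.subsetP /(_ _ hI); rewrite !inE.
- apply/eqP/setP => l; rewrite inE; apply/finset.bigcupP.
  have : h l \in (\bigcup_j I j)%SET by rewrite coverI inE.
  by case/finset.bigcupP => j _ hI; exists j => //; rewrite in_doubled.
Qed.

(* Codimension of the Schubert cell of I. The flag manifold has dimension
   sum_(i < j) e_i e_j, one for each pair of positions lying in distinct blocks,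
   and the pairs below are those that do not contribute to the dimension of the
   cell: l < l' with l in an earlier block than l'. *)
Definition codim (m M : nat) (I : {ffun 'I_m -> {set 'I_M}}) : nat :=
  #|[set p : 'I_M * 'I_M | (p.1 < p.2)%N &&
      [exists i : 'I_m, exists j : 'I_m, [&& (i < j)%N, p.1 \in I i & p.2 \in I j]]]%SET|.

Section Flags.
Variables (R : realType) (m M : nat).

(* A subspace of R^M is encoded by its orthogonal projector, whose row space is
   the subspace; this embeds the flag manifold, with its usual topology, in a
   product of spaces of matrices. *)
Definition flagspace : topologicalType := {ptws 'I_m -> 'M[R]_M}.

Variable e : 'I_m -> nat.

Definition Fl : set flagspace :=
  [set F : flagspace | (forall i : 'I_m, (F i)^T = F i /\ F i *m F i = F i) /\
           (forall i : 'I_m, \rank (F i) = \sum_(j < m | (j <= i)%N) e j)%N /\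
           (forall i j : 'I_m, (i <= j)%N -> (F i <= F j)%MS)].

(* The row space of [pid_mx k] is E_k. *)
Definition schubert_cell (I : {ffun 'I_m -> {set 'I_M}}) : set flagspace :=
  [set F : flagspace | Fl F /\ forall (i : 'I_m) (k : nat), (k <= M)%N ->
     \rank (F i :&: (pid_mx k : 'M[R]_M))%MS =
     #|[set l in \bigcup_(j < m | (j <= i)%N) I j | (l < k)%N]%SET|].

Definition schubert_variety (I : {ffun 'I_m -> {set 'I_M}}) : set flagspace :=
  Fl `&` closure (schubert_cell I).

(* The open set of flags lying in a cell of codimension less than k. *)
Definition stratum_lt (k : nat) : set flagspace :=
  \bigcup_(I in [set I | I \in OSP M e /\ (codim I < k)%N]) schubert_cell I.

Notation cochains A := (forall k : nat,
  {ffun 'I_m -> {set 'I_M}} -> cochain R flagspace A k).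

(* A coorientation of the cell of I, that is an orientation of its normal
   bundle, is the same as a Thom class: a generator of H^k(U, U \ cell; Z) for
   the open set U = Fl \ (variety \ cell), in which the cell is closed. *)
Definition coorientation (I : {ffun 'I_m -> {set 'I_M}})
    (theta : cochain R flagspace int (codim I)) : Prop :=
  generates (Fl `\` (schubert_variety I `\` schubert_cell I))
            (Fl `\` schubert_variety I) theta.

(* Families indexed by all degrees k are used to avoid casts: for the cell of I
   only the component of degree [codim I] matters. *)
Definition coorientations (theta : cochains int) : Prop :=
  forall I, I \in OSP M e -> coorientation (theta (codim I) I).

(* A cochain of degree k of the Vassiliev complex is an integer combination
   a = sum_I a_I I of the cells of codimension k; it is identified with the
   element sum_I a_I theta_I of H^k(stratum_lt k.+1, stratum_lt k; Z). The
   differential of the complex is the connecting homomorphism to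
   H^(k+1)(stratum_lt k.+2, stratum_lt k.+1; Z), whose matrix entries in the
   bases theta are the incidence coefficients. *)
Definition realization (theta : cochains int) (k : nat)
    (a : {ffun 'I_m -> {set 'I_M}} -> int) : cochain R flagspace int k :=
  fun s => \sum_(I in OSP M e | codim I == k) a I * theta k I s.
Arguments realization : clear implicits.

Definition vassiliev_differential (theta : cochains int) (k : nat)
    (a b : {ffun 'I_m -> {set 'I_M}} -> int) : Prop :=
  cohomologous (stratum_lt k.+2) (stratum_lt k.+1)
    (coboundary (realization theta k a)) (realization theta k.+1 b).

Definition vassiliev_cocycle (theta : cochains int) (k : nat)
    (a : {ffun 'I_m -> {set 'I_M}} -> int) : Prop :=
  vassiliev_differential theta k a (fun=> 0).

Definition schubert_cycle (theta : cochains int)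
    (I : {ffun 'I_m -> {set 'I_M}}) : Prop :=
  vassiliev_cocycle theta (codim I) (fun J => (J == I)%:R).

(* c represents the fundamental cohomology class of the Schubert variety of I in
   H^(codim I)(Fl; Z): it is supported on the variety and restricts to the
   coorientation near the cell. *)
Definition fundamental_class (theta : cochains int)
    (I : {ffun 'I_m -> {set 'I_M}})
    (c : cochain R flagspace int (codim I)) : Prop :=
  cocycle Fl (Fl `\` schubert_variety I) c /\
  cohomologous (Fl `\` (schubert_variety I `\` schubert_cell I))
               (Fl `\` schubert_variety I) c (theta (codim I) I).

End Flags.

Arguments flagspace R m M : clear implicits.
Arguments Fl R [m] M e.

(* Main.v *)
(** Conjugation by the diagonal matrix that changes the signs of the coordinates
    2k and 2k+1 preserves every Schubert cell, and rotating that plane shows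
    that it acts trivially on the cohomology of the flag manifold. On the Thom
    class of the cell of J it acts by the parity of the number of normal
    directions of J that it reverses. For a doubled J all these signs are +1
    and the codimension is even; for any other J some k gives the sign -1.

    The Thom class of a doubled cell is extended over the cells of higher
    codimension, one at a time. Only a cell of codimension one more can
    obstruct this; its codimension is odd, so it is not doubled, and the
    obstruction, an integer, is both fixed and negated by some sign change,
    hence 0. Rationally, averaging over the sign changes removes the
    contribution of the cells that are not doubled, and the remaining ones all
    have even codimension, so nothing cancels among them: their classes are a
    basis. *)

Require Import Defs.
From mathcomp Require Import all_boot all_order all_algebra.
From mathcomp Require Import zify ring lra.
From mathcomp Require Import all_classical all_reals all_analysis.

Set Implicit Arguments.
Unset Strict Implicit.
Unset Printing Implicit Defensive.

Import Order.TTheory GRing.Theory Num.Theory.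
Import numFieldNormedType.Exports.

Local Open Scope classical_set_scope.
Local Open Scope ring_scope.

(** * Affine simplices as words of vertices *)

(** The Thom class of a cell does not come from a tubular neighbourhood. A chart identifies an open
    set containing the cell with a vector space, and there the class is built one normal coordinate
    at a time; the same recursion gives its sign under each sign change. Cells are then added one at
    a time by increasing codimension, so that every step concerns a pair whose cohomology is the
    coefficient ring in a single degree. The obstacle is that sign changes preserve the cells while
    the rotations joining them to the identity do not: triviality of the action is available only on
    the absolute cohomology of the whole manifold. Hence invariance over the strata is carried
    through the integral extension as part of the induction. For rational freeness, a multiple of a
    Thom class that bounds absolutely must be shown to bound relative to the lower strata; the
    possible failure comes from odd-degree classes of those strata. Averaging a primitive leaves
    only invariant ones, and these vanish because invariant classes are combinations of doubled
    classes, of even degree. *)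

Section Words.
Variable A : comNzRingType.

Definition del (V : Type) (i : nat) (w : seq V) : seq V :=
  take i w ++ drop i.+1 w.

(** The alternating sum over deleted letters, unfolded at the head of the word, so that [bd_bd] and
    the homotopy formulas follow by induction without index manipulation; [bdE] recovers the sum. *)
Fixpoint bd (V : Type) (phi : seq V -> A) (w : seq V) : A :=
  if w is x :: w' then phi w' - bd (fun u => phi (x :: u)) w' else 0.

Lemma size_del (V : Type) i (w : seq V) :
  (i < size w)%N -> size (del i w) = (size w).-1.
Proof. by move=> iw; rewrite size_cat size_take size_drop iw; lia. Qed.

Lemma nth_del (V : Type) x0 i (w : seq V) k :
  (i < size w)%N -> nth x0 (del i w) k = nth x0 w (bump i k).
Proof.
move=> iw; rewrite nth_cat size_take iw /bump.
case: (ltnP k i) => ki; first by rewrite nth_take.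
by rewrite nth_drop; congr nth; lia.
Qed.

Lemma del_sub (V : eqType) i (w : seq V) : {subset del i w <= w}.
Proof.
by move=> x; rewrite mem_cat => /orP[/mem_take|/mem_drop].
Qed.

Lemma map_del (V V' : Type) (f : V -> V') i w :
  map f (del i w) = del i (map f w).
Proof. by rewrite /del map_cat map_take map_drop. Qed.

Lemma bdE (V : Type) (phi : seq V -> A) w :
  bd phi w = \sum_(i < size w) (-1) ^+ i * phi (del i w).
Proof.
elim: w phi => [|x w IH] phi /=; first by rewrite big_ord0.
rewrite big_ord_recl /= expr0 mul1r [del 0 _]drop0; congr (_ + _).
rewrite IH -sumrN; apply: eq_bigr => i _.
by rewrite /bump /= add1n exprS mulN1r mulNr.
Qed.

Lemma eq_bd (V : Type) (phi psi : seq V -> A) w :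
  (forall i, (i < size w)%N -> phi (del i w) = psi (del i w)) ->
  bd phi w = bd psi w.
Proof.
by move=> e; rewrite !bdE; apply: eq_bigr => i _; rewrite e.
Qed.

Lemma bd0 (V : Type) (phi : seq V -> A) w :
  (forall i, (i < size w)%N -> phi (del i w) = 0) -> bd phi w = 0.
Proof. by move=> e; rewrite !bdE big1// => i _; rewrite e// mulr0. Qed.

Lemma bdB (V : Type) (phi psi : seq V -> A) w :
  bd (fun u => phi u - psi u) w = bd phi w - bd psi w.
Proof.
by rewrite !bdE -sumrB; apply: eq_bigr => i _; rewrite mulrBr.
Qed.

Lemma bd_sum (V : Type) n (phi : nat -> seq V -> A) w :
  bd (fun u => \sum_(j < n) phi j u) w = \sum_(j < n) bd (phi j) w.
Proof.
rewrite bdE; under eq_bigr do rewrite mulr_sumr.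
by rewrite exchange_big; apply: eq_bigr => i _; rewrite bdE.
Qed.

Lemma bd_bd (V : Type) (phi : seq V -> A) w : bd (bd phi) w = 0.
Proof.
elim: w phi => [//|x w IH] phi /=.
rewrite (bdB phi (bd (fun u => phi (x :: u)))) IH subr0.
by rewrite subrr.
Qed.

Lemma bd_map (V V' : Type) (f : V -> V') (phi : seq V' -> A) w :
  bd phi (map f w) = bd (phi \o map f) w.
Proof.
by rewrite !bdE size_map; apply: eq_bigr => i _; rewrite /= map_del.
Qed.

(* The dual of the operator D on chains defined by the cone recursion
   D w = b(w) * (F w - G w - D (boundary w)), a chain homotopy from F to G. *)
Section ConeHomotopy.
Variables (V V' : Type) (F G : (seq V' -> A) -> seq V -> A) (b : seq V -> V').

(** The length of the word serves as fuel, since the recursive calls are made on the words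
    [del i w], which are not subterms of [w]. *)
Fixpoint cone_rec n (phi : seq V' -> A) (w : seq V) : A :=
  if n is n'.+1 then
    let phi_b := fun u => phi (b w :: u) in
    F phi_b w - G phi_b w - bd (cone_rec n' phi_b) w
  else 0.

Definition cone phi w := cone_rec (size w) phi w.

Hypothesis FB : forall phi psi w,
  F (fun u => phi u - psi u) w = F phi w - F psi w.
Hypothesis GB : forall phi psi w,
  G (fun u => phi u - psi u) w = G phi w - G psi w.
Hypothesis Fbd : forall phi w, F (bd phi) w = bd (F phi) w.
Hypothesis Gbd : forall phi w, G (bd phi) w = bd (G phi) w.
Hypothesis FG0 : forall phi, F phi [::] = G phi [::].

Lemma cone_recS phi w : w <> [::] -> cone phi w =
  F (fun u => phi (b w :: u)) w - G (fun u => phi (b w :: u)) w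
  - bd (cone (fun u => phi (b w :: u))) w.
Proof.
move=> w0; rewrite {1}/cone; case en: (size w) => [|n].
  by rewrite (size0nil en) in w0.
rewrite /=; congr (_ - _); apply: eq_bd => i iw.
by rewrite /cone size_del // en.
Qed.

Lemma coneB phi psi w :
  cone (fun u => phi u - psi u) w = cone phi w - cone psi w.
Proof.
move en: (size w) => n; elim: n w en phi psi => [|n IH] w en phi psi.
  by rewrite /cone en /= subr0.
have w0 : w <> [::] by move=> w0; rewrite w0 in en.
rewrite !cone_recS //; set pb := fun u => phi _; set qb := fun u => psi _.
rewrite (FB pb qb) (GB pb qb).
rewrite (eq_bd (psi := fun u => cone pb u - cone qb u)) ?bdB; first ring.
by move=> i iw; apply: IH; rewrite size_del // en.
Qed.

(** Coning from the apex [b w] inverts the boundary up to the base. After unfolding, the terms in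
    [F] and [G] cancel because both commute with [bd], and the induction hypothesis on the faces
    removes the nested [cone]. *)
Lemma cone_homotopy phi w :
  cone (bd phi) w + bd (cone phi) w = F phi w - G phi w.
Proof.
move en: (size w) => n; elim: n w en phi => [|n IH] w en phi.
  by rewrite (size0nil en) /= addr0 FG0 subrr.
have w0 : w <> [::] by move=> w0; rewrite w0 in en.
rewrite cone_recS //=; set pb := fun u => phi _.
rewrite FB GB Fbd Gbd.
have -> : bd (cone (fun u => phi u - bd pb u)) w =
    bd (cone phi) w - bd (fun u => F pb u - G pb u) w.
  rewrite (eq_bd (psi := fun u =>
    cone phi u - (F pb u - G pb u - bd (cone pb) u))).
    rewrite (bdB (cone phi) (fun u => F pb u - G pb u - bd (cone pb) u)).
    by rewrite (bdB (fun u => F pb u - G pb u) (bd (cone pb))) bd_bd subr0.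
  move=> i iw; rewrite (coneB phi (bd pb)); congr (_ - _).
  have := IH (del i w) _ pb; rewrite (size_del iw) en => /(_ erefl) <-.
  by rewrite addrK.
rewrite bdB.
move: (F phi w) (G phi w) (bd (F pb) w) (bd (G pb) w) (bd (cone phi) w) => f g x y z.
ring.
Qed.

End ConeHomotopy.

Section ConeFunctoriality.
Variables (V V' : Type) (F G : (seq V' -> A) -> seq V -> A) (b : seq V -> V').

(* [H w u] reads: the simplex with vertices u lies over the one spanned by w. *)
Lemma cone_local (H : seq V -> seq V' -> Prop) :
  (forall i w u, (i < size w)%N -> H (del i w) u -> H w u) ->
  (forall w u, w <> [::] -> H w u -> H w (b w :: u)) ->
  (forall phi w, (forall u, H w u -> size u = size w -> phi u = 0) ->
     F phi w = 0) ->
  (forall phi w, (forall u, H w u -> size u = size w -> phi u = 0) ->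
     G phi w = 0) ->
  forall phi w, (forall u, H w u -> size u = (size w).+1 -> phi u = 0) ->
  cone F G b phi w = 0.
Proof.
move=> Hdel Hb HF HG phi w; move en: (size w) => n.
elim: n w en phi => [|n IH] w en phi phi0; first by rewrite /cone en.
have w0 : w <> [::] by move=> w0; rewrite w0 in en.
rewrite cone_recS // HF ?HG ?bd0 ?subrr ?subr0 // => [i iw|u Hu su|u Hu su].
- apply: IH => [|u Hu su]; first by rewrite size_del // en.
  by apply: phi0; [apply/Hb/Hdel; eassumption|rewrite /= su].
- by apply: phi0; [exact: Hb|rewrite /= su en].
- by apply: phi0; [exact: Hb|rewrite /= su en].
Qed.

Lemma cone_nat (V1 V1' : Type) (F1 G1 : (seq V1' -> A) -> seq V1 -> A)
    (b1 : seq V1 -> V1') (f : V -> V1) (f' : V' -> V1') :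
  (forall w, w <> [::] -> b1 (map f w) = f' (b w)) ->
  (forall phi w, F1 phi (map f w) = F (phi \o map f') w) ->
  (forall phi w, G1 phi (map f w) = G (phi \o map f') w) ->
  forall phi w,
    cone F1 G1 b1 phi (map f w) = cone F G b (phi \o map f') w.
Proof.
move=> fb fF fG phi w; move en: (size w) => n.
elim: n w en phi => [|n IH] w en phi; first by rewrite /cone size_map en.
have w0 : w <> [::] by move=> w0; rewrite w0 in en.
have fw0 : map f w <> [::] by case: (w) w0.
rewrite !cone_recS // fF fG fb //=; congr (_ - _).
rewrite bd_map; apply: eq_bd => i iw /=.
by rewrite IH // size_del // en.
Qed.

End ConeFunctoriality.

(** * Barycentric subdivision and its chain homotopy to the identity *)

Section Subdivision.
Variables (V : Type) (b : seq V -> V).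

(** Dual to Sd w = b(w) * Sd(boundary of w), the star being the cone. The apex [b] is a parameter,
    so the algebra is separated from the geometry of barycentres. *)
Fixpoint sd_rec n (phi : seq V -> A) (w : seq V) : A :=
  if n is n'.+1 then bd (sd_rec n' (fun u => phi (b w :: u))) w else phi w.

Definition sd phi w := sd_rec (size w) phi w.

Lemma sd_recS phi w : w <> [::] -> sd phi w = bd (sd (fun u => phi (b w :: u))) w.
Proof.
move=> w0; rewrite {1}/sd; case en: (size w) => [|n].
  by rewrite (size0nil en) in w0.
by rewrite /=; apply: eq_bd => i iw; rewrite /sd size_del // en.
Qed.

Lemma sdB phi psi w : sd (fun u => phi u - psi u) w = sd phi w - sd psi w.
Proof.
move en: (size w) => n; elim: n w en phi psi => [|n IH] w en phi psi.
  by rewrite /sd en.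
have w0 : w <> [::] by move=> w0; rewrite w0 in en.
rewrite !sd_recS // -bdB; apply: eq_bd => i iw.
by rewrite -IH // size_del // en.
Qed.

Lemma sd_bd phi w : sd (bd phi) w = bd (sd phi) w.
Proof.
move en: (size w) => n; elim: n w en phi => [|n IH] w en phi.
  by rewrite (size0nil en).
have w0 : w <> [::] by move=> w0; rewrite w0 in en.
rewrite sd_recS //=.
rewrite (eq_bd (psi := fun u =>
    sd phi u - bd (sd (fun u => phi (b w :: u))) u)).
  by rewrite (bdB (sd phi)) bd_bd subr0.
by move=> i iw; rewrite sdB IH // size_del // en.
Qed.

Definition sd_htp := cone (fun phi : seq V -> A => phi) sd b.

Lemma sd_htpB phi psi w :
  sd_htp (fun u => phi u - psi u) w = sd_htp phi w - sd_htp psi w.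
Proof. by apply: coneB => //; exact: sdB. Qed.

Lemma sd_htpE phi w : sd_htp (bd phi) w + bd (sd_htp phi) w = phi w - sd phi w.
Proof.
by rewrite /sd_htp cone_homotopy //; [exact: sdB|exact: sd_bd].
Qed.

Lemma sd_local (H : seq V -> seq V -> Prop) :
  (forall i w u, (i < size w)%N -> H (del i w) u -> H w u) ->
  (forall w u, w <> [::] -> H w u -> H w (b w :: u)) ->
  H [::] [::] ->
  forall phi w, (forall u, H w u -> size u = size w -> phi u = 0) ->
  sd phi w = 0.
Proof.
move=> Hdel Hb H0 phi w; move en: (size w) => n.
elim: n w en phi => [|n IH] w en phi phi0.
  by rewrite (size0nil en); apply: phi0; rewrite ?(size0nil en).
have w0 : w <> [::] by move=> w0; rewrite w0 in en.
rewrite sd_recS // bd0 // => i iw; apply: IH => [|u Hu su].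
  by rewrite size_del // en.
by apply: phi0; [apply/Hb/Hdel; eassumption|rewrite /= su].
Qed.

End Subdivision.

Lemma sd_nat (V V1 : Type) (b : seq V -> V) (b1 : seq V1 -> V1) (f : V -> V1) :
  (forall w, w <> [::] -> b1 (map f w) = f (b w)) ->
  forall phi w, sd b1 phi (map f w) = sd b (phi \o map f) w.
Proof.
move=> fb phi w; move en: (size w) => n.
elim: n w en phi => [|n IH] w en phi; first by rewrite /sd size_map en.
have w0 : w <> [::] by move=> w0; rewrite w0 in en.
have fw0 : map f w <> [::] by case: (w) w0.
rewrite !sd_recS // fb //= bd_map; apply: eq_bd => i iw /=.
by rewrite IH // size_del // en.
Qed.

Section Barycentric.
Variables (R : realType).

Definition bary (V : lmodType R) (w : seq V) : V :=
  (size w)%:R^-1 *: \sum_(x <- w) x.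

Definition convex_pred (V : lmodType R) (P : V -> Prop) : Prop :=
  forall k (c : 'I_k -> R) (x : 'I_k -> V), (forall i, 0 <= c i) ->
    \sum_i c i = 1 -> (forall i, P (x i)) -> P (\sum_i c i *: x i).

(** The vertices of [u] lie in the convex hull of [w], the hull being encoded as the intersection of
    all convex predicates that hold on [w]. This makes transitivity immediate. *)
Definition lies_over (V : lmodType R) (w u : seq V) : Prop :=
  forall P : V -> Prop, convex_pred P -> (forall x, x \in w -> P x) ->
    forall x, x \in u -> P x.

Lemma conv_bary (V : lmodType R) (P : V -> Prop) w :
  convex_pred P -> w <> [::] -> (forall x, x \in w -> P x) -> P (bary w).
Proof.
move=> cP w0 Pw; have s0 : (size w)%:R != 0 :> R.
  by rewrite pnatr_eq0 size_eq0; apply/eqP.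
rewrite /bary (big_nth 0) big_mkord scaler_sumr; apply: cP => [i||i].
- by rewrite invr_ge0.
- by rewrite sumr_const card_ord -[X in X *+ _]mulr1 -mulrnAr mulVf.
- by apply: Pw; rewrite mem_nth.
Qed.

Lemma bary_linear (V V1 : lmodType R) (f : {linear V -> V1}) w :
  bary (map f w) = f (bary w).
Proof. by rewrite /bary size_map big_map linearZ [in RHS]linear_sum. Qed.

Lemma over_del (V : lmodType R) i (w u : seq V) :
  (i < size w)%N -> lies_over (del i w) u -> lies_over w u.
Proof.
by move=> iw wu P cP Pw; apply: wu => // x /del_sub; exact: Pw.
Qed.

Lemma over_bary (V : lmodType R) (w u : seq V) :
  w <> [::] -> lies_over w u -> lies_over w (bary w :: u).
Proof.
move=> w0 wu P cP Pw x; rewrite inE => /orP[/eqP ->|].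
  exact: conv_bary.
exact: wu.
Qed.

Lemma over_refl (V : lmodType R) (w : seq V) : lies_over w w.
Proof. by move=> P _; apply. Qed.

Lemma over_trans (V : lmodType R) (w u v : seq V) :
  lies_over w u -> lies_over u v -> lies_over w v.
Proof. by move=> wu uv P cP Pw; apply: uv => //; exact: wu. Qed.

Lemma sd_over (V : lmodType R) (phi : seq V -> A) w :
  (forall u, lies_over w u -> size u = size w -> phi u = 0) ->
  sd (@bary V) phi w = 0.
Proof.
apply: (sd_local (H := @lies_over V)).
- exact: over_del.
- exact: over_bary.
- exact: over_refl.
Qed.

Lemma sd_iter_over (V : lmodType R) j (phi : seq V -> A) w :
  (forall u, lies_over w u -> size u = size w -> phi u = 0) ->
  iter j (sd (@bary V)) phi w = 0.
Proof.
elim: j w => [|j IH] w phi0; first by apply: phi0 => //; exact: over_refl.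
apply: sd_over => u wu su; apply: IH => v uv sv; apply: phi0.
  exact: over_trans uv.
by rewrite sv.
Qed.

Lemma sd_htp_over (V : lmodType R) (phi : seq V -> A) w :
  (forall u, lies_over w u -> size u = (size w).+1 -> phi u = 0) ->
  sd_htp (@bary V) phi w = 0.
Proof.
apply: (cone_local (H := @lies_over V)).
- exact: over_del.
- exact: over_bary.
- by move=> psi u; apply => //; exact: over_refl.
- exact: sd_over.
Qed.

Definition diam_le (V : normedModType R) (r : R) (w : seq V) : Prop :=
  forall x y, x \in w -> y \in w -> `|x - y| <= r.

Lemma conv_ball (V : normedModType R) (a : V) r :
  convex_pred (fun x => `|a - x| <= r).
Proof.
move=> k c x c0 c1 ax.
have -> : a - \sum_i c i *: x i = \sum_i c i *: (a - x i).
  under [RHS]eq_bigr do rewrite scalerBr.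
  by rewrite sumrB -scaler_suml c1 scale1r.
rewrite (le_trans (ler_norm_sum _ _ _)) //.
rewrite -[leRHS]mul1r -c1 mulr_suml; apply: ler_sum => i _.
by rewrite normrZ (ger0_norm (c0 i)) ler_wpM2l.
Qed.

(** The barycentre minus [y] is the mean of the differences x - y; the one with x = y vanishes, so
    at most k of at most k+1 terms contribute, each of norm at most [r]. *)
Lemma dist_bary (V : normedModType R) k r (w : seq V) y :
  (size w <= k.+1)%N -> diam_le r w -> y \in w ->
  `|bary w - y| <= k%:R / k.+1%:R * r.
Proof.
move=> wk wr yw; have r0 : 0 <= r by apply: le_trans (wr _ _ yw yw).
have s0 : (0 < size w)%N by case: (w) yw.
have -> : bary w - y = (size w)%:R^-1 *: \sum_(x <- w) (x - y).
  rewrite big_split /= scalerDr; congr (_ + _).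
  rewrite big_const_seq count_predT iter_addr addr0 -scalerMnr scalerMnl -mulr_natr.
  by rewrite mulVf ?scale1r // pnatr_eq0 -lt0n.
rewrite normrZ ger0_norm ?invr_ge0 //.
have : `|\sum_(x <- w) (x - y)| <= (size w).-1%:R * r.
  rewrite (perm_big _ (perm_to_rem yw)) /= big_cons subrr add0r.
  rewrite (le_trans (ler_norm_sum _ _ _)) //.
  rewrite -(size_rem yw) mulr_natl -[X in _ *+ X]count_predT.
  rewrite -iter_addr_0 -big_const_seq big_seq [leRHS]big_seq.
  by apply: ler_sum => x /mem_rem xw; exact: wr.
case: (size w) s0 wk => // s _ sk /= hs.
rewrite mulrC ler_pdivrMr //; apply: le_trans hs _.
rewrite mulrAC ler_wpM2r // mulrAC ler_pdivlMr // -!natrM ler_nat; nia.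
Qed.

(** An edge of the subdivision either starts at the barycentre or already lies in a subdivided
    facet. The bound [k] is kept fixed in the induction so that all facets contract by the same
    factor. *)
Lemma sd_mesh (V : normedModType R) k r (phi : seq V -> A) w :
  (size w <= k.+1)%N -> diam_le r w ->
  (forall u, lies_over w u -> size u = size w -> diam_le (k%:R / k.+1%:R * r) u ->
     phi u = 0) ->
  sd (@bary V) phi w = 0.
Proof.
move en: (size w) => n; elim: n w en phi => [|n IH] w en phi nk wr phi0.
  rewrite (size0nil en) [LHS]phi0 //; rewrite (size0nil en) //.
have w0 : w <> [::] by move=> w0; rewrite w0 in en.
rewrite sd_recS // bd0 // => i iw; apply: IH => [|||u wu su ur].
- by rewrite size_del // en.
- exact: ltnW.
- by move=> x y /del_sub xw /del_sub yw; exact: wr.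
have wbu : lies_over w (bary w :: u) by apply: over_bary => //; exact: over_del wu.
have bu x : x \in u -> `|bary w - x| <= k%:R / k.+1%:R * r.
  (* The ball around the barycentre is convex and contains the vertices of [w], hence every point
     lying over them. *)
  move=> xu; apply: (over_del iw wu (conv_ball (a := _) (r := _))) xu => y yw.
  by apply: dist_bary => //; rewrite en.
apply: phi0 => //=; first by rewrite su.
move=> x y; rewrite !inE => /orP[/eqP ->|xu] /orP[/eqP ->|yu].
- rewrite subrr normr0 mulr_ge0 // ?divr_ge0 //.
  case: (w) w0 wr => // z w' _ wr.
  by have := wr z z; rewrite subrr normr0; apply; rewrite inE eqxx.
- exact: bu.
- by rewrite distrC; exact: bu.
- exact: ur.
Qed.

Lemma sd_iter_mesh (V : normedModType R) k j r (phi : seq V -> A) w :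
  (size w <= k.+1)%N -> diam_le r w ->
  (forall u, lies_over w u -> size u = size w ->
     diam_le ((k%:R / k.+1%:R) ^+ j * r) u -> phi u = 0) ->
  iter j (sd (@bary V)) phi w = 0.
Proof.
elim: j r w => [|j IH] r w wk wr phi0.
  by apply: phi0 => //; [exact: over_refl|rewrite expr0 mul1r].
apply: (sd_mesh wk wr) => u wu su ur; apply: IH ur _; first by rewrite su.
move=> v uv sv vr; apply: phi0; first exact: over_trans uv.
  by rewrite sv.
by rewrite exprSr -mulrA.
Qed.

Lemma sd_iter_bd (V : lmodType R) j (phi : seq V -> A) w :
  bd (iter j (sd (@bary V)) phi) w = iter j (sd (@bary V)) (bd phi) w.
Proof.
elim: j w => // j IH w; rewrite /= -sd_bd.
by congr (sd _ _ _); apply/funext => u; rewrite IH.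
Qed.

Lemma sd_iterB (V : lmodType R) j (phi psi : seq V -> A) w :
  iter j (sd (@bary V)) (fun u => phi u - psi u) w =
  iter j (sd (@bary V)) phi w - iter j (sd (@bary V)) psi w.
Proof.
elim: j w => // j IH w; rewrite /= -sdB.
by congr (sd _ _ _); apply/funext => u; rewrite IH.
Qed.

Lemma sd_iter_nat (V V1 : lmodType R) j (f : {linear V -> V1})
    (phi : seq V1 -> A) w :
  iter j (sd (@bary V1)) phi (map f w) =
  iter j (sd (@bary V)) (phi \o map f) w.
Proof.
elim: j w => // j IH w /=.
rewrite (sd_nat (b := @bary V)) => [|u _]; last exact: bary_linear.
by congr (sd _ _ _); apply/funext => u /=; rewrite IH.
Qed.

Lemma sd_htp_nat (V V1 : lmodType R) (f : {linear V -> V1})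
    (phi : seq V1 -> A) w :
  sd_htp (@bary V1) phi (map f w) = sd_htp (@bary V) (phi \o map f) w.
Proof.
apply: cone_nat => // [u _|psi u]; first exact: bary_linear.
by apply: sd_nat => v _; exact: bary_linear.
Qed.

End Barycentric.
End Words.

(** * Affine singular simplices *)

Lemma continuous_at_sum (R : realType) (T : topologicalType)
    (V : normedModType R) I (r : seq I) (P : pred I) (F : I -> T -> V) (x : T) :
  (forall i, P i -> {for x, continuous (F i)}) ->
  {for x, continuous (fun y => \sum_(i <- r | P i) F i y)}.
Proof. by move=> cF; apply: cvg_big => //; exact: add_continuous. Qed.

Section Affine.
Variable R : realType.

Definition lin (V : lmodType R) k (w : seq V) (x : 'rV[R]_k.+1) : V :=
  \sum_(j < k.+1) x 0 j *: w`_j.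

Lemma lin_map (V V1 : lmodType R) (f : {linear V -> V1}) k w (x : 'rV[R]_k.+1) :
  lin (map f w) x = f (lin w x).
Proof.
rewrite /lin linear_sum; apply: eq_bigr => j _; rewrite linearZ; congr (_ *: _).
have [jw|wj] := ltnP j (size w); first by rewrite (nth_map 0).
by rewrite !nth_default ?size_map // linear0.
Qed.

Lemma lin_conv (V : lmodType R) (P : V -> Prop) k (w : seq V) (x : 'rV[R]_k.+1) :
  convex_pred P -> size w = k.+1 -> (forall y, y \in w -> P y) -> stdsimplex R k x ->
  P (lin w x).
Proof.
move=> cP sw Pw [x0 x1]; apply: cP => // i.
by apply: Pw; rewrite mem_nth // sw.
Qed.

Lemma conv_stdsimplex n : convex_pred (stdsimplex R n).
Proof.
move=> k c x c0 c1 Sx; split=> [j|].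
  rewrite summxE sumr_ge0 // => i _; rewrite mxE mulr_ge0 //.
  by have [] := Sx i.
under eq_bigr do rewrite summxE.
rewrite exchange_big /= -[RHS]c1; apply: eq_bigr => i _.
under eq_bigr do rewrite mxE.
by rewrite -mulr_sumr; have [_ ->] := Sx i; rewrite mulr1.
Qed.

Lemma delta_simplex n (j : 'I_n.+1) : stdsimplex R n (delta_mx 0 j).
Proof.
split=> [i|]; first by rewrite mxE; case: (_ && _).
rewrite (bigD1 j) //= mxE !eqxx big1 ?addr0 // => i ij.
by rewrite mxE (negPf ij) andbF.
Qed.

Definition vertices n : seq 'rV[R]_n.+1 :=
  [seq delta_mx 0 j | j <- enum 'I_n.+1].

Lemma size_vertices n : size (vertices n) = n.+1.
Proof. by rewrite size_map -cardE card_ord. Qed.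

Lemma nth_vertices n (j : 'I_n.+1) : (vertices n)`_j = delta_mx 0 j.
Proof.
by rewrite (nth_map ord0) ?nth_ord_enum // -cardE card_ord.
Qed.

Lemma vertices_simplex n x : x \in vertices n -> stdsimplex R n x.
Proof. by case/mapP => j _ ->; exact: delta_simplex. Qed.

Lemma lin_vertices n (x : 'rV[R]_n.+1) : lin (vertices n) x = x.
Proof.
rewrite [RHS]row_sum_delta; apply: eq_bigr => j _.
by rewrite nth_vertices.
Qed.

Lemma over_simplex n (u : seq 'rV[R]_n.+1) :
  lies_over (vertices n) u -> forall y, y \in u -> stdsimplex R n y.
Proof.
by apply; [exact: conv_stdsimplex|exact: vertices_simplex].
Qed.

Definition face_mx n (i : 'I_n.+2) : 'M[R]_(n.+1, n.+2) :=
  \matrix_(k, j) (j == lift i k)%:R.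

Definition face_lin n (i : 'I_n.+2) : {linear 'rV[R]_n.+1 -> 'rV[R]_n.+2} :=
  mulmxr (face_mx i).

Lemma face_linE n i (x : 'rV[R]_n.+1) : face_lin i x = face_row i x.
Proof.
apply/rowP => j; rewrite !mxE; case: unliftP => [k ->|->] /=.
  rewrite (bigD1 k) //= mxE eqxx mulr1 big1 ?addr0 // => l lk.
  by rewrite mxE (inj_eq lift_inj) eq_sym (negPf lk) mulr0.
by rewrite big1 // => l _; rewrite mxE (negPf (neq_lift _ _)) mulr0.
Qed.

Lemma del_vertices n (i : 'I_n.+2) :
  del i (vertices n.+1) = map (face_lin i) (vertices n).
Proof.
have si : (i < size (vertices n.+1))%N by rewrite size_vertices.
apply: (@eq_from_nth _ 0) => [|j].
  by rewrite size_del // [RHS]size_map !size_vertices.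
rewrite size_del // size_vertices => jn.
rewrite nth_del // [RHS](nth_map 0) ?size_vertices //.
have -> : bump i j = lift i (Ordinal jn) by [].
rewrite nth_vertices [X in face_lin i X](nth_vertices (Ordinal jn)).
by rewrite /= -rowE; apply/rowP => k; rewrite !mxE eqxx /=.
Qed.

Lemma lin_face (V : lmodType R) k (u : seq V) (i : 'I_k.+2) (x : 'rV[R]_k.+1) :
  size u = k.+2 -> lin (del i u) x = lin u (face_row i x).
Proof.
move=> su; rewrite /lin [RHS](bigD1_ord i) //= mxE unlift_none scale0r add0r.
apply: eq_bigr => j _; rewrite mxE liftK /=; congr (_ *: _).
by rewrite nth_del // su.
Qed.

Lemma vertex0_subproof n : delta_mx 0 ord0 \in stdsimplex R n.
Proof. by apply/mem_set; exact: delta_simplex. Qed.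

Definition vertex0 n : stdsimplex R n := exist _ (delta_mx 0 ord0) (vertex0_subproof n).

(** A total map, because affine simplices are written with ambient vectors. Outside the simplex the
    value is an arbitrary vertex, and continuity is only claimed along maps that stay inside. *)
Definition to_simplex n (y : 'rV[R]_n.+1) : stdsimplex R n :=
  insubd (vertex0 n) y.

Lemma to_simplexK n (y : 'rV[R]_n.+1) :
  stdsimplex R n y -> val (to_simplex y) = y.
Proof. by move=> Sy; rewrite insubdK //; apply/mem_set. Qed.

Lemma val_simplexK n (x : stdsimplex R n) : to_simplex (val x) = x.
Proof. by apply: val_inj; rewrite to_simplexK //; exact: set_valP. Qed.

Lemma to_simplex_face n i (y : 'rV[R]_n.+1) : stdsimplex R n y ->
  to_simplex (face_lin i y) = face i (to_simplex y).
Proof.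
move=> Sy; apply: val_inj; rewrite [RHS]/= to_simplexK; last first.
  rewrite face_linE -[y]to_simplexK //; apply/set_mem.
  exact: face_row_subproof.
by rewrite face_linE -[in LHS](to_simplexK Sy).
Qed.

Lemma lin_continuous (V : normedModType R) k (w : seq V) :
  continuous (lin w : 'rV[R]_k.+1 -> V).
Proof.
move=> x; apply: continuous_at_sum => j _; apply: continuousZr_tmp.
exact: coord_continuous.
Qed.

Lemma val_continuous n : continuous (val : stdsimplex R n -> 'rV[R]_n.+1).
Proof. exact: initial_continuous. Qed.

Lemma to_simplex_continuous n (Z : topologicalType) (f : Z -> 'rV[R]_n.+1) :
  (forall z, stdsimplex R n (f z)) -> continuous f ->
  continuous (@to_simplex n \o f).
Proof.
move=> Sf cf; apply: continuous_comp_initial.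
suff -> : set_val \o (@to_simplex n \o f) = f by [].
by apply/funext => z; exact: to_simplexK.
Qed.

Lemma stdsimplex_norm n (x : 'rV[R]_n.+1) : stdsimplex R n x -> `|x| <= 1.
Proof.
move=> [x0 x1]; rewrite [`|x|]mx_normrE.
apply/bigmax_leP; split=> // -[i j] _ /=; rewrite (ord1 i) ger0_norm //.
by rewrite -x1 (bigD1 j) //= lerDl sumr_ge0.
Qed.

Lemma stdsimplex_compact n : compact (stdsimplex R n).
Proof.
apply: bounded_closed_compact.
  exists 1; split=> // r r1 x /stdsimplex_norm x1; apply/ltW.
  exact: le_lt_trans r1.
have -> : stdsimplex R n = \bigcap_(j in setT) [set x | 0 <= x 0 j] `&`
    [set x | \sum_j x 0 j = 1].
  apply/seteqP; split=> x [h1 h2]; split=> //; first by move=> j _; exact: h1.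
  by move=> j; exact: h1.
apply: closedI.
  apply: closed_bigI => j _.
  apply: (@preimage_closed _ _ (fun x : 'rV[R]_n.+1 => x 0 j) [set r | 0 <= r]).
    by move=> x _; exact: coord_continuous.
  exact: closed_ge.
apply: (@preimage_closed _ _ (fun x : 'rV[R]_n.+1 => \sum_j x 0 j) [set r | r = 1]).
  by move=> x _; apply: continuous_at_sum => j _; exact: coord_continuous.
exact: closed_eq.
Qed.

End Affine.

(** * The prism operator and homotopy invariance *)

Section Prism.
Variables (R : realType) (A : comNzRingType) (V : lmodType R).

Definition level (t : R) (phi : seq (V * R) -> A) (w : seq V) : A :=
  phi [seq (x, t) | x <- w].

(** The prism operator as an instance of the cone recursion: the apex is the bottom copy of the
    first vertex. Degenerate simplices occur, which unnormalised singular cochains allow. *)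
Definition prism (phi : seq (V * R) -> A) (w : seq V) : A :=
  cone (level 1) (level 0) (fun w => (head 0 w, 0)) phi w.

Lemma prismB phi psi w :
  prism (fun u => phi u - psi u) w = prism phi w - prism psi w.
Proof. exact: coneB. Qed.

Lemma prismE phi w :
  prism (bd phi) w + bd (prism phi) w = level 1 phi w - level 0 phi w.
Proof.
by apply: cone_homotopy => // psi u; rewrite /level bd_map.
Qed.

Definition in_cylinder (P : V -> Prop) (y : V * R) : Prop :=
  P y.1 /\ 0 <= y.2 <= 1.

Definition over_cylinder (w : seq V) (u : seq (V * R)) : Prop :=
  forall P : V -> Prop, (forall x, x \in w -> P x) ->
    forall y, y \in u -> in_cylinder P y.

Lemma prism_over phi w :
  (forall u, over_cylinder w u -> size u = (size w).+1 -> phi u = 0) ->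
  prism phi w = 0.
Proof.
apply: (cone_local (H := over_cylinder)).
- by move=> i v u iv vu P Pv; apply: vu => x /del_sub; exact: Pv.
- move=> v u v0 vu P Pv y; rewrite inE => /orP[/eqP ->|].
    split; last by rewrite /= lexx ler01.
    by apply: Pv; case: (v) v0 => //= a l _; rewrite inE eqxx.
  exact: vu.
- move=> psi v; apply; last by rewrite size_map.
  by move=> P Pv y /mapP[x xv ->]; split; [exact: Pv|rewrite /= ler01 lexx].
- move=> psi v; apply; last by rewrite size_map.
  by move=> P Pv y /mapP[x xv ->]; split; [exact: Pv|rewrite /= ler01 lexx].
Qed.

Lemma eq_prism phi psi w :
  (forall u, over_cylinder w u -> size u = (size w).+1 -> phi u = psi u) ->
  prism phi w = prism psi w.
Proof.
move=> e; apply/eqP; rewrite -subr_eq0 -prismB; apply/eqP.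
by apply: prism_over => u wu su; rewrite e // subrr.
Qed.

End Prism.

Lemma prism_nat (R : realType) (A : comNzRingType) (V V1 : lmodType R)
    (f : {linear V -> V1}) (phi : seq (V1 * R) -> A) w :
  prism phi (map f w) =
  prism (phi \o map (fun y : V * R => (f y.1, y.2))) w.
Proof.
apply: cone_nat => [[|x u]//|psi u|psi u]; by rewrite /level /= -!map_comp.
Qed.

Section EqSubdivision.
Variables (R : realType) (A : comNzRingType) (V : lmodType R).

Lemma eq_sd_iter_htp j (phi psi : seq V -> A) w :
  (forall u, lies_over w u -> size u = (size w).+1 -> phi u = psi u) ->
  iter j (sd (@bary R V)) (sd_htp (@bary R V) phi) w =
  iter j (sd (@bary R V)) (sd_htp (@bary R V) psi) w.
Proof.
move=> e; apply/eqP; rewrite -subr_eq0 -sd_iterB; apply/eqP.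
apply: sd_iter_over => u wu su.
rewrite -sd_htpB; apply: sd_htp_over => v uv sv; rewrite e ?subrr //.
  exact: over_trans uv.
by rewrite sv su.
Qed.

End EqSubdivision.

Section Singular.
Variables (R : realType) (A : comNzRingType) (T : topologicalType).

Definition sing (V : lmodType R) (f : V -> T) k (u : seq V) :
  stdsimplex R k -> T := fun x => f (lin u (val x)).

Lemma sing_face (V : lmodType R) (f : V -> T) k (u : seq V) (i : 'I_k.+2) :
  size u = k.+2 -> sing f u \o face i = sing f (del i u) :> (stdsimplex R k -> T).
Proof. by move=> su; apply/funext => x; rewrite /sing /= lin_face. Qed.

Lemma coboundary_sing (V : lmodType R) (f : V -> T) k (c : cochain R T A k) u :
  size u = k.+2 ->
  coboundary c (sing f u) = bd (fun v => c (sing f v)) u.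
Proof.
move=> su; rewrite bdE su; apply: eq_bigr => i _.
by rewrite sing_face.
Qed.

Lemma simplices_face n (U : set T) (s : stdsimplex R n.+1 -> T) i :
  simplices U s -> simplices U (s \o face i).
Proof.
move=> [cs sU]; split; last by move=> _ [x _ <-]; apply: sU; exists (face i x).
have -> : face i = @to_simplex R n.+1 \o (fun x => face_lin R i (val x)) :> (stdsimplex R n -> _).
  apply/funext => x /=; rewrite -[RHS]/(to_simplex (face_lin R i (val x))).
  by rewrite to_simplex_face ?val_simplexK //; exact: set_valP.
move=> x; apply: continuous_comp; last exact: cs.
apply: to_simplex_continuous => [z|y].
  rewrite face_linE; apply/set_mem; exact: face_row_subproof.
apply: continuous_comp; first exact: val_continuous.
have -> : (face_lin R i : 'rV_n.+1 -> _) = lin [seq face_lin R i v | v <- vertices R n].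
  by apply/funext => v; rewrite lin_map lin_vertices.
exact: lin_continuous.
Qed.

Lemma simplices_sub n (U V : set T) (s : stdsimplex R n -> T) :
  U `<=` V -> simplices U s -> simplices V s.
Proof. by move=> UV [cs sU]; split=> // x /sU /UV. Qed.

End Singular.

Lemma continuous_at_comp2 (Z X Y W : topologicalType) (f : Z -> X) (g : Z -> Y)
    (h : X -> Y -> W) (z : Z) :
  {for z, continuous f} -> {for z, continuous g} ->
  {for (f z, g z), continuous (fun p : X * Y => h p.1 p.2)} ->
  {for z, continuous (fun x => h (f x) (g x))}.
Proof.
move=> cf cg ch.
exact: (@continuous2_cvg _ _ _ _ (nbhs z) _ f g h (f z) (g z) ch cf cg).
Qed.

Section Homotopy.
Variables (R : realType) (A : comNzRingType) (T T' : topologicalType).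
Variable h : T -> R -> T'.

Definition htp_map n (s : stdsimplex R n -> T) (y : 'rV[R]_n.+1 * R) : T' :=
  h (s (to_simplex y.1)) y.2.

Definition prism_cochain n (c : cochain R T' A n.+1) : cochain R T A n :=
  fun s => prism (fun u => c (sing (htp_map s) u)) (vertices R n).

Lemma lin_fst n k (u : seq ('rV[R]_n.+1 * R)) (x : 'rV[R]_k.+1) :
  (lin u x).1 = lin (map fst u) x.
Proof.
by rewrite -[LHS]/((fst : {linear ('rV[R]_n.+1 * R)%type -> _}) _) -lin_map.
Qed.

Lemma lin_snd n k (u : seq ('rV[R]_n.+1 * R)) (x : 'rV[R]_k.+1) :
  (lin u x).2 = lin (map snd u : seq R) x.
Proof.
by rewrite -[LHS]/((snd : {linear ('rV[R]_n.+1 * R)%type -> _}) _) -lin_map.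
Qed.

Lemma convex_pred_01 : convex_pred (fun t : R => 0 <= t <= 1).
Proof.
move=> k c x c0 c1 x01; apply/andP; split.
  by apply: sumr_ge0 => i _; rewrite mulr_ge0 //; case/andP: (x01 i).
rewrite -c1; apply: ler_sum => i _.
by rewrite ler_piMr //; case/andP: (x01 i).
Qed.

Lemma over_cylinder_simplex n (u : seq ('rV[R]_n.+1 * R)) :
  over_cylinder (vertices R n) u ->
  forall y, y \in u -> in_cylinder (stdsimplex R n) y.
Proof. by apply; exact: vertices_simplex. Qed.

Lemma cylinder_lin n k (u : seq ('rV[R]_n.+1 * R)) (x : 'rV[R]_k.+1) :
  (forall y, y \in u -> in_cylinder (stdsimplex R n) y) -> size u = k.+1 ->
  stdsimplex R k x -> in_cylinder (stdsimplex R n) (lin u x).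
Proof.
move=> Hu su Sx; split.
  rewrite lin_fst; apply: lin_conv; rewrite ?size_map //.
    exact: conv_stdsimplex.
  by move=> y /mapP[z /Hu[? _] ->].
rewrite lin_snd; apply: (lin_conv convex_pred_01); rewrite ?size_map //.
by move=> y /mapP[z /Hu[_ ?] ->].
Qed.

Lemma htp_map_simplices (U : set T) (U' : set T') n k (s : stdsimplex R n -> T)
    (u : seq ('rV[R]_n.+1 * R)) :
  (forall x t, U x -> 0 <= t <= 1 ->
     {for (x, t), continuous (fun p : T * R => h p.1 p.2)}) ->
  (forall x t, U x -> 0 <= t <= 1 -> U' (h x t)) ->
  simplices U s ->
  (forall y, y \in u -> in_cylinder (stdsimplex R n) y) -> size u = k.+1 ->
  simplices U' (sing (htp_map s) u : stdsimplex R k -> T').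
Proof.
move=> ch hU [cs sU] Hu su.
have cyl (x : stdsimplex R k) := cylinder_lin Hu su (set_valP x).
split; last first.
  move=> _ [x _ <-]; rewrite /sing /htp_map; apply: hU.
    by apply: sU; exists (to_simplex (lin u (val x)).1).
  by have [_] := cyl x.
have clin : continuous (fun x : stdsimplex R k => lin u (val x)).
  move=> x; apply: continuous_comp; first exact: val_continuous.
  exact: lin_continuous.
have c1 : continuous (fun x : stdsimplex R k => s (to_simplex (lin u (val x)).1)).
  move=> x; apply: continuous_comp; last exact: cs.
  apply: to_simplex_continuous => [z|z]; first by have [] := cyl z.
  apply: (@continuous_comp _ _ _ (fun x : stdsimplex R k => lin u (val x)) fst).
    exact: clin.
  exact: cvg_fst.
have c2 : continuous (fun x : stdsimplex R k => (lin u (val x)).2).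
  move=> x.
  apply: (@continuous_comp _ _ _ (fun x : stdsimplex R k => lin u (val x)) snd).
    exact: clin.
  exact: cvg_snd.
move=> x; apply: continuous_at_comp2; [exact: c1|exact: c2|].
apply: ch; last by have [_] := cyl x.
by apply: sU; exists (to_simplex (lin u (val x)).1).
Qed.

Lemma sing_level n (s : stdsimplex R n -> T) t :
  sing (htp_map s) [seq (x, t) | x <- vertices R n] = fun x => h (s x) t.
Proof.
apply/funext => x; rewrite /sing /htp_map lin_fst lin_snd.
have -> : map fst [seq (x, t) | x <- vertices R n] = vertices R n.
  by rewrite -map_comp -[RHS]map_id; apply: eq_map.
rewrite lin_vertices val_simplexK -map_comp; congr h.
rewrite /lin (eq_bigr (fun j => t * val x 0 j)) => [|j _].
  by rewrite -mulr_sumr; have [_ ->] := set_valP x; rewrite mulr1.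
by rewrite (nth_map 0) ?size_vertices // mulrC.
Qed.

Lemma prism_cochain_face n (c : cochain R T' A n.+1)
    (s : stdsimplex R n.+1 -> T) (i : 'I_n.+2) :
  prism (fun u => c (sing (htp_map s) u)) (del i (vertices R n.+1)) =
  prism_cochain c (s \o face i).
Proof.
rewrite del_vertices prism_nat; apply: eq_prism => u /over_cylinder_simplex Hu.
rewrite size_vertices => su /=; congr c; apply/funext => x.
have [Sy _] := cylinder_lin Hu su (set_valP x).
rewrite /sing /htp_map !lin_fst !lin_snd -!map_comp /=.
congr (h (s _) _).
rewrite -to_simplex_face; last by rewrite -lin_fst.
by rewrite -lin_map -map_comp.
Qed.

Lemma prism_cochainE n (c : cochain R T' A n.+1)
    (s : stdsimplex R n.+1 -> T) :
  coboundary (prism_cochain c) s + prism_cochain (coboundary c) s =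
  c (fun x => h (s x) 1) - c (fun x => h (s x) 0).
Proof.
have := prismE (fun u => c (sing (htp_map s) u)) (vertices R n.+1).
rewrite /level !sing_level => <-; rewrite addrC; congr (_ + _).
  by apply: eq_prism => u _; rewrite size_vertices => su; rewrite coboundary_sing.
rewrite bdE size_vertices; apply: eq_bigr => i _.
by rewrite prism_cochain_face.
Qed.

Lemma prism_cochain0E (c : cochain R T' A 0) (s : stdsimplex R 0 -> T) :
  prism_cochain (coboundary c) s =
  c (fun x => h (s x) 1) - c (fun x => h (s x) 0).
Proof.
have := prismE (fun u => c (sing (htp_map s) u)) (vertices R 0).
rewrite /level !sing_level => <-.
(* The only face of a one-letter word is the empty word, where [cone] is 0; this replaces the
   missing coboundary term in degree 0. *)
rewrite bd0 => [|i]; last first.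
  rewrite size_vertices ltnS leqn0 => /eqP ->.
  by rewrite /prism /cone size_del size_vertices.
rewrite addr0; apply: eq_prism => u _.
by rewrite size_vertices => su; rewrite coboundary_sing.
Qed.

Lemma prism_cochain_vanishes (U : set T) (U' : set T') n
    (c : cochain R T' A n.+1) :
  (forall x t, U x -> 0 <= t <= 1 ->
     {for (x, t), continuous (fun p : T * R => h p.1 p.2)}) ->
  (forall x t, U x -> 0 <= t <= 1 -> U' (h x t)) ->
  vanishes_on U' c -> vanishes_on U (prism_cochain c).
Proof.
move=> ch hU c0 s Us; apply: prism_over => u /over_cylinder_simplex Hu.
rewrite size_vertices => su; apply: c0.
exact: htp_map_simplices hU Us Hu su.
Qed.

(** The map [h] is total on the ambient space and continuity is asked only at points of U x [0,1]:
    the formulas used for flags and charts are not continuous everywhere. *)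
Lemma homotopy_cohomologous (U V : set T) (U' V' : set T') n
    (c : cochain R T' A n) : V `<=` U ->
  (forall x t, U x -> 0 <= t <= 1 ->
     {for (x, t), continuous (fun p : T * R => h p.1 p.2)}) ->
  (forall x t, U x -> 0 <= t <= 1 -> U' (h x t)) ->
  (forall x t, V x -> 0 <= t <= 1 -> V' (h x t)) ->
  cocycle U' V' c ->
  cohomologous U V (fun s => c (fun x => h (s x) 1))
                   (fun s => c (fun x => h (s x) 0)).
Proof.
move=> VU ch hU hV [c0 dc0].
have dP := prism_cochain_vanishes ch hU dc0.
case: n c c0 dc0 dP => [|n] c c0 dc0 dP.
  by move=> s Us; rewrite -prism_cochain0E dP.
exists (prism_cochain c); split.
  by apply: prism_cochain_vanishes c0 => // x t /VU; exact: ch.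
move=> s Us; rewrite -prism_cochainE // dP ?addr0 //.
Qed.

End Homotopy.

(** * Small simplices and excision *)

Section SmallSimplices.
Variables (R : realType) (T : topologicalType).

Lemma sing_simplices (W : set T) n k (s : stdsimplex R n -> T)
    (u : seq 'rV[R]_n.+1) :
  simplices W s -> (forall y, y \in u -> stdsimplex R n y) -> size u = k.+1 ->
  simplices W (sing (s \o @to_simplex R n) u : stdsimplex R k -> T).
Proof.
move=> [cs sW] Hu su.
have Sl (x : stdsimplex R k) :=
  lin_conv (@conv_stdsimplex R n) su Hu (set_valP x).
split; last by move=> _ [x _ <-]; apply: sW; exists (to_simplex (lin u (val x))).
move=> x; apply: (@continuous_comp _ _ _
  (@to_simplex R n \o (fun x : stdsimplex R k => lin u (val x))) s);
  last exact: cs.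
apply: to_simplex_continuous => // z.
by apply: continuous_comp; [exact: val_continuous|exact: lin_continuous].
Qed.

(** A Lebesgue number for the pulled back cover. Each point has a radius that works; half of it
    works uniformly nearby, and compactness makes one radius serve the whole simplex. *)
Lemma lebesgue_number (A' B' : set T) n (s : stdsimplex R n -> T) :
  open A' -> open B' -> simplices (A' `|` B') s ->
  exists2 e : R, 0 < e & forall x, stdsimplex R n x ->
    (forall y, stdsimplex R n y -> `|x - y| <= e -> A' (s (to_simplex y))) \/
    (forall y, stdsimplex R n y -> `|x - y| <= e -> B' (s (to_simplex y))).
Proof.
move=> oA oB [cs sAB].
have loc (C : set T) x : open C -> stdsimplex R n x -> C (s (to_simplex x)) ->
    exists2 r : R, 0 < r & forall y, stdsimplex R n y -> `|x - y| < r ->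
      C (s (to_simplex y)).
  move=> oC Sx Cx.
  have : nbhs (to_simplex x) (s @^-1` C) by apply: cs; exact: open_nbhs_nbhs.
  case=> _ [[W oW <-] /= Wx WC].
  have : nbhs x W.
    by move: Wx; rewrite [set_val _]to_simplexK // => Wx; exact: open_nbhs_nbhs.
  move=> /nbhs_normP[r /= r0 rW]; exists r => // y Sy xy.
  by apply: (WC (to_simplex y)) => /=; rewrite [set_val _]to_simplexK //; exact: rW.
have /compact_near_coveringP/(_ R (0^'+) (fun e x =>
    (forall y, stdsimplex R n y -> `|x - y| <= e -> A' (s (to_simplex y))) \/
    (forall y, stdsimplex R n y -> `|x - y| <= e -> B' (s (to_simplex y)))) _) :=
  @stdsimplex_compact R n.
case.
  move=> x Sx.
  have half (C : set T) : open C -> C (s (to_simplex x)) ->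
    \forall x' \near x & e \near 0^'+, forall y, stdsimplex R n y ->
      `|x' - y| <= e -> C (s (to_simplex y)).
    move=> oC Cx; have [r r0 rC] := loc C x oC Sx Cx.
    exists (ball x (r / 2), [set e | e < r / 2]).
      split => /=; first by apply: nbhsx_ballx; rewrite divr_gt0.
      by apply: nbhs_right_lt; rewrite divr_gt0.
    move=> [x' e] /= [+ er] y Sy xy; rewrite -ball_normE /= => xx'.
    apply: rC => //; rewrite (le_lt_trans (ler_distD x' _ _)) //.
    by rewrite [ltRHS]splitr ltrD // (le_lt_trans xy).
  have [Ax|Bx] : (A' `|` B') (s (to_simplex x)) by apply: sAB; exists (to_simplex x).
    by apply: filterS (half A' oA Ax) => -[x' e] /=; left.
  by apply: filterS (half B' oB Bx) => -[x' e] /=; right.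
move=> /= r /= r0 rP; exists (r / 2); first by rewrite divr_gt0.
apply: (rP (r / 2)) => //=.
  by rewrite /ball /= sub0r normrN gtr0_norm ?divr_gt0 // gtr_pMr // invf_lt1 // ltr1n.
by rewrite divr_gt0.
Qed.

End SmallSimplices.

Section Excision.
Variables (R : realType) (A : comNzRingType) (T : topologicalType).

(** Quantifying over every word above [u], of any length, makes smallness survive both further
    subdivision and the homotopy, which adds a vertex. *)
Definition small_word (C : set T) n (s : stdsimplex R n -> T)
    (u : seq 'rV[R]_n.+1) : Prop :=
  forall k (v : seq 'rV[R]_n.+1), lies_over u v -> size v = k.+1 ->
    range (sing (s \o @to_simplex R n) v : stdsimplex R k -> T) `<=` C.

(** After j subdivisions the mesh is at most (n/(n+1))^j times 2, since points of the simplex have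
    norm at most 1; eventually this is below the Lebesgue number. *)
Lemma iterated_subdivision_small (A' B' : set T) n (s : stdsimplex R n -> T) :
  open A' -> open B' -> simplices (A' `|` B') s ->
  exists N, forall j, (N <= j)%N -> forall phi : seq 'rV[R]_n.+1 -> A,
    (forall u, lies_over (vertices R n) u -> size u = n.+1 ->
       small_word A' s u \/ small_word B' s u -> phi u = 0) ->
    iter j (sd (@bary R _)) phi (vertices R n) = 0.
Proof.
move=> oA oB sAB; have [e e0 he] := lebesgue_number oA oB sAB.
have z1 : `|n%:R / n.+1%:R : R| < 1.
  by rewrite ger0_norm ?divr_ge0 // ltr_pdivrMr // mul1r ltr_nat.
have /cvgrPdist_lt/(_ _ e0)[N _ hN] := cvg_geometric (2 : R) z1.
exists N => j Nj phi phi0.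
apply: (@sd_iter_mesh _ _ _ n j 2) => [||u wu su ud].
- by rewrite size_vertices.
- move=> x y /vertices_simplex/stdsimplex_norm x1.
  move=> /vertices_simplex/stdsimplex_norm y1.
  by rewrite (le_trans (ler_normB _ _)) // (_ : 2 = 1 + 1) // lerD.
have ue : diam_le e u.
  move=> x y xu yu; apply: le_trans (ud _ _ xu yu) _.
  apply/ltW; have := hN j Nj; rewrite /= sub0r normrN mulrC.
  exact: le_lt_trans (ler_norm _).
have Su := over_simplex wu; rewrite size_vertices in su.
have x0u : head 0 u \in u by case: (u) su => //= a l _; rewrite inE eqxx.
have small (C : set T) : (forall y, stdsimplex R n y -> `|head 0 u - y| <= e ->
    C (s (to_simplex y))) -> small_word C s u.
  move=> hC k v uv sv _ [x _ <-]; rewrite /sing /=; apply: hC.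
    apply: lin_conv sv _ (set_valP x); first exact: conv_stdsimplex.
    exact: uv (@conv_stdsimplex R n) Su.
  have cb := @conv_ball R 'rV[R]_n.+1 (head 0 u) e.
  apply: (lin_conv cb sv) (set_valP x).
  by apply: uv cb _ => y yu; exact: ue.
apply: phi0 => //.
by have [/small|/small] := he _ (Su _ x0u); [left|right].
Qed.

(** The value of [c] on T(Sd^j s), where T is the homotopy from the identity to Sd; summed over j <
    N these give a homotopy from the identity to Sd^N. *)
Definition subdivision_htp j n (c : cochain R T A n.+1) : cochain R T A n :=
  fun s => iter j (sd (@bary R _)) (sd_htp (@bary R _)
    (fun u => c (sing (s \o @to_simplex R n) u))) (vertices R n).

Lemma subdivision_htp_face j n (c : cochain R T A n.+1)
    (s : stdsimplex R n.+1 -> T) (i : 'I_n.+2) :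
  iter j (sd (@bary R _)) (sd_htp (@bary R _)
    (fun u => c (sing (s \o @to_simplex R n.+1) u))) (del i (vertices R n.+1)) =
  subdivision_htp j c (s \o face i).
Proof.
rewrite del_vertices sd_iter_nat.
have -> : forall phi, sd_htp (@bary R 'rV[R]_n.+2) phi \o map (face_lin R i) =
    sd_htp (@bary R _) (phi \o map (face_lin R i)) :> (_ -> A).
  by move=> phi; apply/funext => u; exact: sd_htp_nat.
apply: eq_sd_iter_htp => u /over_simplex Su.
rewrite size_vertices => su /=; congr c; apply/funext => x.
rewrite /sing /= lin_map to_simplex_face //.
by apply: lin_conv su Su (set_valP x); exact: conv_stdsimplex.
Qed.

Lemma sing_vertices n (s : stdsimplex R n -> T) :
  sing (s \o @to_simplex R n) (vertices R n) = s.
Proof.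
by apply/funext => x; rewrite /sing /= lin_vertices val_simplexK.
Qed.

(** The coboundary of the j-th term is the difference of the values on Sd^j and Sd^(j+1), because
    the part involving [coboundary c] only sees simplices of [W] and vanishes; the sum
    telescopes. *)
Lemma coboundary_subdivision_htp (W : set T) N n (c : cochain R T A n.+1)
    (s : stdsimplex R n.+1 -> T) :
  vanishes_on W (coboundary c) -> simplices W s ->
  coboundary (fun s => \sum_(j < N) subdivision_htp j c s) s = c s -
  iter N (sd (@bary R _)) (fun u => c (sing (s \o @to_simplex R n.+1) u))
    (vertices R n.+1).
Proof.
move=> dc0 Ws; set phi := fun u => c _.
have step j w : lies_over (vertices R n.+1) w -> size w = n.+2 ->
    bd (iter j (sd (@bary R _)) (sd_htp (@bary R _) phi)) w =
    iter j (sd (@bary R _)) phi w - iter j.+1 (sd (@bary R _)) phi w.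
  move=> wo sw; rewrite sd_iter_bd iterSr.
  have -> : bd (sd_htp (@bary R _) phi) = fun w =>
      (phi w - sd (@bary R _) phi w) - sd_htp (@bary R _) (bd phi) w.
    by apply/funext => v; rewrite -sd_htpE addrAC subrr add0r.
  rewrite (sd_iterB _ (fun w => phi w - sd (@bary R _) phi w)) sd_iterB.
  rewrite [X in _ - X]sd_iter_over ?subr0 // => u wu su.
  apply: sd_htp_over => v uv sv.
  have wv : lies_over (vertices R n.+1) v.
    by apply: over_trans wo _; exact: over_trans uv.
  rewrite -coboundary_sing ?sv ?su ?sw //.
  apply: dc0; apply: sing_simplices Ws _ _; first exact: over_simplex wv.
  by rewrite sv su sw.
have -> : coboundary (fun s => \sum_(j < N) subdivision_htp j c s) s =
    bd (fun w => \sum_(j < N) iter j (sd (@bary R _)) (sd_htp (@bary R _) phi) w)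
       (vertices R n.+1).
  rewrite bdE size_vertices; apply: eq_bigr => i _; congr (_ * _).
  by apply: eq_bigr => j _; rewrite subdivision_htp_face.
rewrite (bd_sum N (fun j => iter j (sd (@bary R _)) (sd_htp (@bary R _) phi))).
rewrite (eq_bigr (fun j : 'I_N => - (iter j.+1 (sd (@bary R _)) phi (vertices R n.+1)
   - iter j (sd (@bary R _)) phi (vertices R n.+1)))); last first.
  move=> j _; rewrite opprB; apply: step; first exact: over_refl.
  exact: size_vertices.
rewrite sumrN -(big_mkord xpredT (fun j =>
  iter j.+1 (sd (@bary R _)) phi (vertices R n.+1) -
  iter j (sd (@bary R _)) phi (vertices R n.+1))) telescope_sumr //.
by rewrite opprB /= /phi sing_vertices.
Qed.

(* tau s sums [subdivision_htp j c s] over all j; by subdivision the sum is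
   finite for each s, though not uniformly in s. *)
Lemma small_cochain_exact (W A' B' : set T) n (c : cochain R T A n.+1) :
  open A' -> open B' -> W `<=` A' `|` B' ->
  vanishes_on (W `&` A') c -> vanishes_on (W `&` B') c ->
  vanishes_on W (coboundary c) ->
  exists tau : cochain R T A n,
    [/\ vanishes_on (W `&` A') tau, vanishes_on (W `&` B') tau &
        forall s, simplices W s -> c s = coboundary tau s].
Proof.
move=> oA oB WAB cA cB dc0.
have small0 k (s : stdsimplex R k -> T) u v : simplices W s ->
    lies_over (vertices R k) u -> small_word A' s u \/ small_word B' s u ->
    lies_over u v -> size v = n.+2 -> c (sing (s \o @to_simplex R k) v) = 0.
  move=> Ws wu sm uv sv.
  have wv : lies_over (vertices R k) v by exact: over_trans uv.
  have := sing_simplices Ws (over_simplex wv) sv.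
  move=> [cv vW]; case: sm => sm; [apply: cA|apply: cB]; split=> // y yv;
    split; [exact: vW| |exact: vW|]; exact: sm yv.
have fin (s : stdsimplex R n -> T) : exists N, simplices W s ->
    forall j, (N <= j)%N -> subdivision_htp j c s = 0.
  have [Ws|nWs] := pselect (simplices W s); last by exists 0%N.
  have [N hN] := iterated_subdivision_small oA oB (simplices_sub WAB Ws).
  exists N => _ j Nj; apply: hN => // u wu su sm.
  apply: sd_htp_over => v uv sv; apply: small0 uv _ => //.
  by rewrite sv su.
pose N s := projT1 (cid (fin s)).
have hN s : simplices W s -> forall j, (N s <= j)%N -> subdivision_htp j c s = 0.
  by rewrite /N; case: cid.
pose tau s := \sum_(j < N s) subdivision_htp j c s.
have tauE s M : simplices W s -> (N s <= M)%N ->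
    tau s = \sum_(j < M) subdivision_htp j c s.
  move=> Ws NM; rewrite /tau -!(big_mkord xpredT (fun j => subdivision_htp j c s)).
  rewrite [RHS](big_cat_nat _ NM) //= -[LHS]addr0; congr (_ + _).
  by rewrite big_nat big1 // => j /andP[Nj _]; exact: hN.
exists tau.
have van (C : set T) : (forall k (s : stdsimplex R k -> T) u,
    simplices (W `&` C) s ->  lies_over (vertices R k) u -> size u = n.+2 ->
    c (sing (s \o @to_simplex R k) u) = 0) -> vanishes_on (W `&` C) tau.
  move=> hC s Ws; rewrite /tau big1 // => j _.
  apply: sd_iter_over => u wu su; apply: sd_htp_over => v uv sv.
  apply: hC => //; first exact: over_trans uv.
  by rewrite sv su size_vertices.
split.
- by apply: van => k s u Ws wu su; apply: cA;
    apply: sing_simplices Ws (over_simplex wu) su.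
- by apply: van => k s u Ws wu su; apply: cB;
    apply: sing_simplices Ws (over_simplex wu) su.
move=> s Ws.
have [M hM] := iterated_subdivision_small oA oB (simplices_sub WAB Ws).
(* [K] is beyond the stopping index of every face of [s], so [tau] may be replaced by one uniform
   finite sum, and beyond the index where subdivision makes [s] itself small. *)
pose K := (M + \sum_(i < n.+2) N (s \o face i))%N.
have -> : coboundary tau s =
    coboundary (fun s => \sum_(j < K) subdivision_htp j c s) s.
  apply: eq_bigr => i _; congr (_ * _); apply: tauE.
    exact: simplices_face.
  by rewrite /K (bigD1 i) //= addnCA leq_addr.
rewrite (coboundary_subdivision_htp _ dc0 Ws) hM ?subr0 // ?leq_addr //.
move=> u wu su sm; apply: small0 sm _ _ => //; exact: over_refl.
Qed.

End Excision.

(** * Relative cohomology *)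

Section Cochains.
Variables (R : realType) (A : comNzRingType) (T : topologicalType).
Implicit Types U V W : set T.

Lemma coboundary_coboundary n (c : cochain R T A n) s :
  coboundary (coboundary c) s = 0.
Proof.
rewrite -[s]sing_vertices coboundary_sing ?size_vertices //.
rewrite -[RHS](bd_bd (fun u => c (sing (s \o @to_simplex R n.+2) u))
  (vertices R n.+2)).
apply: eq_bd => i isz; rewrite coboundary_sing // size_del // size_vertices //.
Qed.

Lemma eq_coboundary U n (c c' : cochain R T A n) s :
  (forall s, simplices U s -> c s = c' s) -> simplices U s ->
  coboundary c s = coboundary c' s.
Proof.
move=> e Us; apply: eq_bigr => i _; rewrite e //; exact: simplices_face.
Qed.

Lemma coboundaryD n (c c' : cochain R T A n) s :
  coboundary (fun s => c s + c' s) s = coboundary c s + coboundary c' s.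
Proof. by rewrite -big_split; apply: eq_bigr => i _; rewrite mulrDr. Qed.

Lemma coboundaryB n (c c' : cochain R T A n) s :
  coboundary (fun s => c s - c' s) s = coboundary c s - coboundary c' s.
Proof. by rewrite -sumrB; apply: eq_bigr => i _; rewrite mulrBr. Qed.

Lemma coboundaryZ n a (c : cochain R T A n) s :
  coboundary (fun s => a * c s) s = a * coboundary c s.
Proof. by rewrite mulr_sumr; apply: eq_bigr => i _; rewrite mulrCA. Qed.

Lemma coboundary_vanishes V n (c : cochain R T A n) :
  vanishes_on V c -> vanishes_on V (coboundary c).
Proof.
move=> c0 s Vs; rewrite /coboundary big1 // => i _; rewrite c0 ?mulr0 //.
exact: simplices_face.
Qed.

Lemma is_coboundary_eq U V n (c c' : cochain R T A n) :
  (forall s, simplices U s -> c s = c' s) ->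
  is_coboundary U V c -> is_coboundary U V c'.
Proof.
case: n c c' => [|n] c c' e /=; first by move=> c0 s Us; rewrite -e // c0.
by move=> [b [b0 cb]]; exists b; split=> // s Us; rewrite -e // cb.
Qed.

Lemma is_coboundary0 U V n (c : cochain R T A n) :
  vanishes_on U c -> is_coboundary U V c.
Proof.
case: n c => // n c c0; exists (fun=> 0); split=> // s Us; rewrite c0 //.
by rewrite /coboundary big1 // => i _; rewrite mulr0.
Qed.

Lemma is_coboundaryD U V n (c c' : cochain R T A n) :
  is_coboundary U V c -> is_coboundary U V c' ->
  is_coboundary U V (fun s => c s + c' s).
Proof.
case: n c c' => [|n] c c' /=.
  by move=> c0 c0' s Us; rewrite c0 ?c0' // addr0.
move=> [b [b0 cb]] [b' [b0' cb']]; exists (fun s => b s + b' s); split.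
  by move=> s Vs; rewrite b0 ?b0' // addr0.
by move=> s Us; rewrite coboundaryD cb ?cb'.
Qed.

Lemma is_coboundaryZ U V n a (c : cochain R T A n) :
  is_coboundary U V c -> is_coboundary U V (fun s => a * c s).
Proof.
case: n c => [|n] c /=; first by move=> c0 s Us; rewrite c0 // mulr0.
move=> [b [b0 cb]]; exists (fun s => a * b s); split.
  by move=> s Vs; rewrite b0 // mulr0.
by move=> s Us; rewrite coboundaryZ cb.
Qed.

Lemma is_coboundaryN U V n (c : cochain R T A n) :
  is_coboundary U V c -> is_coboundary U V (fun s => - c s).
Proof.
move=> /(is_coboundaryZ (-1)); apply: is_coboundary_eq => s _.
by rewrite mulN1r.
Qed.

Lemma is_coboundaryB U V n (c c' : cochain R T A n) :
  is_coboundary U V c -> is_coboundary U V c' ->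
  is_coboundary U V (fun s => c s - c' s).
Proof. by move=> cU /is_coboundaryN; exact: is_coboundaryD. Qed.

Lemma is_coboundary_sub U V U' V' n (c : cochain R T A n) :
  U' `<=` U -> V' `<=` V -> is_coboundary U V c -> is_coboundary U' V' c.
Proof.
move=> UU VV; case: n c => [|n] c /=.
  by move=> c0 s Us; apply: c0; exact: simplices_sub Us.
move=> [b [b0 cb]]; exists b; split=> s Us; [apply: b0|apply: cb];
  exact: simplices_sub Us.
Qed.

Lemma cocycle_sub U V U' V' n (c : cochain R T A n) :
  U' `<=` U -> V' `<=` V -> cocycle U V c -> cocycle U' V' c.
Proof.
move=> UU VV [c0 dc0]; split=> s Us; [apply: c0|apply: dc0];
  exact: simplices_sub Us.
Qed.

Lemma cocycleD U V n (c c' : cochain R T A n) :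
  cocycle U V c -> cocycle U V c' -> cocycle U V (fun s => c s + c' s).
Proof.
move=> [c0 dc0] [c0' dc0']; split=> s Us; first by rewrite c0 ?c0' // addr0.
by rewrite coboundaryD dc0 ?dc0' // addr0.
Qed.

Lemma cocycleZ U V n a (c : cochain R T A n) :
  cocycle U V c -> cocycle U V (fun s => a * c s).
Proof.
move=> [c0 dc0]; split=> s Us; first by rewrite c0 // mulr0.
by rewrite coboundaryZ dc0 // mulr0.
Qed.

Lemma cocycleN U V n (c : cochain R T A n) :
  cocycle U V c -> cocycle U V (fun s => - c s).
Proof.
have -> : (fun s => - c s) = (fun s => -1 * c s).
  by apply/funext => s; rewrite mulN1r.
exact: cocycleZ.
Qed.

Lemma cocycleB U V n (c c' : cochain R T A n) :
  cocycle U V c -> cocycle U V c' -> cocycle U V (fun s => c s - c' s).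
Proof. by move=> cU /cocycleN; exact: cocycleD. Qed.

Lemma cohomologous_trans U V n (a b c : cochain R T A n) :
  cohomologous U V a b -> cohomologous U V b c -> cohomologous U V a c.
Proof.
move=> ab bc; apply: is_coboundary_eq (is_coboundaryD ab bc) => s _.
by rewrite addrA subrK.
Qed.

Lemma cohomologous_sym U V n (a b : cochain R T A n) :
  cohomologous U V a b -> cohomologous U V b a.
Proof.
move=> ab; apply: is_coboundary_eq (is_coboundaryN ab) => s _.
by rewrite opprB.
Qed.

Lemma cohomologous_coboundary U V n (a b : cochain R T A n) :
  cohomologous U V a b -> is_coboundary U V b -> is_coboundary U V a.
Proof.
move=> ab /(is_coboundaryD ab); apply: is_coboundary_eq => s _.
by rewrite subrK.
Qed.

(** Cochains are functions on all maps, so one known on [U] extends by 0 with no compatibility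
    condition; what is lost is being a cocycle, and [small_exact] repairs that. *)
Definition extend0 U n (c : cochain R T A n) : cochain R T A n :=
  fun s => if pselect (simplices U s) then c s else 0.

Lemma extend0E U n (c : cochain R T A n) s :
  simplices U s -> extend0 U c s = c s.
Proof. by rewrite /extend0; case: pselect. Qed.

Lemma extend0_vanishes U V n (c : cochain R T A n) :
  vanishes_on (U `&` V) c -> vanishes_on V (extend0 U c).
Proof.
move=> c0 s Vs; rewrite /extend0; case: pselect => // Us.
by apply: c0; case: Us Vs => cs sU [_ sV]; split=> // y ys; split; auto.
Qed.

Definition rel_open W O := exists2 P1 : set T, open P1 & O = W `&` P1.

Lemma rel_open_sub W O : rel_open W O -> O `<=` W.
Proof. by case=> P1 _ -> x []. Qed.

Lemma small_exact W O V n (c : cochain R T A n.+1) :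
  rel_open W O -> rel_open W V -> W = O `|` V ->
  vanishes_on O c -> vanishes_on V c -> vanishes_on W (coboundary c) ->
  exists tau : cochain R T A n,
    [/\ vanishes_on O tau, vanishes_on V tau &
        forall s, simplices W s -> c s = coboundary tau s].
Proof.
move=> [P1 oO OE] [V' oV VE] WE; rewrite OE VE => cO cV dc.
apply: small_cochain_exact cO cV dc => //.
by rewrite {1}WE OE VE => x [[_ ?]|[_ ?]]; [left|right].
Qed.

Lemma simplices0_cover W O V (s : stdsimplex R 0 -> T) :
  W = O `|` V -> simplices W s -> simplices O s \/ simplices V s.
Proof.
move=> WE [cs sW].
have one (x y : stdsimplex R 0) : x = y.
  apply: val_inj; apply/rowP => j; rewrite (ord1 j).
  have [_] := set_valP x; rewrite big_ord1 => ->.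
  by have [_] := set_valP y; rewrite big_ord1 => ->.
have : W (s (vertex0 R 0)) by apply: sW; exists (vertex0 R 0).
by rewrite WE; case=> h; [left|right]; split=> // _ [x _ <-]; rewrite (one x (vertex0 R 0)).
Qed.

(** Injectivity in excision. A primitive on [O] is extended by 0; the remaining defect vanishes on
    the simplices of [O] and on those of [V], so it is exact by small simplices, with a primitive
    vanishing on both. *)
Lemma excision_coboundary W O V n (c : cochain R T A n) :
  rel_open W O -> rel_open W V -> W = O `|` V ->
  cocycle W V c -> is_coboundary O (O `&` V) c -> is_coboundary W V c.
Proof.
move=> rO rV WE [c0 dc0]; case: n c c0 dc0 => [|n] c c0 dc0 /=.
  by move=> cO s /(simplices0_cover WE)[/cO|/c0].
move=> [b [b0 cb]].
have b0V := extend0_vanishes b0.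
have [| | |tau [t0 tV tE]] := small_exact rO rV WE _ _
    (c := fun s => c s - coboundary (extend0 O b) s).
- move=> s Os; rewrite cb // (eq_coboundary (c' := b) _ Os) ?subrr //.
  by move=> s1; exact: extend0E.
- by move=> s Vs; rewrite c0 // (coboundary_vanishes b0V) // subr0.
- by move=> s Ws; rewrite coboundaryB coboundary_coboundary dc0 // subr0.
exists (fun s => extend0 O b s + tau s); split.
  by move=> s Vs; rewrite b0V // tV // addr0.
by move=> s Ws; rewrite coboundaryD -tE // addrC subrK.
Qed.

(** Surjectivity in excision, in a strong form: the correction [tau] vanishes on [O], so the
    extension restricts to [c] itself and not only to its class. *)
Lemma excision_extend W O V n (c : cochain R T A n) :
  rel_open W O -> rel_open W V -> W = O `|` V ->
  cocycle O (O `&` V) c ->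
  exists2 c' : cochain R T A n, cocycle W V c' &
    forall s, simplices O s -> c' s = c s.
Proof.
move=> rO rV WE [c0 dc0].
have cV := extend0_vanishes c0.
have cE s : simplices O s -> extend0 O c s = c s by exact: extend0E.
have [| | |tau [t0 tV tE]] := small_exact rO rV WE _ _ (c := coboundary (extend0 O c)).
- by move=> s Os; rewrite (eq_coboundary cE Os) dc0.
- exact: coboundary_vanishes.
- by move=> s Ws; rewrite coboundary_coboundary.
exists (fun s => extend0 O c s - tau s); last first.
  by move=> s Os; rewrite t0 // subr0 cE.
split; first by move=> s Vs; rewrite cV // tV // subrr.
by move=> s Ws; rewrite coboundaryB -tE // subrr.
Qed.

End Cochains.

Section Pullback.
Variables (R : realType) (A : comNzRingType) (T T' : topologicalType).

Definition pull (f : T -> T') n (c : cochain R T' A n) : cochain R T A n :=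
  fun s => c (f \o s).

Definition continuous_on (U : set T) (f : T -> T') : Prop :=
  forall x, U x -> {for x, continuous f}.

Variables (U V : set T) (U' V' : set T') (f : T -> T').
Hypotheses (cf : continuous_on U f) (VU : V `<=` U).
Hypotheses (fU : forall x, U x -> U' (f x)) (fV : forall x, V x -> V' (f x)).

Lemma simplices_comp (W : set T) (W' : set T') n (s : stdsimplex R n -> T) :
  W `<=` U -> (forall x, W x -> W' (f x)) ->
  simplices W s -> simplices W' (f \o s).
Proof.
move=> WU fW [cs sW]; split.
  move=> x; apply: continuous_comp; first exact: cs.
  by apply: cf; apply: WU; apply: sW; exists x.
by move=> _ [x _ <-]; apply: fW; apply: sW; exists x.
Qed.

Lemma pull_cocycle n (c : cochain R T' A n) :
  cocycle U' V' c -> cocycle U V (pull f c).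
Proof.
move=> [c0 dc0]; split=> s Us; first by apply: c0; exact: simplices_comp Us.
by rewrite -[LHS]/(coboundary c (f \o s)) dc0 //; exact: simplices_comp Us.
Qed.

Lemma pull_coboundary n (c : cochain R T' A n) :
  is_coboundary U' V' c -> is_coboundary U V (pull f c).
Proof.
case: n c => [|n] c /=.
  by move=> c0 s Us; apply: c0; exact: simplices_comp Us.
move=> [b [b0 cb]]; exists (pull f b); split=> s Us.
  by apply: b0; exact: simplices_comp Us.
by rewrite /pull cb //; exact: simplices_comp Us.
Qed.

End Pullback.

Lemma simplicesI (R : realType) (T : topologicalType) (U V : set T) n
    (s : stdsimplex R n -> T) :
  simplices U s -> simplices V s -> simplices (U `&` V) s.
Proof. by move=> [cs sU] [_ sV]; split=> // x sx; split; auto. Qed.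

(** If [c] vanishes on the intersection of [U] and [V], it is the difference of [cutoff U c], zero
    on [U], and of a cochain that is zero on [V]: the splitting behind the Mayer-Vietoris
    sequence. *)
Definition cutoff (R : realType) (A : nmodType) (T : topologicalType)
    (U : set T) n (c : cochain R T A n) : cochain R T A n :=
  fun s => if pselect (simplices U s) then 0 else c s.

Lemma cutoff_vanishes (R : realType) (A : nmodType) (T : topologicalType)
    (U : set T) n (c : cochain R T A n) : vanishes_on U (cutoff U c).
Proof. by move=> s Us; rewrite /cutoff; case: pselect. Qed.

Lemma cutoffB_vanishes (R : realType) (A : zmodType) (T : topologicalType)
    (U V : set T) n (c : cochain R T A n) :
  vanishes_on (U `&` V) c -> vanishes_on V (fun s => cutoff U c s - c s).
Proof.
move=> c0 s Vs; rewrite /cutoff; case: pselect => [Us|nUs] /=; last by rewrite subrr.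
by rewrite c0 ?subrr //; exact: simplicesI.
Qed.

(** * The Mayer-Vietoris connecting map *)

Section Linked.
Variables (R : realType) (A : comNzRingType) (T : topologicalType).
Variables (Y Vp Vm : set T).
Hypotheses (rp : rel_open Y Vp) (rm : rel_open Y Vm).

(* The connecting isomorphism of the Mayer-Vietoris sequence of (Y, Vp) and
   (Y, Vm), as a relation. *)
Definition linked n (a : cochain R T A n.+1) (b : cochain R T A n) : Prop :=
  exists p q : cochain R T A n,
    [/\ vanishes_on Vp p, vanishes_on Vm q,
        forall s, simplices Y s -> a s = coboundary p s,
        forall s, simplices Y s -> a s = coboundary q s &
        forall s, simplices Y s -> b s = p s - q s].

Let VpY := rel_open_sub rp.
Let VmY := rel_open_sub rm.

Lemma linkedB n (a a' : cochain R T A n.+1) b b' :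
  linked a b -> linked a' b' ->
  linked (fun s => a s - a' s) (fun s => b s - b' s).
Proof.
move=> [p [q [p0 q0 ap aq bpq]]] [p' [q' [p0' q0' ap' aq' bpq']]].
exists (fun s => p s - p' s), (fun s => q s - q' s); split=> s Ys.
- by rewrite p0 ?p0' // subrr.
- by rewrite q0 ?q0' // subrr.
- by rewrite coboundaryB ap ?ap'.
- by rewrite coboundaryB aq ?aq'.
- by rewrite bpq // bpq' //; ring.
Qed.

Lemma linkedZ n x (a : cochain R T A n.+1) b :
  linked a b -> linked (fun s => x * a s) (fun s => x * b s).
Proof.
move=> [p [q [p0 q0 ap aq bpq]]].
exists (fun s => x * p s), (fun s => x * q s); split=> s Ys.
- by rewrite p0 // mulr0.
- by rewrite q0 // mulr0.
- by rewrite coboundaryZ ap.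
- by rewrite coboundaryZ aq.
- by rewrite bpq // mulrBr.
Qed.

Lemma linked_cocycler n (a : cochain R T A n.+1) b :
  linked a b -> cocycle Y (Vp `&` Vm) b.
Proof.
move=> [p [q [p0 q0 ap aq bpq]]]; split=> s Vs; last first.
  by rewrite (eq_coboundary bpq) // coboundaryB -ap // -aq // subrr.
rewrite bpq; last by apply: simplices_sub Vs => x [/VpY].
by rewrite p0 ?q0 ?subrr //; apply: simplices_sub Vs => x [].
Qed.

Let rU : rel_open (Vp `|` Vm) Vp.
Proof.
case: rp => P oP PE; exists P => //; apply/seteqP; split=> [x Vx|x [+ Px]].
  by split; [left|move: Vx; rewrite PE => -[]].
by case=> [//|/VmY Yx]; rewrite PE.
Qed.

Let rU' : rel_open (Vp `|` Vm) Vm.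
Proof.
case: rm => P oP PE; exists P => //; apply/seteqP; split=> [x Vx|x [+ Px]].
  by split; [right|move: Vx; rewrite PE => -[]].
by case=> [/VpY Yx|//]; rewrite PE.
Qed.

Let UY : Vp `|` Vm `<=` Y.
Proof. by move=> x [/VpY|/VmY]. Qed.

(** The coboundary of [p] vanishes on the simplices inside [Vp] and on those inside [Vm], but
    possibly not on simplices that meet both; subtracting the correction [t] makes it vanish on the
    whole union. *)
Lemma linked_of n (b : cochain R T A n) : cocycle Y (Vp `&` Vm) b ->
  exists2 a : cochain R T A n.+1, linked a b & cocycle Y (Vp `|` Vm) a.
Proof.
move=> [b0 db].
pose p := cutoff Vp b; pose q : cochain R T A n := fun s => p s - b s.
have p0 : vanishes_on Vp p by exact: cutoff_vanishes.
have q0 : vanishes_on Vm q by exact: cutoffB_vanishes.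
have dpq s : simplices Y s -> coboundary p s = coboundary q s.
  by move=> Ys; rewrite /q coboundaryB db // subr0.
have [| | |t [tp tm tE]] := small_exact rU rU' erefl _ _ (c := coboundary p).
- exact: coboundary_vanishes.
- move=> s Vs; rewrite dpq ?(coboundary_vanishes q0) //.
  exact: simplices_sub Vs.
- by move=> s _; rewrite coboundary_coboundary.
exists (coboundary (fun s => p s - t s)).
  exists (fun s => p s - t s), (fun s => q s - t s); split=> // s Ys.
  - by rewrite p0 // tp // subrr.
  - by rewrite q0 // tm // subrr.
  - by rewrite (coboundaryB p t) (coboundaryB q t) dpq.
  - by rewrite /q; ring.
split=> s Us; last by rewrite coboundary_coboundary.
by rewrite coboundaryB -tE // subrr.
Qed.

(** A primitive of [b], split by [cutoff], first gives a primitive [r] of [a] that vanishes on the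
    two pieces separately. Since [coboundary r] vanishes on the union, small simplices then correct
    [r] to vanish there too. Degree 0 is separate because a point lies in one piece. *)
Lemma linked_coboundaryl n (a : cochain R T A n.+1) b :
  cocycle Y (Vp `|` Vm) a -> linked a b ->
  is_coboundary Y (Vp `&` Vm) b -> is_coboundary Y (Vp `|` Vm) a.
Proof.
move=> [a0 da] [p [q [p0 q0 ap aq bpq]]] cb.
suff [r [rp0 rm0 ar]] : exists r : cochain R T A n, [/\ vanishes_on Vp r,
    vanishes_on Vm r & forall s, simplices Y s -> a s = coboundary r s].
  have dr s : simplices (Vp `|` Vm) s -> coboundary r s = 0.
    by move=> Us; rewrite -ar ?a0 //; exact: simplices_sub Us.
  case: n r a b p q a0 da p0 q0 ap aq bpq cb rp0 rm0 ar dr =>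
    [|n] r a b p q a0 da p0 q0 ap aq bpq cb rp0 rm0 ar dr.
    exists r; split=> // s Us.
    by have [/rp0|/rm0] := simplices0_cover erefl Us.
  have [t [tp tm tE]] := small_exact rU rU' erefl rp0 rm0 dr.
  exists (fun s => r s - coboundary t s); split=> s Us.
    by rewrite tE // subrr.
  by rewrite coboundaryB coboundary_coboundary subr0 ar.
case: n a b p q a0 da p0 q0 ap aq bpq cb =>
  [|n] a b p q a0 da p0 q0 ap aq bpq cb.
  exists p; split=> // s Vs; have Ys := simplices_sub VmY Vs.
  by have := bpq s Ys; rewrite (q0 s) // subr0 => <-; exact: cb.
case: cb => g [g0 bg].
pose gp := cutoff Vp g.
have gp0 : vanishes_on Vp gp by exact: cutoff_vanishes.
have gm0 : vanishes_on Vm (fun s => gp s - g s) by exact: cutoffB_vanishes.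
exists (fun s => p s - coboundary gp s); split=> s Ys.
- by rewrite p0 // (coboundary_vanishes gp0) // subrr.
- have := simplices_sub VmY Ys => Ys'.
  have -> : p s - coboundary gp s = q s - coboundary (fun s => gp s - g s) s.
    by rewrite coboundaryB -bg // bpq //; ring.
  by rewrite q0 // (coboundary_vanishes gm0) // subrr.
- by rewrite coboundaryB coboundary_coboundary subr0 ap.
Qed.

Hypothesis acp : forall n (c : cochain R T A n), cocycle Y Vp c -> is_coboundary Y Vp c.
Hypothesis acm : forall n (c : cochain R T A n), cocycle Y Vm c -> is_coboundary Y Vm c.

Lemma linked_to n (a : cochain R T A n.+1) : cocycle Y (Vp `|` Vm) a ->
  exists b, linked a b.
Proof.
move=> aU.
have [p [p0 ap]] := acp (cocycle_sub (@subset_refl _ Y) (@subsetUl _ Vp Vm) aU).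
have [q [q0 aq]] := acm (cocycle_sub (@subset_refl _ Y) (@subsetUr _ Vp Vm) aU).
by exists (fun s => p s - q s), p, q.
Qed.

Lemma linked_coboundaryr n (a : cochain R T A n.+1) b :
  linked a b -> is_coboundary Y (Vp `|` Vm) a -> is_coboundary Y (Vp `&` Vm) b.
Proof.
move=> [p [q [p0 q0 ap aq bpq]]] [g [g0 ag]].
have gp0 : vanishes_on Vp g.
  by move=> s Vs; apply: g0; apply: simplices_sub Vs; exact: subsetUl.
have gm0 : vanishes_on Vm g.
  by move=> s Vs; apply: g0; apply: simplices_sub Vs; exact: subsetUr.
have cp : cocycle Y Vp (fun s => p s - g s).
  split=> s Us; first by rewrite p0 // gp0 // subrr.
  by rewrite coboundaryB -ap // -ag // subrr.
have cq : cocycle Y Vm (fun s => q s - g s).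
  split=> s Us; first by rewrite q0 // gm0 // subrr.
  by rewrite coboundaryB -aq // -ag // subrr.
have := is_coboundaryB (is_coboundary_sub (@subset_refl _ Y) (@subIsetl _ Vp Vm) (acp cp))
  (is_coboundary_sub (@subset_refl _ Y) (@subIsetr _ Vp Vm) (acm cq)).
by apply: is_coboundary_eq => s Ys; rewrite bpq // opprB addrA subrK.
Qed.

End Linked.

(** * Thom classes and their behaviour under maps *)

Section Thom.
Variables (R : realType) (T : topologicalType).

Definition coef (A : comNzRingType) n (c : cochain R T int n) : cochain R T A n :=
  fun s => (c s)%:~R.

Lemma coboundary_coef (A : comNzRingType) n (c : cochain R T int n) s :
  coboundary (coef A c) s = coef A (coboundary c) s.
Proof.
rewrite /coef /coboundary rmorph_sum; apply: eq_bigr => i _.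
by rewrite rmorphM rmorphXn rmorphN1.
Qed.

Lemma cocycle_coef (A : comNzRingType) U V n (c : cochain R T int n) :
  cocycle U V c -> cocycle U V (coef A c).
Proof.
move=> [c0 dc0]; split=> s Us; first by rewrite /coef c0.
by rewrite coboundary_coef /coef dc0.
Qed.

Lemma is_coboundary_coef (A : comNzRingType) U V n (c : cochain R T int n) :
  is_coboundary U V c -> is_coboundary U V (coef A c).
Proof.
case: n c => [|n] c /=; first by move=> c0 s Us; rewrite /coef c0.
move=> [b [b0 cb]]; exists (coef A b); split=> s Us.
  by rewrite /coef b0.
by rewrite coboundary_coef /coef cb.
Qed.

Definition acyclic (U V : set T) : Prop :=
  forall (A : comNzRingType) n (c : cochain R T A n),
    cocycle U V c -> is_coboundary U V c.

(* For all coefficients, H^*(U, V; A) is A, in degree j, generated by the class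
   of tau. *)
Definition thom_class (U V : set T) j (tau : cochain R T int j) : Prop :=
  cocycle U V tau /\ forall A : comNzRingType,
  [/\ forall n (c : cochain R T A n), n <> j -> cocycle U V c ->
        is_coboundary U V c,
      forall c : cochain R T A j, cocycle U V c ->
        exists a : A, cohomologous U V c (fun s => a * coef A tau s) &
      forall a : A, is_coboundary U V (fun s => a * coef A tau s) -> a = 0].

Definition scales_class (U V : set T) j (tau : cochain R T int j) (g : T -> T)
    (e : int) : Prop :=
  cohomologous U V (pull g tau) (fun s => e * tau s).

Lemma linked_coef (A : comNzRingType) Y Vp Vm n (a : cochain R T int n.+1) b :
  linked Y Vp Vm a b -> linked Y Vp Vm (coef A a) (coef A b).
Proof.
move=> [p [q [p0 q0 ap aq bpq]]].
exists (coef A p), (coef A q); split=> s Ys.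
- by rewrite /coef p0.
- by rewrite /coef q0.
- by rewrite coboundary_coef /coef ap.
- by rewrite coboundary_coef /coef aq.
- by rewrite /coef bpq // rmorphB.
Qed.

(** With both pairs (Y, Vp) and (Y, Vm) acyclic the connecting map is an isomorphism and raises the
    degree of the Thom class by one. A map exchanging the two halves exchanges the two primitives
    [p] and [q], so it negates their difference: this is the source of all the signs. *)
Lemma thom_step (Y Vp Vm : set T) j (tau0 : cochain R T int j) :
  rel_open Y Vp -> rel_open Y Vm -> acyclic Y Vp -> acyclic Y Vm ->
  thom_class Y (Vp `&` Vm) tau0 ->
  exists2 tau : cochain R T int j.+1, thom_class Y (Vp `|` Vm) tau &
    forall g e, continuous_on Y g -> (forall x, Y x -> Y (g x)) ->
      scales_class Y (Vp `&` Vm) tau0 g e ->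
      ((forall x, Vp x -> Vp (g x)) -> (forall x, Vm x -> Vm (g x)) ->
        scales_class Y (Vp `|` Vm) tau g e) /\
      ((forall x, Vp x -> Vm (g x)) -> (forall x, Vm x -> Vp (g x)) ->
        scales_class Y (Vp `|` Vm) tau g (- e)).
Proof.
move=> rp rm acp acm [ctau0 th0].
have [tau ltau ctau] := linked_of rp rm ctau0.
have [VpY VmY] := (rel_open_sub rp, rel_open_sub rm).
exists tau.
  split=> // A; have [deg gen fr] := th0 A.
  have ctA := cocycle_coef A ctau; have ltA := linked_coef A ltau.
  split.
  - move=> [|n] c nj cc.
      have cp := cocycle_sub (@subset_refl _ Y) (@subsetUl _ Vp Vm) cc.
      (* In degree 0 a coboundary is a cochain vanishing on [Y], whatever the subspace. *)
      exact: (acp A 0%N c cp).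
    have [b cb] := linked_to (acp A) (acm A) cc.
    apply: (linked_coboundaryl rp rm cc cb); apply: deg.
      by move=> nj'; apply: nj; rewrite nj'.
    exact: linked_cocycler cb.
  - move=> c cc; have [b cb] := linked_to (acp A) (acm A) cc.
    have [a ba] := gen _ (linked_cocycler rp cb).
    exists a; apply: (linked_coboundaryl rp rm (b := fun s => b s - a * coef A tau0 s)) => //.
      by apply: cocycleB => //; exact: cocycleZ.
    by apply: linkedB => //; exact: linkedZ.
  - move=> a /(linked_coboundaryr (acp A) (acm A) (linkedZ a ltA)).
    exact: fr.
move=> g e cg gY sc.
have pullY n (s : stdsimplex R n -> T) : simplices Y s -> simplices Y (g \o s).
  by apply: (simplices_comp cg) => //.
case: (ltau) => p [q [p0 q0 ap aq bpq]].
split=> gp gm.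
  have l : linked Y Vp Vm (pull g tau) (pull g tau0).
    exists (pull g p), (pull g q); split=> s Ys.
    - by apply: p0; apply: (simplices_comp cg VpY) Ys.
    - by apply: q0; apply: (simplices_comp cg VmY) Ys.
    - exact: ap (pullY _ _ Ys).
    - exact: aq (pullY _ _ Ys).
    - exact: bpq (pullY _ _ Ys).
  apply: (linked_coboundaryl rp rm _ (linkedB l (linkedZ e ltau))) => //.
  apply: cocycleB; last exact: cocycleZ.
  apply: pull_cocycle ctau => //; first by move=> x [/VpY|/VmY].
  by move=> x [/gp|/gm]; [left|right].
have l : linked Y Vp Vm (pull g tau) (fun s => - pull g tau0 s).
  exists (pull g q), (pull g p); split=> s Ys.
  - by apply: q0; apply: (simplices_comp cg VpY) Ys.
  - by apply: p0; apply: (simplices_comp cg VmY) Ys.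
  - exact: aq (pullY _ _ Ys).
  - exact: ap (pullY _ _ Ys).
  - by rewrite /pull bpq ?opprB //; exact: pullY.
apply: (linked_coboundaryl rp rm _ (linkedB l (linkedZ (- e) ltau))).
  apply: cocycleB; last exact: cocycleZ.
  apply: pull_cocycle ctau => //; first by move=> x [/VpY|/VmY].
  by move=> x [/gp|/gm]; [right|left].
apply: is_coboundary_eq (is_coboundaryN sc) => s _.
by rewrite mulNr opprB opprK addrC.
Qed.

End Thom.

Section Contractions.
Variables (R : realType) (T : topologicalType).
Implicit Types U V : set T.

Lemma acyclic_homotopy U V (h : T -> R -> T) : V `<=` U ->
  (forall x t, U x -> 0 <= t <= 1 ->
     {for (x, t), continuous (fun p : T * R => h p.1 p.2)}) ->
  (forall x t, U x -> 0 <= t <= 1 -> U (h x t)) ->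
  (forall x t, V x -> 0 <= t <= 1 -> V (h x t)) ->
  (forall x, U x -> h x 0 = x) -> (forall x, U x -> V (h x 1)) ->
  acyclic R U V.
Proof.
move=> VU ch hU hV h0 h1 A n c cc.
have I1 : 0 <= (1 : R) <= 1 by rewrite ler01 lexx.
have := homotopy_cohomologous VU ch hU hV cc => /is_coboundaryN.
apply: is_coboundary_eq => s Us; have [cs sU] := Us.
have -> : (fun x => h (s x) 0) = s.
  by apply/funext => x; apply: h0; apply: sU; exists x.
rewrite (cc.1 (fun x => h (s x) 1)) ?sub0r ?opprK //; split.
  move=> x; apply: (@continuous_at_comp2 _ _ R _ s (fun=> 1) h).
  - exact: cs.
  - exact: cst_continuous.
  by apply: ch => //; apply: sU; exists x.
by move=> _ [x _ <-]; apply: h1; apply: sU; exists x.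
Qed.

Lemma sum_signs (A : comNzRingType) k :
  \sum_(i < k) (-1) ^+ i = (odd k)%:R :> A.
Proof.
elim: k => [|k IH]; first by rewrite big_ord0.
rewrite big_ord_recr /= IH -signr_odd.
by case: (odd k) => /=; rewrite ?expr1 ?subrr ?expr0 ?add0r.
Qed.

Lemma coboundary_cst (A : comNzRingType) n (a : A) (s : stdsimplex R n.+1 -> T) :
  coboundary (fun _ : stdsimplex R n -> T => a) s = (odd n)%:R * a.
Proof.
by rewrite /coboundary -mulr_suml sum_signs /= negbK.
Qed.

(** The start of the recursion: with no normal direction, the constant 1 is a Thom class of degree
    0. *)
Lemma thom_contractible U (h : T -> R -> T) x0 :
  U x0 ->
  (forall x t, U x -> 0 <= t <= 1 ->
     {for (x, t), continuous (fun p : T * R => h p.1 p.2)}) ->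
  (forall x t, U x -> 0 <= t <= 1 -> U (h x t)) ->
  (forall x, U x -> h x 0 = x) -> (forall x, U x -> h x 1 = x0) ->
  thom_class U set0 (fun=> 1 : int) (j := 0) (R := R).
Proof.
move=> Ux0 ch hU h0 h1.
have cst n : simplices U (fun _ : stdsimplex R n => x0).
  by split; [move=> x; exact: cst_continuous|move=> _ [x _ <-]].
have emp n (s : stdsimplex R n -> T) : simplices set0 s -> False.
  by case=> _ /(_ (s (vertex0 R n))); apply; exists (vertex0 R n).
have nul (A : comNzRingType) n (c : cochain R T A n) : vanishes_on set0 c.
  by move=> s /emp.
have coh (A : comNzRingType) n (c : cochain R T A n) : cocycle U set0 c ->
    cohomologous U set0 c (fun=> c (fun=> x0)).
  move=> cc; have := homotopy_cohomologous (@sub0set _ U) ch hU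
    (V' := set0) (fun _ _ => False_ind _) cc.
  move=> /cohomologous_sym; apply: is_coboundary_eq => s [cs sU].
  congr (c _ - c _); apply/funext => x; [apply: h0|apply: h1];
    by apply: sU; exists x.
split.
  by split=> [s /emp//|s Us]; rewrite (@coboundary_cst int) mul0r.
move=> A; split.
- case=> [//|n] c _ cc; apply: cohomologous_coboundary (coh A n.+1 c cc) _.
  (* The n+3 faces of a constant simplex coincide and alternate in sign, so for even n the cocycle
     condition makes the constant value vanish; for odd n a constant cochain is the coboundary of
     the same constant. *)
  have on : (~~ odd n)%:R * c (fun=> x0) = 0.
    have -> : ~~ odd n = odd n.+3 by rewrite /= negbK.
    by rewrite -sum_signs mulr_suml -[RHS](cc.2 _ (cst n.+2)).
  exists (fun=> c (fun=> x0)); split=> [s /emp//|s Us]; rewrite coboundary_cst.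
  case: (odd n) on => /=; rewrite ?mul1r // => ->; by rewrite mulr0.
- move=> c cc; exists (c (fun=> x0)).
  by apply: is_coboundary_eq (coh A 0%N c cc) => s _; rewrite /coef mulr1.
- by move=> a /(_ _ (cst 0%N)); rewrite /coef mulr1.
Qed.

End Contractions.

(** * The Thom class of a coordinate subspace *)

Section LinearThom.
Variables (R : realType) (M : nat) (D : rel 'I_M).
Implicit Types (ps : seq ('I_M * 'I_M)) (x : 'M[R]_M).

Lemma mx_continuous_at (Z : topologicalType) m n (f : Z -> 'M[R]_(m, n)) z :
  (forall i j, {for z, continuous (fun y => f y i j)}) ->
  {for z, continuous f}.
Proof.
move=> cf B [P zP PB].
have : \forall y \near z, forall i j, P i j (f y i j).
  apply: filter_forall => i; apply: filter_forall => j.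
  exact: cf (zP i j).
by apply: filterS => y Py; apply: PB.
Qed.

(** The model of a chart: a coordinate subspace of matrices, with [D] listing the free entries. *)
Definition mx_supp : set 'M[R]_M := [set x | forall i j, ~~ D i j -> x i j = 0].

(** The complement of the subspace on which the entries in [ps] vanish; those entries play the role
    of normal coordinates. *)
Definition nonzero_at ps : set 'M[R]_M :=
  [set x | has (fun p => x p.1 p.2 != 0) ps].

Definition flip_entries (b : 'I_M -> 'I_M -> bool) x : 'M[R]_M :=
  \matrix_(i, j) ((-1) ^+ b i j * x i j).

Lemma open_coord (f : R -> bool) i j : open [set r | f r] ->
  open [set x : 'M[R]_M | f (x i j)].
Proof. by move=> fo; apply: open_comp fo => x _; exact: coord_continuous. Qed.

Lemma open_nonzero_at ps : open (nonzero_at ps).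
Proof.
elim: ps => [|p ps IH].
  rewrite (_ : nonzero_at _ = set0); first exact: open0.
  by apply/seteqP; split.
rewrite (_ : nonzero_at _ = [set x : 'M[R]_M | x p.1 p.2 != 0] `|` nonzero_at ps).
  apply: openU => //; apply: (@open_coord (fun r => r != 0)); exact: open_neq.
by apply/seteqP; split=> x /=; [move=> /orP|move=> h; apply/orP].
Qed.

Definition line_to (y : 'M[R]_M) x (t : R) : 'M[R]_M := (1 - t) *: x + t *: y.

Lemma line_to_continuous y : continuous (fun p : 'M[R]_M * R => line_to y p.1 p.2).
Proof.
move=> p; apply: mx_continuous_at => i j.
have -> : (fun p : 'M[R]_M * R => line_to y p.1 p.2 i j) =
    (fun p => (1 - p.2) * p.1 i j + p.2 * y i j).
  by apply/funext => q; rewrite !mxE.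
have c2 : {for p, continuous (snd : 'M[R]_M * R -> R)} by exact: cvg_snd.
have c1 : {for p, continuous (fun p : 'M[R]_M * R => p.1 i j)}.
  apply: (@continuous_comp _ _ _ fst (fun x : 'M[R]_M => x i j)).
    exact: cvg_fst.
  exact: coord_continuous.
apply: continuousD.
  by apply: continuousM c1; apply: continuousB c2; exact: cst_continuous.
by apply: continuousM c2 _; exact: cst_continuous.
Qed.

Lemma line_to0 y x : line_to y x 0 = x.
Proof. by rewrite /line_to subr0 scale1r scale0r addr0. Qed.

Lemma line_to1 y x : line_to y x 1 = y.
Proof. by rewrite /line_to subrr scale1r scale0r add0r. Qed.

Lemma line_to_supp y x t : mx_supp y -> mx_supp x -> mx_supp (line_to y x t).
Proof. by move=> Yy Yx i j nD; rewrite !mxE Yx // Yy // !mulr0 addr0. Qed.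

(** Contract along straight lines to [r] times the elementary matrix at [p]. Entries in [ps] differ
    from [p], so they are only rescaled and stay nonzero for t < 1; the condition on entry [p] is
    preserved and holds at the end point. *)
Lemma acyclic_half p ps (f : R -> bool) (r : R) : D p.1 p.2 -> p \notin ps ->
  f r -> (forall a t, f a -> 0 <= t <= 1 -> f ((1 - t) * a + t * r)) ->
  acyclic R mx_supp (mx_supp `&` [set x | nonzero_at ps x \/ f (x p.1 p.2)]).
Proof.
move=> Dp pps fr fc; set y := r *: delta_mx p.1 p.2 : 'M[R]_M.
have yp : y p.1 p.2 = r by rewrite !mxE !eqxx mulr1.
have Yy : mx_supp y.
  move=> i j nD; rewrite !mxE; case: eqP => [ip|_] /=; last by rewrite mulr0.
  case: eqP => [jp|_] /=; last by rewrite mulr0.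
  by rewrite ip jp Dp in nD.
apply: (@acyclic_homotopy _ _ _ _ (line_to y)).
- by move=> x [].
- by move=> x t _ _; exact: line_to_continuous.
- by move=> x t Yx _; exact: line_to_supp.
- move=> x t [Yx Vx] t01; split; first exact: line_to_supp.
  have [->|t1] := eqVneq t 1; first by rewrite line_to1 /= yp; right.
  case: Vx => [/hasP[q qps xq]|fx]; [left|right].
    apply/hasP; exists q => //; have : q != p.
      by apply: contraNneq pps => <-.
    rewrite !mxE -pair_eqE /= => /negPf ->; rewrite mulr0 mulr0 addr0.
    by rewrite mulf_neq0 // subr_eq0 eq_sym.
  by rewrite /line_to mxE [(_ *: x) _ _]mxE [(t *: y) _ _]mxE yp; exact: fc.
- by move=> x _; exact: line_to0.
- by move=> x _; rewrite line_to1; split=> //; right; rewrite yp.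
Qed.

Lemma flip_continuous b : continuous (flip_entries b).
Proof.
move=> x; apply: mx_continuous_at => i j.
have -> : (fun y => flip_entries b y i j) = (fun x => (-1) ^+ b i j * x i j).
  by apply/funext => y; rewrite mxE.
by apply: continuousM; [exact: cst_continuous|exact: coord_continuous].
Qed.

Lemma flip_supp b x : mx_supp x -> mx_supp (flip_entries b x).
Proof. by move=> Yx i j nD; rewrite mxE Yx // mulr0. Qed.

Lemma nonzero_at_flip b ps x :
  nonzero_at ps x -> nonzero_at ps (flip_entries b x).
Proof.
move=> /hasP[q qps xq]; apply/hasP; exists q => //.
by rewrite mxE mulf_neq0 // signr_eq0.
Qed.

(** Induction on the normal coordinates. The half spaces x_p > 0 and x_p < 0, each enlarged by
    [nonzero_at ps], meet in the set for [ps] and have the set for [p :: ps] as union. A flip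
    exchanges them exactly when it reverses entry [p]. *)
Lemma thom_linear ps : uniq ps -> (forall p, p \in ps -> D p.1 p.2) ->
  exists2 tau : cochain R 'M[R]_M int (size ps),
    thom_class mx_supp (mx_supp `&` nonzero_at ps) tau &
    forall b, scales_class mx_supp (mx_supp `&` nonzero_at ps) tau
      (flip_entries b) ((-1) ^+ count (fun p => b p.1 p.2) ps).
Proof.
elim: ps => [|p ps IH].
  move=> _ _; have -> : mx_supp `&` nonzero_at [::] = set0.
    by apply/seteqP; split=> // x [].
  exists (fun=> 1); last first.
    by move=> b s _; rewrite /pull expr0 mul1r subrr.
  apply: (thom_contractible (h := line_to 0) (x0 := 0)).
  - by move=> i j _; rewrite mxE.
  - by move=> x t _ _; exact: line_to_continuous.
  - by move=> x t Yx _; apply: line_to_supp => // i j _; rewrite mxE.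
  - by move=> x _; exact: line_to0.
  - by move=> x _; exact: line_to1.
rewrite cons_uniq => /andP[pps ups] Dps; have Dp := Dps p (mem_head _ _).
have [|tau0 th0 sc0] := IH ups.
  by move=> q qps; apply: Dps; rewrite inE qps orbT.
pose half (f : R -> bool) := mx_supp `&` [set x | nonzero_at ps x \/ f (x p.1 p.2)].
pose pos (r : R) := 0 < r; pose neg (r : R) := r < 0.
have ro (f : R -> bool) : open [set r | f r] -> rel_open mx_supp (half f).
  move=> fo; exists (nonzero_at ps `|` [set x | f (x p.1 p.2)]) => //.
  by apply: openU; [exact: open_nonzero_at|exact: open_coord].
have acp : acyclic R mx_supp (half pos).
  apply: (acyclic_half (r := 1)) => //; rewrite /pos ?ltr01 // => a t a0 /andP[t0 t1].
  by have [->|nt] := eqVneq t 1; [rewrite subrr; lra|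
    rewrite ltr_pwDl ?mulr_ge0 // mulr_gt0 // subr_gt0 lt_neqAle nt].
have acm : acyclic R mx_supp (half neg).
  apply: (acyclic_half (r := -1)) => //; rewrite /neg ?ltrN10 // => a t a0 /andP[t0 t1].
  have [->|nt] := eqVneq t 1; first by rewrite subrr; lra.
  have t1' : 0 < 1 - t by rewrite subr_gt0 lt_neqAle nt.
  by have := mulr_gt0 t1' (_ : 0 < - a); rewrite oppr_gt0 => /(_ a0); lra.
have capE : half pos `&` half neg = mx_supp `&` nonzero_at ps.
  apply/seteqP; split=> [x [[Yx px] [_ mx]]|x [Yx nx]]; last first.
    by split; split=> //; left.
  split=> //; case: px => // px; case: mx => // mx.
  by move: (lt_trans px mx); rewrite ltxx.
have cupE : half pos `|` half neg = mx_supp `&` nonzero_at (p :: ps).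
  apply/seteqP; split=> [x [[Yx px]|[Yx px]]|x [Yx /orP[]]].
  - split=> //; apply/orP; case: px => [|px]; first by right.
    by left; rewrite gt_eqF.
  - split=> //; apply/orP; case: px => [|px]; first by right.
    by left; rewrite lt_eqF.
  - by rewrite neq_lt => /orP[xp|xp]; [right|left]; split=> //; right.
  - by left; split=> //; left.
rewrite -capE in th0 sc0.
have [||tau th sc] := thom_step (ro _ _) (ro _ _) acp acm th0.
- exact: open_gt.
- exact: open_lt.
exists tau; rewrite -cupE // => b.
have cf : continuous_on mx_supp (flip_entries b).
  by move=> x _; exact: flip_continuous.
have [] := sc _ _ cf (@flip_supp b) (sc0 b).
have im (f f' : R -> bool) : (forall r, f r -> f' ((-1) ^+ b p.1 p.2 * r)) ->
    forall x, half f x -> half f' (flip_entries b x).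
  move=> ff x [Yx hx]; split; first exact: flip_supp.
  case: hx => [nx|fx]; first by left; exact: nonzero_at_flip.
  by right; rewrite mxE; exact: ff.
rewrite /= addnC.
case bp: (b p.1 p.2) im => im pres exch.
  rewrite exprD expr1 mulrN1; apply: exch; apply: im => r;
    by rewrite /pos /neg expr1 mulN1r ?oppr_gt0 ?oppr_lt0.
rewrite addn0; apply: pres; apply: im => r; by rewrite /pos /neg expr0 mul1r.
Qed.

End LinearThom.

(** * Ordered set partitions as words *)

Section Words.
Variable M : nat.
Implicit Types w v : 'I_M -> nat.

Definition prefix_count w c k : nat := \sum_(l < M) ((l < k) && (w l < c))%N.

Definition word_codim w : nat :=
  \sum_(l' < M) \sum_(l < M) ((l < l') && (w l < w l'))%N.

Lemma word_codimE w : word_codim w = (\sum_(l < M) prefix_count w (w l) l)%N.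
Proof. by []. Qed.

Lemma leq_sum_eq (I : finType) (a b : I -> nat) :
  (forall i, b i <= a i)%N -> (\sum_i a i <= \sum_i b i)%N -> forall i, a i = b i.
Proof.
move=> ba sab i; apply/eqP; rewrite eqn_leq ba andbT.
move: sab; rewrite (bigD1 i) //= [X in (_ <= X)%N](bigD1 i) //=.
have := leq_sum (P := fun j => j != i) (index_enum I) (fun j _ => ba j).
by move: (bigop _ _ _) (bigop _ _ _) => x y; lia.
Qed.

Lemma prefix_countS w c (l : 'I_M) :
  prefix_count w c l.+1 = (prefix_count w c l + (w l < c))%N.
Proof.
rewrite /prefix_count [LHS](bigD1 l) //= [X in _ = (X + _)%N](bigD1 l) //=.
rewrite ltnSn ltnn /= add0n addnC; congr (_ + _)%N.
by apply: eq_bigr => i il; rewrite ltnS leq_eqVlt (inj_eq val_inj) (negPf il).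
Qed.

Section Compare.
Variables w v : 'I_M -> nat.
Hypothesis total : forall c, prefix_count w c M = prefix_count v c M.
Hypothesis dom : forall c k, (prefix_count v c k <= prefix_count w c k)%N.

Let later (u : 'I_M -> nat) c (l : 'I_M) : nat := (\sum_(l' < M) ((l < l') && (c < u l')))%N.

Let laterE u c (l : 'I_M) :
  (later u c l + (\sum_(l' < M) (l' <= l)%N) + prefix_count u c.+1 M =
   M + prefix_count u c.+1 l.+1)%N.
Proof.
rewrite -[X in (_ = X + _)%N](card_ord M) -sum1_card -!big_split /=.
apply: eq_bigr => l' _; rewrite ltn_ord !ltnS /= (ltnNge c) (ltnNge l).
by case: (l' <= l)%N; case: (u l' <= c)%N.
Qed.

(* Mixing the two words gives word_codim v <= mix <= word_codim w. *)
Let mix : nat := (\sum_(l < M) later w (v l) l)%N.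

Let mixE : mix = (\sum_(l' < M) prefix_count v (w l') l')%N.
Proof. by rewrite /mix /later exchange_big. Qed.

Let codE u : word_codim u = (\sum_(l < M) later u (u l) l)%N.
Proof. by rewrite /word_codim /later exchange_big. Qed.

Let cod_mix : (word_codim v <= mix)%N.
Proof.
rewrite codE; apply: leq_sum => l _.
have := laterE v (v l) l; have := laterE w (v l) l.
by rewrite total; have := dom (v l).+1 l.+1; lia.
Qed.

(** Strict monotonicity of the codimension along the dominance order. The chain through [mix]
    collapses to equalities, hence equality of prefix counts at each position's own letter; the
    words are then compared from the last position backwards. *)
Lemma word_codim_lt : (word_codim w <= word_codim v)%N -> w =1 v.
Proof.
move=> wv; have eqs : forall l, prefix_count w (w l) l = prefix_count v (w l) l.
  apply: leq_sum_eq => [l|]; first exact: dom.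
  by rewrite -word_codimE -mixE; exact: leq_trans cod_mix.
(* Removing the letter at [l]: the counts at threshold [w l] give w l <= v l, and domination at the
   next threshold excludes w l < v l. *)
have same n : (n <= M)%N -> forall c,
    prefix_count w c (M - n) = prefix_count v c (M - n).
  elim: n => [|n IH] nM c; first by rewrite subn0.
  have lM : (M - n.+1 < M)%N by lia.
  have e c' : prefix_count w c' (M - n.+1).+1 = prefix_count v c' (M - n.+1).+1.
    by rewrite subnSK // IH // ltnW.
  pose l := Ordinal lM.
  have e0 := e (w l); have e1 := e (w l).+1; have e2 := e c; move: e0 e1 e2.
  rewrite !(prefix_countS _ _ l) /= (eqs l) ltnn ltnS leqnn.
  have := dom (w l).+1 l => /=.
  case: (ltngtP (v l) (w l)) => /= [||->]; lia.
move=> l; have lM := ltn_ord l.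
have e (k : nat) : (k <= M)%N -> forall c, prefix_count w c k = prefix_count v c k.
  by move=> kM c; rewrite -(subKn kM) same // leq_subr.
have h c : (w l < c)%N = (v l < c)%N.
  have := e l.+1 lM c; rewrite !prefix_countS e ?(ltnW lM) //.
  by move=> /addnI; case: (w l < c)%N; case: (v l < c)%N.
by have := h (v l); have := h (w l); rewrite !ltnn; lia.
Qed.

End Compare.

End Words.

Section Blocks.
Variables (m M : nat) (e : 'I_m -> nat).
Implicit Types I J : {ffun 'I_m -> {set 'I_M}}.

(** The partition read as a word. For an ordered set partition the maximum ranges over the single
    block containing [l]; it merely makes the function total. *)
Definition blk I (l : 'I_M) : nat := \max_(i < m | l \in I i) i.

Lemma blkE I l i : I \in OSP M e -> l \in I i -> blk I l = i.
Proof.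
rewrite inE => /and3P[_ /forallP disj _] li.
rewrite /blk (bigD1 i) //= big1 ?maxn0 // => j /andP[lj ji].
have /forallP/(_ i)/implyP/(_ ji) := disj j.
by rewrite disjoint_subset => /fintype.subsetP/(_ l lj); rewrite inE li.
Qed.

Lemma blk_ex I l : I \in OSP M e -> exists2 i, l \in I i & blk I l = i.
Proof.
move=> OI; have : l \in (\bigcup_j I j)%SET.
  by move: OI; rewrite inE => /and3P[_ _ /eqP ->]; rewrite inE.
by case/finset.bigcupP => i _ li; exists i => //; exact: blkE OI li.
Qed.

Lemma mem_blk I l i : I \in OSP M e -> (l \in I i) = (blk I l == i :> nat).
Proof.
move=> OI; apply/idP/eqP => [|bi]; first exact: blkE.
by have [j lj] := blk_ex l OI; rewrite bi => /val_inj ->.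
Qed.

Lemma blk_inj I J : I \in OSP M e -> J \in OSP M e -> blk I =1 blk J -> I = J.
Proof.
move=> OI OJ b; apply/ffunP => i; apply/setP => l.
by rewrite (mem_blk _ _ OI) (mem_blk _ _ OJ) b.
Qed.

Lemma rank_count I (i : 'I_m) k : I \in OSP M e ->
  #|[set l in \bigcup_(j < m | (j <= i)%N) I j | (l < k)%N]%SET| =
  prefix_count (blk I) i.+1 k.
Proof.
move=> OI; rewrite -sum1dep_card big_mkcond /=; apply: eq_bigr => l _.
suff -> : (l \in \bigcup_(j < m | (j <= i)%N) I j)%SET = (blk I l < i.+1)%N.
  by rewrite andbC; case: (_ && _).
apply/finset.bigcupP/idP => [[j ji lj]|bi]; first by rewrite (blkE OI lj) ltnS.
by have [j lj bj] := blk_ex l OI; exists j => //; rewrite -bj.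
Qed.

Lemma codimE I : I \in OSP M e -> codim I = word_codim (blk I).
Proof.
move=> OI; rewrite /codim -sum1dep_card big_mkcond /= /word_codim.
rewrite [RHS]exchange_big pair_big /=; apply: eq_bigr => -[l l'] _ /=.
congr nat_of_bool; rewrite -[RHS]/(_ && _); congr (_ && _).
apply/existsP/idP => [[i /existsP[j /and3P[ij li lj]]]|].
  by rewrite (blkE OI li) (blkE OI lj).
have [i li ->] := blk_ex l OI; have [j lj ->] := blk_ex l' OI => ij.
by exists i; apply/existsP; exists j; rewrite ij li lj.
Qed.

Lemma sum_blk (P : pred nat) I : I \in OSP M e ->
  (\sum_(l < M) P (blk I l) = \sum_(i < m | P i) e i)%N.
Proof.
move=> OI; transitivity (\sum_(i < m | P i) #|I i|)%N; last first.
  apply: eq_bigr => i _; apply/eqP.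
  by move: OI; rewrite inE => /and3P[/forallP].
under [RHS]eq_bigr do rewrite -sum1_card big_mkcond.
rewrite [RHS]exchange_big /=; apply: eq_bigr => l _.
have [j lj bj] := blk_ex l OI; rewrite bj big_mkcond (bigD1 j) //= lj big1.
  by case: (P j).
move=> i ij; rewrite (mem_blk _ _ OI) bj eq_sym (inj_eq val_inj) (negPf ij).
by case: (P i).
Qed.

Lemma prefix_count_total I c : I \in OSP M e ->
  prefix_count (blk I) c M = (\sum_(i < m | (i < c)%N) e i)%N.
Proof.
move=> OI; rewrite -(sum_blk (fun b => b < c)%N OI).
by apply: eq_bigr => l _; rewrite ltn_ord.
Qed.

Lemma blk_lt I l : I \in OSP M e -> (blk I l < m)%N.
Proof. by move=> OI; have [i _ ->] := blk_ex l OI. Qed.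

Lemma prefix_count_dom I J : I \in OSP M e -> J \in OSP M e ->
  (forall (i : 'I_m) k, (k <= M)%N ->
    prefix_count (blk I) i.+1 k <= prefix_count (blk J) i.+1 k)%N ->
  forall c k, (prefix_count (blk I) c k <= prefix_count (blk J) c k)%N.
Proof.
move=> OI OJ h c k.
wlog kM : k / (k <= M)%N => [hw|].
  have [/hw //|Mk] := leqP k M.
  have e1 (u : 'I_M -> nat) : prefix_count u c k = prefix_count u c M.
    by apply: eq_bigr => l _; rewrite ltn_ord (ltn_trans _ Mk) ?ltn_ord.
  by rewrite !e1; exact: hw.
have [cm|mc] := leqP c m; last first.
  apply: leq_sum => l _; rewrite (ltn_trans (blk_lt l OI)) //.
  by rewrite (ltn_trans (blk_lt l OJ)).
case: c cm => [|c] cm; last exact: (h (Ordinal cm)).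
by rewrite /prefix_count big1 // => l _; rewrite ltn0 andbF.
Qed.

Lemma codim_lt I J : I \in OSP M e -> J \in OSP M e ->
  (forall (i : 'I_m) k, (k <= M)%N ->
    prefix_count (blk I) i.+1 k <= prefix_count (blk J) i.+1 k)%N ->
  I <> J -> (codim I < codim J)%N.
Proof.
move=> OI OJ /(prefix_count_dom OI OJ) dom IJ; rewrite !codimE // ltnNge.
apply/negP => le; apply: IJ; apply: blk_inj => // l; apply/esym.
apply: word_codim_lt le l => // c.
by rewrite !prefix_count_total.
Qed.

(** In the chart centred at the cell these index the matrix entries normal to it; the other free
    entries are tangent. *)
Definition normal_pairs (w : 'I_M -> nat) : seq ('I_M * 'I_M) :=
  [seq p : 'I_M * 'I_M <- enum {: 'I_M * 'I_M} |
    (p.1 < p.2)%N && (w p.1 < w p.2)%N].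

Lemma size_normal_pairs I : I \in OSP M e ->
  size (normal_pairs (blk I)) = codim I.
Proof.
move=> OI; rewrite codimE // /normal_pairs size_filter -sum1_count.
rewrite /word_codim exchange_big pair_big /= big_mkcond big_enum /=.
by apply: eq_bigr => p _; case: ifP.
Qed.

End Blocks.

(** * Parity of the reversed normal directions *)

Section Parity.

Lemma sum_pairs (g : nat -> nat) n :
  (forall a, (a < n)%N -> g (2 * a).+1 = g (2 * a)%N) ->
  (\sum_(0 <= l < 2 * n) g l = 2 * \sum_(0 <= a < n) g (2 * a))%N.
Proof.
elim: n => [|n IH] gE; first by rewrite !big_geq.
rewrite mulnS add2n !big_nat_recr //= IH => [|a an]; last by apply: gE; lia.
by rewrite gE //; lia.
Qed.

Definition in_pair (k l : nat) : bool := l./2 == k.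

(** Whether the k-th sign change, acting on a matrix by conjugation, reverses the entry at (l,
    l'). *)
Definition pair_sign (k l l' : nat) : bool := in_pair k l (+) in_pair k l'.

Variables (m N : nat) (d : 'I_m -> nat).

Lemma half_lt (l : 'I_(2 * N)) : (l./2 < N)%N.
Proof. by rewrite ltn_half_double -mul2n. Qed.

Definition half_ord (l : 'I_(2 * N)) : 'I_N := Ordinal (half_lt l).

Lemma blk_doubled (I : {ffun 'I_m -> {set 'I_N}}) l : I \in OSP N d ->
  blk (doubled I) l = blk I (half_ord l).
Proof.
move=> OI; have [i hi ->] := blk_ex (half_ord l) OI.
apply: (blkE (doubled_OSP OI)); rewrite ffunE inE; apply/existsP.
exists (half_ord l); rewrite hi /=.
by have := odd_double_half l; case: (odd l); lia.
Qed.

(* Words are extended to nat so that sums can be cut at arbitrary places. *)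
Definition extend_word (w : 'I_(2 * N) -> nat) (k : nat) : nat :=
  oapp w 0%N (insub k).

Lemma extend_wordE w (l : 'I_(2 * N)) : extend_word w l = w l.
Proof. by rewrite /extend_word valK. Qed.

Lemma count_normal (Q : nat -> nat -> bool) w :
  count (fun p : 'I_(2 * N) * 'I_(2 * N) => Q p.1 p.2) (normal_pairs w) =
  (\sum_(0 <= l < 2 * N) \sum_(0 <= l' < 2 * N)
    [&& l < l', extend_word w l < extend_word w l' & Q l l'])%N.
Proof.
rewrite /normal_pairs count_filter -sum1_count big_mkcond big_enum /=.
rewrite big_mkord; under [RHS]eq_bigr do rewrite big_mkord.
rewrite pair_big /=; apply: eq_bigr => -[l l'] _ /=.
rewrite !extend_wordE.
by case: (l < l')%N; case: (w l < w l')%N; case: (Q l l').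
Qed.

(** Rows 2a and 2a+1 contribute equally: they carry the same letter, and the pair (2a, 2a+1) itself
    is not normal. *)
Lemma count_normal_doubled (Q : nat -> nat -> bool) w :
  (forall l l' : 'I_(2 * N), half_ord l = half_ord l' -> w l = w l') ->
  (forall a l, Q (2 * a).+1 l = Q (2 * a)%N l) ->
  ~~ odd (count (fun p : 'I_(2 * N) * 'I_(2 * N) => Q p.1 p.2) (normal_pairs w)).
Proof.
move=> wE QE; rewrite count_normal sum_pairs ?oddM // => a aN.
have W2 : extend_word w (2 * a).+1 = extend_word w (2 * a)%N.
  have h0 : (2 * a < 2 * N)%N by lia.
  have h1 : ((2 * a).+1 < 2 * N)%N by lia.
  rewrite (extend_wordE w (Ordinal h0)) (extend_wordE w (Ordinal h1)).
  by apply: wE; apply: val_inj => /=; lia.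
apply: eq_bigr => l' _; rewrite W2 QE; congr nat_of_bool.
have [->|ne] := eqVneq l' (2 * a).+1; first by rewrite W2 !ltnn /= ?andbF.
by have -> : ((2 * a).+1 < l')%N = (2 * a < l')%N by lia.
Qed.

Lemma pair_sign_doubled (I : {ffun 'I_m -> {set 'I_N}}) k : I \in OSP N d ->
  ~~ odd (count (fun p : 'I_(2 * N) * 'I_(2 * N) => pair_sign k p.1 p.2)
    (normal_pairs (blk (doubled I)))).
Proof.
move=> OI; apply: count_normal_doubled => [l l' ll'|a l].
  by rewrite !blk_doubled // ll'.
by rewrite /pair_sign /in_pair; have -> : (2 * a).+1./2 = (2 * a)./2 by lia.
Qed.

Lemma codim_doubled_even (I : {ffun 'I_m -> {set 'I_N}}) : I \in OSP N d ->
  ~~ odd (codim (doubled I)).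
Proof.
move=> OI; rewrite -(size_normal_pairs (doubled_OSP OI)) -count_predT.
apply: (@count_normal_doubled (fun _ _ => true)) => // l l' ll'.
by rewrite !blk_doubled // ll'.
Qed.

Lemma undouble (J : {ffun 'I_m -> {set 'I_(2 * N)}}) :
  J \in OSP (2 * N) (twice d) ->
  (forall a, (a < N)%N ->
    extend_word (blk J) (2 * a).+1 = extend_word (blk J) (2 * a)%N) ->
  exists2 I, I \in OSP N d & J = doubled I.
Proof.
move=> OJ JE.
have dlt (a : 'I_N) : (2 * a < 2 * N)%N by have := ltn_ord a; lia.
pose f a := Ordinal (dlt a).
have bh l : blk J (f (half_ord l)) = blk J l.
  rewrite -(extend_wordE _ l) -(extend_wordE _ (f _)) /= -[in RHS](odd_double_half l).
  have := JE _ (half_lt l); rewrite -mul2n.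
  by case: (odd l) => //= ->.
pose I : {ffun 'I_m -> {set 'I_N}} := [ffun j => [set a | f a \in J j]%SET].
have OI : I \in OSP N d.
  rewrite inE; apply/and3P; split.
  - apply/forallP => j; rewrite ffunE -(eqn_pmul2l (isT : 0 < 2)%N).
    have := sum_blk (pred1 (j : nat)) OJ.
    rewrite (eq_bigl (pred1 j)) // big_pred1_eq /twice => <-.
    rewrite (eq_bigr (fun l : 'I_(2 * N) =>
      nat_of_bool (extend_word (blk J) l == j :> nat))); last first.
      by move=> l _; rewrite extend_wordE.
    rewrite -(big_mkord xpredT (fun l => nat_of_bool (extend_word (blk J) l == j :> nat))).
    rewrite sum_pairs ?big_mkord => [|a aN]; last by rewrite JE.
    rewrite -sum1dep_card big_mkcond; apply/eqP; congr (_ * _)%N.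
    apply: eq_bigr => a _; rewrite (mem_blk _ _ OJ) -(extend_wordE _ (f a)) /=.
    by case: eqP.
  - apply/forallP => i; apply/forallP => j; apply/implyP => ij.
    rewrite disjoint_subset; apply/fintype.subsetP => a; rewrite !ffunE !inE.
    rewrite !(mem_blk _ _ OJ) => /eqP ->.
    by rewrite (inj_eq val_inj).
  - apply/eqP/setP => a; rewrite inE; apply/finset.bigcupP.
    have [j fj _] := blk_ex (f a) OJ; exists j => //.
    by rewrite ffunE inE.
exists I => //; apply: (blk_inj OJ (doubled_OSP OI)) => l.
rewrite blk_doubled // -bh; have [j fj ->] := blk_ex (f (half_ord l)) OJ.
by apply/esym/(blkE OI); rewrite ffunE inE.
Qed.

(** Take the least k whose two positions carry different letters x and y. Positions before 2k come
    in equal pairs and contribute evenly. Among the later ones, the letters above x have the parity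
    of [x < y] and those above y the parity of [y < x]; exactly one of these is odd. The pair (2k,
    2k+1) is counted twice and drops out. *)
Lemma pair_sign_split (J : {ffun 'I_m -> {set 'I_(2 * N)}}) :
  J \in OSP (2 * N) (twice d) -> (forall I, I \in OSP N d -> J <> doubled I) ->
  exists2 k, (k < N)%N &
    odd (count (fun p : 'I_(2 * N) * 'I_(2 * N) => pair_sign k p.1 p.2)
      (normal_pairs (blk J))).
Proof.
move=> OJ ndJ; set W := extend_word (blk J).
have [k kN kmin] : exists2 k, (k < N)%N & W (2 * k).+1 <> W (2 * k)%N /\
    forall a, (a < k)%N -> W (2 * a).+1 = W (2 * a)%N.
  have ex : exists k, (k < N)%N && (W (2 * k).+1 != W (2 * k)%N).
    have [//|nex] := pselect (exists k, (k < N)%N && (W (2 * k).+1 != W (2 * k)%N)).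
    have [|I OI JI] := undouble OJ; last by case: (ndJ I OI).
    move=> a aN; apply/eqP; apply: contrapT => /negP h.
    by apply: nex; exists a; rewrite aN.
  case: (ex_minnP ex) => k /andP[kN /eqP kW] kmin; exists k => //; split=> // a ak.
  apply/eqP; apply: contrapT => /negP h.
  by have := kmin a; rewrite (ltn_trans ak kN) h => /(_ isT); rewrite leqNgt ak.
exists k => //; case: kmin => Wk kmin.
set x := W (2 * k)%N in Wk; set y := W (2 * k).+1 in Wk.
pose F (l l' : nat) : nat := ((l < l') && (W l < W l'))%N.
pose tail (c : nat) := (\sum_((2 * k).+2 <= l < 2 * N) (c < W l))%N.
(* Every block has even size, so the letters above [c] are even in number; the equal pairs before k
   are even too, which leaves the parity of the pair k. *)
have tailE c : odd (tail c) = (c < x)%N (+) (c < y)%N.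
  have : ~~ odd (\sum_(0 <= l < 2 * N) (c < W l))%N.
    rewrite big_mkord (eq_bigr (fun l : 'I_(2 * N) => nat_of_bool (c < blk J l)%N)).
      by rewrite (sum_blk (fun b => c < b)%N OJ) -big_distrr oddM.
    by move=> l _; rewrite /W extend_wordE.
  rewrite (@big_cat_nat _ _ _ (2 * k).+2) //=; last lia.
  rewrite !big_nat_recr //= (sum_pairs (g := fun l => nat_of_bool (c < W l)%N)).
    rewrite -/x -/y -[X in (_ + X)%N]/(tail c).
    have := oddM 2 (\sum_(0 <= a < k) (c < W (2 * a)))%N.
    move: (2 * _)%N => S /= Se; rewrite !oddD Se /= !oddb.
    by case: (c < x)%N; case: (c < y)%N; case: (odd _).
  by move=> a ak; rewrite kmin.
have pre c : ~~ odd (\sum_(0 <= l < 2 * k) (W l < c))%N.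
  by rewrite (sum_pairs (g := fun l => nat_of_bool (W l < c)%N)) ?oddM // => a /kmin ->.
have in_k l : in_pair k l = (l == 2 * k)%N || (l == (2 * k).+1)%N.
  by rewrite /in_pair; have := odd_double_half l; rewrite -mul2n; case: (odd l); lia.
pose A := (\sum_(0 <= l < 2 * N) \sum_(0 <= l' < 2 * N) F l l' * in_pair k l)%N.
pose B := (\sum_(0 <= l < 2 * N) \sum_(0 <= l' < 2 * N) F l l' * in_pair k l')%N.
pose D := (\sum_(0 <= l < 2 * N) \sum_(0 <= l' < 2 * N) F l l' * (in_pair k l && in_pair k l'))%N.
have -> : odd (count (fun p : 'I_(2 * N) * 'I_(2 * N) => pair_sign k p.1 p.2)
    (normal_pairs (blk J))) = odd (A + B)%N.
  (* [A] and [B] count the normal pairs whose first, respectively second, position is in the pair k.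
     Together they count the pairs with both positions there twice, whereas the sign ignores
     them. *)
  set C := count _ _; suff -> : (A + B = C + 2 * D)%N by rewrite oddD (oddM 2) addbF.
  rewrite /C (count_normal (pair_sign k)) /D big_distrr -!big_split /=.
  apply: eq_bigr => l _; rewrite big_distrr -!big_split /=; apply: eq_bigr => l' _.
  rewrite /F /pair_sign.
  by case: (l < l')%N; case: (_ < _)%N; case: (in_pair k l); case: (in_pair k l').
have two (g : nat -> nat) : (\sum_(0 <= l < 2 * N) g l * in_pair k l =
    g (2 * k) + g (2 * k).+1)%N.
  rewrite (@big_cat_nat _ _ _ (2 * k).+2) //=; last lia.
  rewrite [X in (_ + X)%N]big_nat [X in (_ + X)%N]big1 ?addn0; last first.
    by move=> l lk; rewrite in_k; lia.
  rewrite !big_nat_recr //= !in_k !eqxx orbT !muln1.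
  by rewrite big_nat big1 ?add0n // => l lk; rewrite in_k; lia.
have -> : A = (\sum_(0 <= l' < 2 * N) F (2 * k) l' + \sum_(0 <= l' < 2 * N) F (2 * k).+1 l')%N.
  rewrite -(two (fun l => \sum_(0 <= l' < 2 * N) F l l')%N).
  by apply: eq_bigr => l _; rewrite big_distrl.
have -> : B = (\sum_(0 <= l < 2 * N) F l (2 * k) + \sum_(0 <= l < 2 * N) F l (2 * k).+1)%N.
  rewrite -(two (fun l' => \sum_(0 <= l < 2 * N) F l l')%N) /B exchange_big.
  by apply: eq_bigr => l _; rewrite big_distrl.
have -> : (\sum_(0 <= l' < 2 * N) F (2 * k) l' = (x < y) + tail x)%N.
  rewrite (@big_cat_nat _ _ _ (2 * k).+2) //=; last lia.
  congr (_ + _)%N; last first.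
    by apply: eq_big_nat => l lk; rewrite /F (_ : (2 * k < l)%N) //; lia.
  rewrite !big_nat_recr //= /F ltnn /= ltnSn /= addn0.
  by rewrite big_nat big1 // => l /andP[_ lk]; rewrite ltnNge ltnW.
have -> : (\sum_(0 <= l' < 2 * N) F (2 * k).+1 l' = tail y)%N.
  rewrite (@big_cat_nat _ _ _ (2 * k).+2) //=; last lia.
  rewrite big_nat big1 ?add0n; last by move=> l lk; rewrite /F ltnNge (_ : (l <= _)%N) //; lia.
  by apply: eq_big_nat => l lk; rewrite /F (_ : (_ < l)%N) //; lia.
have -> : (\sum_(0 <= l < 2 * N) F l (2 * k) = \sum_(0 <= l < 2 * k) (W l < x))%N.
  rewrite (@big_cat_nat _ _ _ (2 * k)) //=; last lia.
  rewrite [X in (_ + X)%N]big_nat [X in (_ + X)%N]big1 ?addn0.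
    by apply: eq_big_nat => l /andP[_ lk]; rewrite /F lk.
  by move=> l /andP[lk _]; rewrite /F ltnNge lk.
have -> : (\sum_(0 <= l < 2 * N) F l (2 * k).+1 =
    \sum_(0 <= l < 2 * k) (W l < y) + (x < y))%N.
  rewrite (@big_cat_nat _ _ _ (2 * k).+1) //=; last lia.
  rewrite [X in (_ + X)%N]big_nat [X in (_ + X)%N]big1 ?addn0.
    rewrite big_nat_recr //= /F ltnSn; congr (_ + _)%N.
    by apply: eq_big_nat => l /andP[_ lk]; rewrite /F ltnW.
  by move=> l /andP[lk _]; rewrite /F ltnNge lk.
rewrite !oddD !tailE (negPf (pre x)) (negPf (pre y)) !oddb !ltnn /= addbF.
by move: Wk => /eqP; case: (ltngtP x y) => //= e; rewrite e eqxx.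
Qed.

End Parity.

(** * Orthogonal projectors *)

Section Projectors.
Variables (R : realType) (M : nat).
Implicit Types P Q b : 'M[R]_M.

Definition is_proj P : Prop := P^T = P /\ P *m P = P.

Lemma mul_tr_eq0 k n (v : 'M[R]_(k, n)) : v *m v^T = 0 -> v = 0.
Proof.
move=> vv; apply/matrixP => i j; rewrite mxE.
have := congr1 (fun A : 'M[R]_(k, k) => A i i) vv; rewrite !mxE => /eqP.
rewrite psumr_eq0 => [/allP/(_ j (mem_index_enum _))|l _].
  by rewrite mxE mulf_eq0 orbb => /eqP.
by rewrite mxE -expr2 sqr_ge0.
Qed.

Lemma unitmx_inj (n : nat) (A : 'M[R]_n) :
  (forall v : 'rV_n, v *m A = 0 -> v = 0) -> A \in unitmx.
Proof. by move=> h; rewrite -row_free_unit; exact: inj_row_free. Qed.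

Lemma proj_absorb k P (A : 'M[R]_(k, M)) :
  is_proj P -> (A <= P)%MS -> A *m P = A.
Proof. by move=> [_ PP] /submxP[C ->]; rewrite -mulmxA PP. Qed.

Lemma proj_eq P Q : is_proj P -> is_proj Q -> (P == Q)%MS -> P = Q.
Proof.
move=> pP pQ /andP[PQ QP].
have := proj_absorb pQ PQ; have := proj_absorb pP QP.
move=> /(congr1 trmx); rewrite trmx_mul pP.1 pQ.1 => -> e.
by rewrite -[LHS]e.
Qed.

(* P b b^T P is invertible on the row space of P only; 1 - P completes it. *)
Definition gram P b := P *m b *m b^T *m P + (1%:M - P).

Lemma mulmx_compl P : is_proj P -> P *m (1%:M - P) = 0.
Proof. by move=> [_ PP]; rewrite mulmxBr mulmx1 PP subrr. Qed.

Lemma compl_mulmx P : is_proj P -> (1%:M - P) *m P = 0.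
Proof. by move=> [_ PP]; rewrite mulmxBl mul1mx PP subrr. Qed.

Lemma compl_compl P : is_proj P -> (1%:M - P) *m (1%:M - P) = 1%:M - P.
Proof. by move=> pP; rewrite mulmxBr mulmx1 compl_mulmx // subr0. Qed.

Lemma gram_unit P b : is_proj P -> b \in unitmx -> gram P b \in unitmx.
Proof.
move=> pP ub; apply: unitmx_inj => v vG.
have vP : v *m P = v.
  have := congr1 (mulmx^~ (1%:M - P)) vG; rewrite /= mul0mx -mulmxA /gram mulmxDl.
  rewrite -[_ *m P *m (_ - _)]mulmxA mulmx_compl // mulmx0 add0r compl_compl //.
  by rewrite mulmxBr mulmx1 => /eqP; rewrite subr_eq0 => /eqP.
have : v *m b *m (v *m b)^T = 0.
  have := congr1 (mulmx^~ v^T) vG; rewrite /= mul0mx /gram mulmxDr mulmxDl.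
  rewrite -[v in X in X + _]vP in vG *.
  rewrite mulmxBr mulmx1 vP subrr mul0mx addr0 !mulmxA vP => h.
  have Pv : P *m v^T = v^T by rewrite -pP.1 -trmx_mul vP.
  by rewrite trmx_mul mulmxA -Pv mulmxA.
by move=> /mul_tr_eq0 vb; rewrite -[v](mulmxK ub) vb mul0mx.
Qed.

(** The orthogonal projector onto the row space of A = P b, by the formula A^T (A A^T)^-1 A with
    [gram] in place of the singular A A^T; it is visibly continuous in both arguments. *)
Definition proj_act P b := b^T *m P *m invmx (gram P b) *m P *m b.

Lemma gram_tr P b : is_proj P -> (gram P b)^T = gram P b.
Proof.
move=> [Pt _]; rewrite /gram raddfD raddfB /= !trmx_mul trmxK trmx1 Pt.
by rewrite !mulmxA.
Qed.

Lemma gram_mulP P b : is_proj P -> P *m gram P b = P *m b *m b^T *m P.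
Proof.
move=> pP; rewrite /gram mulmxDr mulmx_compl // addr0 !mulmxA.
by rewrite pP.2.
Qed.

Lemma proj_act_absorb P b : is_proj P -> b \in unitmx ->
  P *m b *m proj_act P b = P *m b.
Proof.
move=> pP ub; have uG := gram_unit pP ub.
rewrite /proj_act !mulmxA -gram_mulP // mulmxK //.
by rewrite pP.2.
Qed.

Lemma proj_act_proj P b : is_proj P -> b \in unitmx -> is_proj (proj_act P b).
Proof.
move=> pP ub; split.
  by rewrite /proj_act !trmx_mul trmxK trmx_inv gram_tr // pP.1 !mulmxA.
rewrite {1}/proj_act -!mulmxA [P *m (b *m _)]mulmxA proj_act_absorb //.
by rewrite /proj_act !mulmxA.
Qed.

Lemma proj_act_eqmx P b : is_proj P -> b \in unitmx ->
  (proj_act P b :=: P *m b)%MS.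
Proof.
move=> pP ub; apply/eqmxP/andP; split.
  by rewrite /proj_act -[_ *m P *m b]mulmxA submxMl.
by rewrite -{1}(proj_act_absorb pP ub) submxMl.
Qed.

Definition diagm (p : pred 'I_M) : 'M[R]_M := diag_mx (\row_l (p l)%:R).

Lemma diagmE p i j : diagm p i j = ((i == j) && p i)%:R.
Proof. by rewrite !mxE; case: eqP => [->|]; rewrite ?mulr1n ?mulr0n. Qed.

Lemma mul_diagm p n (A : 'M[R]_(M, n)) i j :
  (diagm p *m A) i j = (p i)%:R * A i j.
Proof. by rewrite mul_diag_mx !mxE. Qed.

Lemma mulmx_diagm p n (A : 'M[R]_(n, M)) i j :
  (A *m diagm p) i j = A i j * (p j)%:R.
Proof. by rewrite mul_mx_diag !mxE. Qed.

Lemma diagm_proj p : is_proj (diagm p).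
Proof.
split; first by rewrite tr_diag_mx.
by apply/matrixP => i j; rewrite mul_diagm diagmE -natrM mulnb andbCA andbb.
Qed.

Lemma diagmI p q : diagm p *m diagm q = diagm (predI p q).
Proof.
apply/matrixP => i j; rewrite mul_diagm !diagmE -natrM mulnb.
by congr (_%:R); case: eqP => /= [->|]; rewrite ?andbF.
Qed.

Lemma diagm_sub (p q : pred 'I_M) : (forall i, p i -> q i) ->
  (diagm p <= diagm q)%MS.
Proof.
move=> pq; apply/submxP; exists (diagm p); rewrite diagmI.
apply/matrixP => i j; rewrite !diagmE; congr (_ && _)%:R.
by rewrite /=; case pi: (p i) => //=; rewrite pq.
Qed.

Lemma eq_diagm (p q : pred 'I_M) : p =1 q -> diagm p = diagm q.
Proof. by move=> pq; apply/matrixP => i j; rewrite !diagmE pq. Qed.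

Lemma pid_diagm k : pid_mx k = diagm (fun l => (l < k)%N).
Proof. by apply/matrixP => i j; rewrite diagmE !mxE. Qed.

Lemma rank_diagm_le p : (\rank (diagm p) <= \sum_(l < M) p l)%N.
Proof.
have -> : (\sum_(l < M) p l = #|p|)%N.
  by rewrite -sum1_card [RHS]big_mkcond; apply: eq_bigr => l _; rewrite unfold_in; case: (p l).
have -> : diagm p = (\matrix_(i < M, k < #|p|) (i == enum_val k)%:R) *m
    (\matrix_(k < #|p|, j < M) (enum_val k == j)%:R).
  apply/matrixP => i j; rewrite diagmE !mxE.
  case pi: (p i); last first.
    rewrite andbF big1 // => k _; rewrite !mxE.
    case: eqP => [ik|]; last by rewrite mul0r.
    by have := enum_valP k; rewrite -ik unfold_in pi.
  rewrite andbT (bigD1 (enum_rank_in pi i)) //= !mxE enum_rankK_in // eqxx mul1r.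
  rewrite big1 ?addr0 // => k ki; rewrite !mxE; case: eqP => [ik|]; last by rewrite mul0r.
  by move: ki; rewrite -(inj_eq enum_val_inj) enum_rankK_in -?ik ?eqxx.
by rewrite (leq_trans (mxrankM_maxl _ _)) // rank_leq_col.
Qed.

(** The lower bound comes from the upper bound applied to [p] and to its complement, whose
    projectors add up to the identity. *)
Lemma rank_diagm p : \rank (diagm p) = (\sum_(l < M) p l)%N.
Proof.
apply/eqP; rewrite eqn_leq rank_diagm_le /=.
have e1 : diagm p + diagm (fun l => ~~ p l) = 1%:M.
  apply/matrixP => i j; rewrite mxE !diagmE mxE -natrD /=.
  by case: eqP; case: (p i).
have := mxrank_add (diagm p) (diagm (fun l => ~~ p l)); rewrite e1 mxrank1.
have := rank_diagm_le (fun l => ~~ p l).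
have : (\sum_(l < M) p l + \sum_(l < M) ~~ p l = M)%N.
  rewrite -big_split /= -[RHS](card_ord M) -sum1_card.
  by apply: eq_bigr => l _; case: (p l).
move: (\sum_(l < M) p l)%N (\sum_(l < M) ~~ p l)%N (\rank _) (\rank _) => x y z t; lia.
Qed.

End Projectors.

(** * Charts of the flag manifold centred at the Schubert cells *)

Section Charts.
Variables (R : realType) (m M : nat) (e : 'I_m -> nat).
Variable I : {ffun 'I_m -> {set 'I_M}}.
Hypothesis OI : I \in OSP M e.
Implicit Types (x : 'M[R]_M) (F : flagspace R m M).

Definition upto (i : nat) : 'M[R]_M := diagm R (fun l => (blk I l <= i)%N).
Definition exact_blk (i : nat) : 'M[R]_M := diagm R (fun l => blk I l == i).

Definition blk_lt_rel : rel 'I_M := fun l l' => (blk I l < blk I l')%N.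

(** The i-th space of the flag is spanned by the rows of 1 + x at positions of blocks up to [i]; x =
    0 is the coordinate flag of [I]. *)
Definition chart x : flagspace R m M :=
  fun i => proj_act (upto i) (1%:M + x).

(** The compression of the projector to the coordinate subspace of blocks up to [i], completed by
    the identity. On a flag it is invertible exactly when [F i] projects isomorphically onto that
    subspace. *)
Definition corner F (i : 'I_m) : 'M[R]_M :=
  upto i *m F i *m upto i + (1%:M - upto i).

(** For a position l in block i, row l of 1 + x is the unique vector of [F i] whose components in
    blocks up to i form the l-th unit vector; [dom_row] and [dom_transverse] give existence and
    uniqueness. *)
Definition chart_coord F : 'M[R]_M :=
  \sum_(i < m) exact_blk i *m invmx (corner F i) *m F i - 1%:M.

Definition chart_dom : set (flagspace R m M) :=
  [set F | Fl R M e F /\ forall i, corner F i \in unitmx].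

Lemma upto_proj i : is_proj (upto i). Proof. exact: diagm_proj. Qed.

Lemma rank_upto (i : 'I_m) : \rank (upto i) = (\sum_(j < m | (j <= i)%N) e j)%N.
Proof. by rewrite rank_diagm (sum_blk (fun b => b <= i)%N OI). Qed.

Lemma exact_upto i j : (i <= j)%N -> exact_blk i *m upto j = exact_blk i.
Proof.
move=> ij; rewrite diagmI; apply: eq_diagm => l /=.
by case: eqP => // ->.
Qed.

Lemma upto_sum i : (i < m)%N -> upto i = \sum_(j < m | (j <= i)%N) exact_blk j.
Proof.
move=> im; apply/matrixP => l l'; rewrite summxE diagmE.
under eq_bigr do rewrite diagmE.
have [j _ bj] := blk_ex l OI; rewrite bj big_mkcond (bigD1 j) //= big1.
  by rewrite addr0 eqxx; case: (j <= i)%N; rewrite ?andbT ?andbF.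
move=> k kj; have /negPf -> : (j != k :> nat)%N by rewrite eq_sym.
by rewrite andbF; case: (_ <= _)%N.
Qed.

Lemma exact_sum : \sum_(j < m) exact_blk j = 1%:M :> 'M[R]_M.
Proof.
apply/matrixP => l l'; rewrite summxE.
under eq_bigr do rewrite diagmE.
have [j _ bj] := blk_ex l OI; rewrite (bigD1 j) //= big1 ?addr0.
  by rewrite bj eqxx andbT mxE.
move=> k kj; have /negPf -> : (blk I l != k :> nat)%N by rewrite bj eq_sym.
by rewrite andbF.
Qed.

Lemma exact_exact (i j : 'I_m) :
  exact_blk i *m exact_blk j = if i == j then exact_blk i else 0.
Proof.
apply/matrixP => l l'; rewrite diagmI diagmE /=.
have [->|ij] := eqVneq i j; first by rewrite diagmE andbb.
rewrite mxE; case: eqP => //= _; case: eqP => //= ->.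
by rewrite (inj_eq val_inj) (negPf ij).
Qed.

(** Free entries of [x] strictly raise the block index, so the components of a kernel vector vanish
    by induction on that index. *)
Lemma unip_unit x : mx_supp blk_lt_rel x -> 1%:M + x \in unitmx.
Proof.
move=> Yx; apply: unitmx_inj => v v0.
have vE l : v 0 l = - \sum_l' v 0 l' * x l' l.
  apply/eqP; rewrite -addr_eq0; apply/eqP.
  have := congr1 (fun A : 'rV[R]_M => A 0 l) v0.
  by rewrite mulmxDr mulmx1 !mxE.
apply/rowP => l; rewrite mxE; move eb: (blk I l) => b.
elim/ltn_ind: b l eb => b IH l bl; rewrite vE big1 ?oppr0 // => l' _.
have [lt|nlt] := boolP (blk_lt_rel l' l); last by rewrite Yx // mulr0.
by rewrite (IH (blk I l')) ?mul0r // -bl.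
Qed.

Lemma mx_suppM x (p q : pred 'I_M) : mx_supp blk_lt_rel x ->
  mx_supp blk_lt_rel (diagm R p *m x *m diagm R q).
Proof.
move=> Yx i j nij; rewrite mulmx_diagm mul_diagm Yx //.
by rewrite mulr0 mul0r.
Qed.

Lemma upto_le i j : (i <= j)%N -> (upto i <= upto j)%MS.
Proof. by move=> ij; apply: diagm_sub => l li; exact: leq_trans ij. Qed.

Lemma chart_proj x i : mx_supp blk_lt_rel x -> is_proj (chart x i).
Proof. by move=> /unip_unit; apply: proj_act_proj; exact: upto_proj. Qed.

Lemma chart_eqmx x (i : 'I_m) : mx_supp blk_lt_rel x ->
  (chart x i :=: upto i *m (1%:M + x))%MS.
Proof. by move=> /unip_unit; apply: proj_act_eqmx; exact: upto_proj. Qed.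

Lemma chart_Fl x : mx_supp blk_lt_rel x -> Fl R M e (chart x).
Proof.
move=> Yx; have uA := unip_unit Yx; split; first by move=> i; exact: chart_proj.
split=> [i|i j ij].
  by rewrite (chart_eqmx i Yx) mxrankMfree ?row_free_unit // rank_upto.
by rewrite !chart_eqmx //; apply: submxMr; exact: upto_le.
Qed.

Lemma corner_kernel (D F : 'M[R]_M) (v : 'rV[R]_M) : is_proj D -> is_proj F ->
  v *m (D *m F *m D + (1%:M - D)) = 0 -> v *m D = v /\ v *m F = 0.
Proof.
move=> pD pF vQ.
have vD : v *m D = v.
  have := congr1 (mulmx^~ (1%:M - D)) vQ; rewrite /= mul0mx -mulmxA mulmxDl.
  rewrite -[_ *m D *m (_ - _)]mulmxA mulmx_compl // mulmx0 add0r compl_compl //.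
  by rewrite mulmxBr mulmx1 => /eqP; rewrite subr_eq0 => /eqP.
have Dv : D *m v^T = v^T by rewrite -pD.1 -trmx_mul vD.
have vF : v *m F = 0.
  apply: mul_tr_eq0; rewrite trmx_mul pF.1 mulmxA -[v *m F *m F]mulmxA pF.2.
  have := congr1 (mulmx^~ v^T) vQ; rewrite /= mul0mx mulmxDr mulmxBr.
  by rewrite mulmx1 !mulmxA vD subrr addr0 -[v *m F *m D *m _]mulmxA Dv.
by split.
Qed.

(** A vector killed by the corner lies in the coordinate subspace and is orthogonal to the i-th
    space of the flag. Testing it against the rows spanning that space puts it in the kernel of 1 +
    D x D with D = [upto i], which is again unipotent. *)
Lemma chart_corner x i : mx_supp blk_lt_rel x -> corner (chart x) i \in unitmx.
Proof.
move=> Yx; rewrite /corner; have pF := chart_proj i Yx.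
have HF : upto i *m (1%:M + x) *m chart x i = upto i *m (1%:M + x).
  by apply: proj_absorb => //; rewrite chart_eqmx.
have uN : 1%:M + upto i *m x *m upto i \in unitmx.
  by apply: unip_unit; exact: mx_suppM.
move: (chart x i) (upto i) (upto_proj i) pF HF uN => F D pD pF HF uN.
apply: unitmx_inj => v vQ; have [vD vF] := corner_kernel pD pF vQ.
have Dv : D *m v^T = v^T by rewrite -pD.1 -trmx_mul vD.
have Hv : D *m (1%:M + x) *m v^T = 0.
  by rewrite -HF -mulmxA -pF.1 -trmx_mul vF trmx0 mulmx0.
have : (1%:M + D *m x *m D) *m v^T = 0.
  rewrite mulmxDl mul1mx -[D *m x *m D *m _]mulmxA Dv.
  by rewrite -{1}Dv -mulmxDl -[RHS]Hv mulmxDr mulmx1.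
by move=> /(congr1 (mulmx (invmx (1%:M + D *m x *m D)))); rewrite mulKmx // mulmx0 =>
  /(congr1 trmx); rewrite trmxK trmx0.
Qed.

Lemma chart_dom_chart x : mx_supp blk_lt_rel x -> chart_dom (chart x).
Proof. by move=> Yx; split=> [|i]; [exact: chart_Fl|exact: chart_corner]. Qed.

Lemma corner_upto F (i : 'I_m) : upto i *m corner F i = upto i *m F i *m upto i.
Proof.
rewrite /corner mulmxDr mulmx_compl ?addr0 ?mulmxA; last exact: upto_proj.
by rewrite (upto_proj i).2.
Qed.

Lemma corner_comm F (i : 'I_m) : upto i *m corner F i = corner F i *m upto i.
Proof.
rewrite corner_upto /corner mulmxDl compl_mulmx ?addr0; last exact: upto_proj.
by rewrite -[RHS]mulmxA (upto_proj i).2.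
Qed.

Section Dom.
Variable F : flagspace R m M.
Hypothesis dF : chart_dom F.

Let FlF : Fl R M e F := dF.1.
Let pF i : is_proj (F i) := FlF.1 i.
Let uQ i : corner F i \in unitmx := dF.2 i.

(** Invertibility of the corner gives [upto i *m F i] the full rank of [F i]. A row of [F i] thus
    factors through the coordinate subspace, and if its projection there is zero the corner kills
    it. *)
Lemma dom_transverse (i : 'I_m) k (Z : 'M[R]_(k, M)) :
  Z *m F i = Z -> Z *m upto i = 0 -> Z = 0.
Proof.
move=> ZF ZD; set D := upto i in ZD *.
have DFD : D *m F i *m D = D *m corner F i by rewrite corner_upto.
have rk : (\rank D <= \rank (D *m F i))%N.
  by rewrite -(mxrankMfree D (_ : row_free (corner F i))) ?row_free_unit // -DFD mxrankM_maxl.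
have : (D *m F i == F i)%MS.
  rewrite -(geq_leqif (mxrank_leqif_eq (submxMl D (F i)))).
  by rewrite (leq_trans _ rk) // rank_upto FlF.2.1.
move=> /andP[_ /submxP[C FC]].
have ZE : Z = Z *m C *m D *m F i by rewrite -!mulmxA -FC.
move: ZD; rewrite {1}ZE -!mulmxA [D *m (_ *m _)]mulmxA DFD !mulmxA => h.
by rewrite ZE -[Z *m C *m D](mulmxK (uQ i)) h !mul0mx.
Qed.

Lemma dom_row (i : 'I_m) (Y := exact_blk i *m invmx (corner F i) *m F i) :
  Y *m F i = Y /\ Y *m upto i = exact_blk i.
Proof.
split; first by rewrite /Y -mulmxA (pF i).2.
have comm : upto i *m invmx (corner F i) = invmx (corner F i) *m upto i.
  rewrite -[RHS](mulmxK (uQ i)) -[_ *m upto i *m _]mulmxA corner_comm.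
  by rewrite mulmxA mulVmx // mul1mx.
rewrite /Y -{1}(exact_upto (leqnn i)) -!mulmxA [upto i *m (_ *m _)]mulmxA comm.
rewrite -!mulmxA [upto i *m (_ *m _)]mulmxA -corner_upto corner_comm.
by rewrite [invmx _ *m _]mulmxA mulVmx // mul1mx exact_upto.
Qed.

Lemma exact_coord (i : 'I_m) :
  exact_blk i *m (1%:M + chart_coord F) = exact_blk i *m invmx (corner F i) *m F i.
Proof.
rewrite /chart_coord addrC subrK mulmx_sumr (bigD1 i) //= big1 ?addr0 => [|j ji].
  by rewrite !mulmxA exact_exact eqxx.
by rewrite !mulmxA exact_exact eq_sym (negPf ji) !mul0mx.
Qed.

Lemma coord_supp : mx_supp blk_lt_rel (chart_coord F).
Proof.
move=> l l' nll; have [i _ bi] := blk_ex l OI.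
have le : (blk I l' <= i)%N by rewrite -bi leqNgt.
have [_] := dom_row i; rewrite -exact_coord => /matrixP/(_ l l').
rewrite mulmx_diagm mul_diagm diagmE bi eqxx mul1r andbT le mulr1.
by rewrite mxE [(1%:M : 'M[R]_M) l l']mxE -[X in _ = X -> _]addr0 => /addrI.
Qed.

Lemma coordK : chart (chart_coord F) = F.
Proof.
apply/funext => i; apply: proj_eq => //; first exact: (chart_proj i coord_supp).
have sub : (upto i *m (1%:M + chart_coord F) <= F i)%MS.
  rewrite upto_sum // mulmx_suml summx_sub // => j ji.
  rewrite exact_coord (submx_trans (submxMl _ _)) //.
  exact: FlF.2.2.
apply/eqmxP; apply: eqmx_trans (chart_eqmx i coord_supp) _; apply/eqmxP.
rewrite -(geq_leqif (mxrank_leqif_eq sub)) mxrankMfree.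
  by rewrite rank_upto FlF.2.1.
by rewrite row_free_unit; exact: (unip_unit coord_supp).
Qed.

(** The coordinate projection is injective on [F i] and sends its intersection with E_k into the
    span of the positions below k with letter at most i. Hence a chart meets no other cell unless
    that cell has smaller codimension. *)
Lemma dom_rank_le (i : 'I_m) k : (\rank (F i :&: (pid_mx k : 'M[R]_M))%MS <=
  prefix_count (blk I) i.+1 k)%N.
Proof.
set W := (F i :&: _)%MS.
have WF : W *m F i = W by apply: proj_absorb => //; exact: capmxSl.
have : (W :&: kermx (upto i) = 0)%MS.
  apply: (dom_transverse (i := i)).
    by apply: proj_absorb => //; apply: submx_trans (capmxSl _ _) (capmxSl _ _).
  by apply/sub_kermxP; exact: capmxSr.
move=> ker; rewrite -(mxrank_mul_ker W (upto i)) ker mxrank0 addn0.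
have /submxP[C WC] : (W <= (pid_mx k : 'M[R]_M))%MS by exact: capmxSr.
rewrite WC pid_diagm -mulmxA diagmI (leq_trans (mxrankM_maxr _ _)) //.
by rewrite rank_diagm.
Qed.

End Dom.

Lemma chartK x : mx_supp blk_lt_rel x -> chart_coord (chart x) = x.
Proof.
move=> Yx; have dF := chart_dom_chart Yx.
suff h : 1%:M + chart_coord (chart x) = 1%:M + x by exact: addrI h.
have split (A : 'M[R]_M) : A = \sum_(i < m) exact_blk i *m A.
  by rewrite -mulmx_suml exact_sum mul1mx.
rewrite [LHS]split [RHS]split; apply: eq_bigr => i _.
rewrite exact_coord //; have [YF YD] := dom_row dF i.
apply/esym/eqP; rewrite -subr_eq0; apply/eqP.
apply: (dom_transverse dF (i := i)); rewrite mulmxBl ?YF ?YD.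
  rewrite (proj_absorb (A := exact_blk i *m (1%:M + x)) (chart_proj i Yx)) //.
  by rewrite chart_eqmx // -{1}(exact_upto (leqnn i)) -mulmxA submxMl.
rewrite mulmxDr mulmx1 mulmxDl exact_upto // addrAC subrr add0r.
apply/matrixP => l l'; rewrite mulmx_diagm mul_diagm mxE.
case: eqP => [bi|_]; last by rewrite !mul0r.
case: leqP => [li|_]; last by rewrite mulr0.
by rewrite Yx ?mulr0 ?mul0r // /blk_lt_rel bi -leqNgt.
Qed.

End Charts.

Section RowSpaces.
Variables (R : realType) (M : nat).

Lemma sub_pidP k n (Z : 'M[R]_(n, M)) :
  reflect (forall i (l : 'I_M), (k <= l)%N -> Z i l = 0) (Z <= (pid_mx k : 'M[R]_M))%MS.
Proof.
have pK := diagm_proj R (fun l : 'I_M => (l < k)%N).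
rewrite pid_diagm; apply: (iffP idP) => [h i l kl|h].
  by rewrite -(proj_absorb pK h) mulmx_diagm ltnNge kl mulr0.
rewrite -[X in (X <= _)%MS](_ : Z *m diagm R (fun l : 'I_M => (l < k)%N) = Z) ?submxMl //.
apply/matrixP => i l; rewrite mulmx_diagm.
by case: ltnP => [_|/h ->]; rewrite ?mulr1 ?mul0r.
Qed.

Lemma sub_pid k k' : (k <= k')%N ->
  ((pid_mx k : 'M[R]_M) <= (pid_mx k' : 'M[R]_M))%MS.
Proof.
by move=> kk; rewrite !pid_diagm; apply: diagm_sub => l lk; exact: leq_trans kk.
Qed.

Lemma pid_full : (pid_mx M : 'M[R]_M) = 1%:M.
Proof. by apply/matrixP => i j; rewrite !mxE ltn_ord andbT. Qed.

Lemma transverse_rank (F D : 'M[R]_M) k (W : 'M[R]_(k, M)) :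
  (forall v : 'rV_M, (v <= W)%MS -> v *m D = 0 -> v = 0) ->
  \rank (W *m D) = \rank W.
Proof.
move=> h; have ker : (W :&: kermx D = 0)%MS.
  apply/eqP; rewrite -submx0; apply/row_subP => i.
  have := row_sub i (W :&: kermx D)%MS; rewrite sub_capmx => /andP[sW sK].
  by rewrite (h _ sW) ?sub0mx //; apply/sub_kermxP.
by rewrite -[RHS](mxrank_mul_ker W D) ker mxrank0 addn0.
Qed.

Lemma rank_cap_pidS (X : 'M[R]_M) k : (k < M)%N ->
  (\rank (X :&: (pid_mx k.+1 : 'M[R]_M))%MS <=
   \rank (X :&: (pid_mx k : 'M[R]_M))%MS + 1)%N.
Proof.
move=> kM; set Y := (X :&: pid_mx k.+1)%MS.
have Yk : (Y :&: (pid_mx k : 'M[R]_M) <= X :&: (pid_mx k : 'M[R]_M))%MS.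
  by apply: capmxS => //; exact: capmxSl.
have := mxrank_sum_cap Y (pid_mx k : 'M[R]_M); have := mxrankS Yk.
have : (Y + (pid_mx k : 'M[R]_M) <= (pid_mx k.+1 : 'M[R]_M))%MS.
  by rewrite addsmx_sub capmxSr sub_pid.
by move=> /mxrankS; rewrite !rank_pid_mx //; lia.
Qed.

End RowSpaces.

(** * The cell inside its chart *)

Section CellCharts.
Variables (R : realType) (m M : nat) (e : 'I_m -> nat).
Variable I : {ffun 'I_m -> {set 'I_M}}.
Hypothesis OI : I \in OSP M e.
Implicit Types (x : 'M[R]_M) (F : flagspace R m M).

(** The cell appears in its own chart as the subspace of lower triangular matrices: right
    multiplication by 1 + x then preserves every E_k. *)
Definition tangent x : Prop := forall l l' : 'I_M, (l < l')%N -> x l l' = 0.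

Lemma schubert_cellP F : schubert_cell e I F <-> Fl R M e F /\
  forall (i : 'I_m) k, (k <= M)%N ->
    \rank (F i :&: (pid_mx k : 'M[R]_M))%MS = prefix_count (blk I) i.+1 k.
Proof.
split=> [[FF h]|[FF h]]; split=> // i k kM.
  by rewrite h // (rank_count _ _ OI).
by rewrite h // (rank_count _ _ OI).
Qed.

Lemma chart_cell x : mx_supp (blk_lt_rel I) x -> tangent x ->
  schubert_cell e I (chart I x).
Proof.
move=> Yx tx; apply/schubert_cellP; split; first exact: (chart_Fl OI).
move=> i k kM; apply/eqP; rewrite eqn_leq.
rewrite (dom_rank_le OI (chart_dom_chart OI Yx)) /=.
set p : pred 'I_M := fun l => ((l < k) && (blk I l < i.+1))%N.
have -> : prefix_count (blk I) i.+1 k = \rank (diagm R p *m (1%:M + x)).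
  rewrite mxrankMfree; first by rewrite rank_diagm.
  by rewrite row_free_unit (unip_unit Yx).
apply: mxrankS; rewrite sub_capmx; apply/andP; split.
  rewrite (chart_eqmx i Yx); apply: submxMr; apply: diagm_sub => l.
  by rewrite /p ltnS => /andP[].
apply/sub_pidP => l l' kl'; rewrite mul_diagm /p !mxE.
case: ltnP => [lk|_]; last by rewrite mul0r.
have ll' : (l < l')%N by exact: leq_trans kl'.
by rewrite tx // (_ : (l == l') = false) ?addr0 ?mulr0 //; apply/negbTE; rewrite neq_ltn ll'.
Qed.

Section Cell.
Variable F : flagspace R m M.
Hypothesis cF : schubert_cell e I F.

Let FF : Fl R M e F. Proof. by case: cF. Qed.
Let rF := (iffLR (schubert_cellP F) cF).2.
Let pF i : is_proj (F i) := FF.1 i.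

(** Descend through the E_k. At a position with letter at most i the component of [v] vanishes by
    assumption; at any other position the rank of the intersection with [F i] does not jump, so [v]
    already lies in the smaller space. *)
Lemma cell_transverse (i : 'I_m) (v : 'rV[R]_M) :
  (v <= F i)%MS -> v *m upto R I i = 0 -> v = 0.
Proof.
move=> vF vD.
have down k : (k <= M)%N -> (v <= (pid_mx (M - k) : 'M[R]_M))%MS.
  elim: k => [|k IH] kM; first by rewrite subn0 pid_full submx1.
  have lM : (M - k.+1 < M)%N by lia.
  have Ek : (M - k)%N = (M - k.+1).+1 by rewrite subnSK.
  have := IH (ltnW kM); rewrite Ek => vk.
  pose l := Ordinal lM.
  have [bl|bl] := leqP (blk I l) i.
    have vl : v 0 l = 0.
      have := congr1 (fun A : 'rV[R]_M => A 0 l) vD.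
      by rewrite mulmx_diagm bl mulr1 mxE.
    apply/sub_pidP => a l' ll'; rewrite (ord1 a).
    have [->//|ne] := eqVneq l' l.
    by move/sub_pidP: vk => -> //; rewrite ltn_neqAle eq_sym ll' andbT.
  have cap : (F i :&: (pid_mx l : 'M[R]_M) == F i :&: (pid_mx l.+1 : 'M[R]_M))%MS.
    have sub : (F i :&: (pid_mx l : 'M[R]_M) <= F i :&: (pid_mx l.+1 : 'M[R]_M))%MS.
      by apply: capmxS => //; exact: sub_pid.
    rewrite -(geq_leqif (mxrank_leqif_eq sub)) !rF //; last exact: ltnW.
    have nb : (blk I l < i.+1)%N = false by rewrite ltnS leqNgt bl.
    by rewrite prefix_countS nb addn0.
  have : (v <= F i :&: (pid_mx l.+1 : 'M[R]_M))%MS by rewrite sub_capmx vF.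
  by rewrite -(eqmxP cap) sub_capmx => /andP[].
have := down M (leqnn _); rewrite subnn => /sub_pidP h.
by apply/rowP => l; rewrite mxE h.
Qed.

Lemma cell_dom : chart_dom e I F.
Proof.
split=> // i; apply: unitmx_inj => v.
have pD := upto_proj R I i; set D := upto R I i in pD *.
rewrite /corner -/D => vQ.
have [vD vF] := corner_kernel pD (pF i) vQ.
have rk : \rank (D *m F i) = \rank D.
  rewrite -mxrank_tr trmx_mul pD.1 (pF i).1 transverse_rank.
  - by rewrite FF.2.1 (rank_upto R OI).
  - exact: F i.
  - by move=> u uF uD; exact: cell_transverse uF uD.
have := mxrank_mul_ker D (F i); rewrite rk => /eqP.
rewrite -[X in _ == X]addn0 eqn_add2l mxrank_eq0 => /eqP ker.
apply/eqP; rewrite -submx0 -ker sub_capmx; apply/andP; split.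
  by rewrite -vD submxMl.
exact/sub_kermxP.
Qed.

(** By ranks, the intersection of [F i] with E_(l+1) projects onto all coordinates allowed there,
    including the l-th. So the l-th unit vector lifts into that intersection; by transversality the
    lift is row l of 1 + x, whose entries beyond l therefore vanish. *)
Lemma cell_tangent : tangent (chart_coord I F).
Proof.
move=> l l' ll'; have dF := cell_dom.
have [i _ bi] := blk_ex l OI.
set p : pred 'I_M := fun k => ((k < l.+1) && (blk I k < i.+1))%N.
set V := (F i :&: (pid_mx l.+1 : 'M[R]_M))%MS.
have VD : (V *m upto R I i == diagm R p)%MS.
  have sub : (V *m upto R I i <= diagm R p)%MS.
    have -> : diagm R p = pid_mx l.+1 *m upto R I i.
      by rewrite pid_diagm diagmI; apply: eq_diagm.
    by apply: submxMr; exact: capmxSr.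
  rewrite -(geq_leqif (mxrank_leqif_eq sub)) rank_diagm transverse_rank.
  - by rewrite rF.
  - exact: F i.
  - move=> u uV; apply: cell_transverse; apply: submx_trans uV _.
    exact: capmxSl.
set dl : 'rV[R]_M := delta_mx 0 l.
have dlp (q : pred 'I_M) : q l -> dl *m diagm R q = dl.
  move=> ql; apply/rowP => k; rewrite mulmx_diagm !mxE.
  by rewrite eqxx /=; case: eqP => [->|]; rewrite ?ql ?mulr1 ?mul0r.
have : (dl <= V *m upto R I i)%MS.
  by rewrite (eqmxP VD) -(dlp p) ?submxMl // /p bi !ltnS !leqnn.
move=> /submxP[u]; rewrite mulmxA => uE.
have uV : (u *m V <= V)%MS by exact: submxMl.
have [YF YD] := dom_row dF i.
set v := dl *m (1%:M + chart_coord I F).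
have vE : v = dl *m (exact_blk R I i *m (1%:M + chart_coord I F)).
  by rewrite mulmxA dlp // bi.
rewrite (exact_coord I F) in vE.
have vw : v = u *m V.
  apply/eqP; rewrite -subr_eq0; apply/eqP; apply: (cell_transverse (i := i)).
    rewrite addmx_sub ?eqmx_opp ?(submx_trans uV) ?capmxSl //.
    by rewrite vE mulmxA submxMl.
  by rewrite mulmxBl -uE vE -[dl *m _ *m upto R I i]mulmxA YD dlp ?subrr // bi.
have : (v <= (pid_mx l.+1 : 'M[R]_M))%MS.
  by rewrite vw (submx_trans uV) // capmxSr.
move=> /sub_pidP/(_ 0 l' ll'); rewrite /v -rowE !mxE.
by rewrite (_ : (l == l') = false) ?add0r //; apply/negbTE; rewrite neq_ltn ll'.
Qed.

End Cell.

End CellCharts.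

Section Cover.
Variables (R : realType) (m M : nat) (e : 'I_m -> nat).
Hypotheses (m_gt0 : (0 < m)%N) (sum_e : (\sum_j e j = M)%N).
Implicit Types F : flagspace R m M.

(** Position l is put in the first block i for which the rank of the intersection of [F i] with E_k
    jumps at l. Jumps persist along the flag, and [F] at the last index is everything, so each
    position gets a block. *)
Lemma cell_cover F : Fl R M e F ->
  exists2 I, I \in OSP M e & schubert_cell e I F.
Proof.
move=> FF.
pose jump (i : 'I_m) (l : nat) :=
  ~~ (F i :&: (pid_mx l.+1 : 'M[R]_M) <= (pid_mx l : 'M[R]_M))%MS.
have mono (i j : 'I_m) l : (i <= j)%N -> jump i l -> jump j l.
  move=> ij; apply: contra => h; apply: submx_trans h.
  by apply: capmxS => //; exact: FF.2.2.
have rankS (i : 'I_m) l : (l < M)%N ->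
    \rank (F i :&: (pid_mx l.+1 : 'M[R]_M))%MS =
    (\rank (F i :&: (pid_mx l : 'M[R]_M))%MS + jump i l)%N.
  move=> lM.
  have sub : (F i :&: (pid_mx l : 'M[R]_M) <= F i :&: (pid_mx l.+1 : 'M[R]_M))%MS.
    by apply: capmxS => //; exact: sub_pid.
  have := mxrank_leqif_eq sub; have := rank_cap_pidS (F i) lM.
  have -> : (F i :&: (pid_mx l : 'M[R]_M) == F i :&: (pid_mx l.+1 : 'M[R]_M))%MS = ~~ jump i l.
    rewrite negbK; apply/idP/idP => [/eqmxP h|h]; first by rewrite -h capmxSr.
    by apply/andP; split=> //; rewrite sub_capmx h capmxSl.
  by move=> h [h1 h2]; move: h2; case: (jump i l) => /= [/eqP|/eqP]; lia.
have rankE (i : 'I_m) k : (k <= M)%N ->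
    \rank (F i :&: (pid_mx k : 'M[R]_M))%MS = (\sum_(l < M) ((l < k) && jump i l))%N.
  elim: k => [|k IH] kM.
    rewrite big1 => [|l _]; last by rewrite ltn0.
    apply/eqP; rewrite mxrank_eq0 -submx0 (submx_trans (capmxSr _ _)) //.
    by rewrite submx0 -mxrank_eq0 rank_pid_mx.
  rewrite rankS // IH ?(ltnW kM) //.
  rewrite [RHS](bigD1 (Ordinal kM)) //= [X in (X + _)%N = _](bigD1 (Ordinal kM)) //=.
  rewrite ltnn ltnSn add0n addnC; congr (_ + _)%N; apply: eq_bigr => l ne.
  rewrite [in RHS]ltnS [in RHS]leq_eqVlt; case: eqP => // lk.
  by move: ne; rewrite -(inj_eq val_inj) /= lk eqxx.
pose I : {ffun 'I_m -> {set 'I_M}} :=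
  [ffun j => [set l : 'I_M | jump j l && [forall j' : 'I_m, (j' < j)%N ==> ~~ jump j' l]]%SET].
have II j l : (l \in I j) = jump j l && [forall j' : 'I_m, (j' < j)%N ==> ~~ jump j' l].
  by rewrite ffunE inE.
have uniq i j l : l \in I i -> l \in I j -> i = j.
  rewrite !II => /andP[ji /forallP ni] /andP[jj /forallP nj].
  apply/val_inj; case: (ltngtP i j) => // h.
    by have /implyP/(_ h) := nj i; rewrite ji.
  by have /implyP/(_ h) := ni j; rewrite jj.
have first i (l : 'I_M) : jump i l = (l \in \bigcup_(j < m | (j <= i)%N) I j)%SET.
  apply/idP/finset.bigcupP => [ji|[j ji]]; last first.
    by rewrite II => /andP[+ _]; exact: mono.
  have ex : exists k : nat, [exists j : 'I_m, (j == k :> nat) && jump j l].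
    by exists i; apply/existsP; exists i; rewrite eqxx.
  case: (ex_minnP ex) => k /existsP[j /andP[/eqP jk jj]] kmin.
  have ki : (k <= i)%N by apply: kmin; apply/existsP; exists i; rewrite eqxx.
  exists j; first by rewrite jk.
  rewrite II jj; apply/forallP => j'; apply/implyP => j'j; apply/negP => jj'.
  have : (k <= j')%N by apply: kmin; apply/existsP; exists j'; rewrite eqxx.
  by rewrite leqNgt -jk j'j.
have count i k : (k <= M)%N -> \rank (F i :&: (pid_mx k : 'M[R]_M))%MS =
    #|[set l in \bigcup_(j < m | (j <= i)%N) I j | (l < k)%N]%SET|.
  move=> kM; rewrite rankE // -sum1dep_card [RHS]big_mkcond.
  by apply: eq_bigr => l _; rewrite -first andbC; case: (_ && _).
have card_upto (i : 'I_m) :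
    (\sum_(j < m | (j <= i)%N) #|I j| = \sum_(j < m | (j <= i)%N) e j)%N.
  rewrite -FF.2.1; have := count i M (leqnn M).
  rewrite pid_full capmx1 => ->.
  under eq_bigr do rewrite -sum1_card big_mkcond.
  rewrite exchange_big -sum1dep_card [RHS]big_mkcond /=; apply: eq_bigr => l _.
  rewrite ltn_ord andbT; case: finset.bigcupP => [[j ji lj]|nlj].
    rewrite (bigD1 j) //= lj big1 // => k /andP[_ kj].
    by case: ifP => // lk; rewrite (uniq _ _ _ lk lj) eqxx in kj.
  by rewrite big1 // => j ji; case: ifP => // lj; case: nlj; exists j.
have OI : I \in OSP M e.
  rewrite inE; apply/and3P; split.
  - apply/forallP => j; apply/eqP.
    have below : (\sum_(k < m | (k < j)%N) #|I k| = \sum_(k < m | (k < j)%N) e k)%N.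
      case ej: (j : nat) => [|j']; first by rewrite !big1 // => k; rewrite ltn0.
      have j'm : (j' < m)%N by rewrite ltnW // -ej.
      exact: (card_upto (Ordinal j'm)).
    have := card_upto j; rewrite !(bigD1 (P := fun k : 'I_m => (k <= j)%N) j) //=.
    have eqp (k : 'I_m) : ((k <= j) && (k != j))%N = (k < j)%N.
      by rewrite ltn_neqAle andbC.
    by rewrite !(eq_bigl _ _ eqp) below => /addIn.
  - apply/forallP => i; apply/forallP => j; apply/implyP => ij.
    rewrite disjoint_subset; apply/fintype.subsetP => l li; rewrite inE.
    by apply: contra ij => lj; rewrite (uniq _ _ _ li lj).
  - apply/eqP/setP => l; rewrite inE.
    have lm : (m.-1 < m)%N by rewrite prednK.
    have : jump (Ordinal lm) l.
      have full : row_full (F (Ordinal lm)).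
        rewrite /row_full FF.2.1 -sum_e; apply/eqP; apply: eq_bigl => j.
        by have := ltn_ord j; rewrite /=; lia.
      rewrite /jump; apply/negP => h.
      have : ((pid_mx l.+1 : 'M[R]_M) <= (pid_mx l : 'M[R]_M))%MS.
        by apply: submx_trans h; rewrite sub_capmx submx_full // submx_refl.
      by move/mxrankS; rewrite !rank_pid_mx ?ltnn // ltnW.
    by rewrite first => /finset.bigcupP[j _ lj]; apply/finset.bigcupP; exists j.
by exists I => //; split=> // i k kM; exact: count.
Qed.

End Cover.

(** * Transfer of Thom classes *)

Section ThomTransfer.
Variables (R : realType) (T : topologicalType).

Lemma cohomologousZ (A : comNzRingType) (U V : set T) n a (c c' : cochain R T A n) :
  cohomologous U V c c' -> cohomologous U V (fun s => a * c s) (fun s => a * c' s).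
Proof.
by move=> /(is_coboundaryZ a); apply: is_coboundary_eq => s _; rewrite mulrBr.
Qed.

Lemma cohomologous_coef (A : comNzRingType) (U V : set T) n
    (c c' : cochain R T int n) :
  cohomologous U V c c' -> cohomologous U V (coef A c) (coef A c').
Proof.
by move=> /(is_coboundary_coef A); apply: is_coboundary_eq => s _; rewrite /coef rmorphB.
Qed.

Lemma thom_restrict (W O V : set T) j (tau : cochain R T int j) :
  rel_open W O -> rel_open W V -> W = O `|` V ->
  thom_class W V tau -> thom_class O (O `&` V) tau.
Proof.
move=> rO rV WE [ct th]; have OW := rel_open_sub rO.
have sOV : O `&` V `<=` V by exact: subIsetr.
split; first exact: cocycle_sub ct.
move=> A; have [deg gen fr] := th A; split.
- move=> n c nj /(excision_extend rO rV WE)[c' cc' c'E].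
  have := is_coboundary_sub OW sOV (deg _ _ nj cc').
  exact: is_coboundary_eq.
- move=> c /(excision_extend rO rV WE)[c' cc' c'E].
  have [a /(is_coboundary_sub OW sOV) ca] := gen _ cc'.
  by exists a; apply: is_coboundary_eq ca => s Os; rewrite c'E.
- move=> a /(excision_coboundary rO rV WE) h; apply: fr; apply: h.
  by apply: cocycleZ; exact: cocycle_coef.
Qed.

Lemma thom_excision (W O V : set T) j (tau : cochain R T int j) :
  rel_open W O -> rel_open W V -> W = O `|` V ->
  thom_class O (O `&` V) tau ->
  exists2 tau' : cochain R T int j, thom_class W V tau' &
    forall g e, continuous_on W g -> (forall x, W x -> W (g x)) ->
      (forall x, O x -> O (g x)) -> (forall x, V x -> V (g x)) ->
      scales_class O (O `&` V) tau g e -> scales_class W V tau' g e.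
Proof.
move=> rO rV WE [ct th]; have [OW VW] := (rel_open_sub rO, rel_open_sub rV).
have sOV : O `&` V `<=` V by exact: subIsetr.
have sOO : O `&` V `<=` O by exact: subIsetl.
have [tau' ct' tE] := excision_extend rO rV WE ct.
have tEA (A : comNzRingType) s : simplices O s -> coef A tau' s = coef A tau s.
  by move=> Os; rewrite /coef tE.
exists tau'.
  split=> // A; have [deg gen fr] := th A.
  have ctA := cocycle_coef A ct'.
  split.
  - move=> n c nj cc; apply: (excision_coboundary rO rV WE cc).
    by apply: deg => //; exact: cocycle_sub cc.
  - move=> c cc; have [a ca] := gen _ (cocycle_sub OW sOV cc).
    exists a; apply: (excision_coboundary rO rV WE).
      by apply: cocycleB => //; exact: cocycleZ.
    by apply: is_coboundary_eq ca => s Os; rewrite tEA.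
  - move=> a /(is_coboundary_sub OW sOV) h; apply: fr.
    by apply: is_coboundary_eq h => s Os; rewrite tEA.
move=> g e cg gW gO gV sc; apply: (excision_coboundary rO rV WE).
  apply: cocycleB; last exact: cocycleZ.
  exact: pull_cocycle ct'.
apply: is_coboundary_eq sc => s Os; rewrite /pull !tE //.
apply: (simplices_comp (U := W)) Os => //.
Qed.

(** [generates] speaks of integers only. Here [theta] is a times [tau] and [tau] is b times [theta]
    in cohomology, and uniqueness of multiples gives ab = 1, so [theta] inherits from [tau] both the
    statement over every coefficient ring and the signs. *)
Lemma generates_thom (U V : set T) j (tau theta : cochain R T int j) :
  thom_class U V tau -> generates U V theta ->
  thom_class U V theta /\
  (forall g e, continuous_on U g -> V `<=` U -> (forall x, U x -> U (g x)) ->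
     (forall x, V x -> V (g x)) ->
     scales_class U V tau g e -> scales_class U V theta g e).
Proof.
move=> [ct th] [cth gen].
have [_ gent _] := th int; have [a tha] := gent _ cth.
have [b [tb _]] := gen _ ct.
have coefE (c : cochain R T int j) : coef int c = c.
  by apply/funext => s; rewrite /coef intz.
rewrite coefE in tha.
have ab1 : a * b = 1.
  have [x [_ xu]] := gen _ cth; rewrite -(xu (a * b)); last first.
    apply: cohomologous_trans tha _.
    apply: is_coboundary_eq (cohomologousZ a tb) => s _; by rewrite mulrA.
  apply: xu; apply: is_coboundary0 => s _; by rewrite mul1r subrr.
split; last first.
  move=> g e cg VU gU gV sc.
  apply: cohomologous_trans (_ : cohomologous U V _ (fun s => a * pull g tau s)) _.
    have := pull_coboundary cg VU gU gV tha.
    exact: is_coboundary_eq.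
  apply: cohomologous_trans (cohomologousZ a sc) _.
  apply: is_coboundary_eq (cohomologousZ e (cohomologous_sym tha)) => s _.
  by rewrite mulrCA.
split=> // A; have [deg genA fr] := th A; split=> //.
  move=> c /genA[q cq]; exists (q * b%:~R); apply: cohomologous_trans cq _.
  apply: is_coboundary_eq (cohomologousZ q (cohomologous_coef A tb)) => s _.
  by rewrite /coef rmorphM mulrA.
move=> q h; suff : q * a%:~R = 0.
  move=> /(congr1 ( *%R^~ b%:~R)) /=; rewrite -mulrA -rmorphM ab1 mul0r.
  by rewrite mulr1.
apply: fr; apply: cohomologous_coboundary h.
apply: is_coboundary_eq (cohomologousZ q (cohomologous_sym (cohomologous_coef A tha))) => s _.
by rewrite /coef rmorphM mulrA.
Qed.

(** A coboundary on a subspace is the restriction of one on the whole space: extend the primitive by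
    0. Subtracting [h] turns a relation that holds on [W'] into a cochain that vanishes there. *)
Lemma coboundary_extend (A : comNzRingType) (W W' V : set T) n
    (f : cochain R T A n) : W' `<=` W -> V `<=` W' ->
  is_coboundary W' V f ->
  exists h : cochain R T A n, [/\ is_coboundary W V h,
    forall s, simplices W' s -> f s = h s & forall s, coboundary h s = 0].
Proof.
move=> WW VW; case: n f => [|n] f.
  move=> f0; exists (fun=> 0); split.
  - by move=> s _.
  - by move=> s Ws; rewrite f0.
  - by move=> s; rewrite coboundary_cst mulr0.
move=> [b [b0 fb]]; exists (coboundary (extend0 W' b)); split.
- exists (extend0 W' b); split=> //; apply: extend0_vanishes.
  by move=> s Vs; apply: b0; apply: simplices_sub Vs => x [].
- move=> s Ws; rewrite fb //; apply: eq_coboundary Ws => s' Ws'.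
  by rewrite extend0E.
- by move=> s; rewrite coboundary_coboundary.
Qed.

End ThomTransfer.

(** * Continuity of matrix operations *)

Section MatrixContinuity.
Variables (R : realType) (Z : topologicalType) (z : Z).

Lemma continuous_at_coord m n (f : Z -> 'M[R]_(m, n)) i j :
  {for z, continuous f} -> {for z, continuous (fun y => f y i j)}.
Proof.
move=> cf; apply: (@continuous_comp _ _ _ f (fun A : 'M[R]_(m, n) => A i j)) => //.
exact: coord_continuous.
Qed.

Lemma continuous_at_mulmx m n p (f : Z -> 'M[R]_(m, n)) (g : Z -> 'M[R]_(n, p)) :
  {for z, continuous f} -> {for z, continuous g} ->
  {for z, continuous (fun y => f y *m g y)}.
Proof.
move=> cf cg; apply: mx_continuous_at => i j.
have -> : (fun y => (f y *m g y) i j) = (fun y => \sum_k f y i k * g y k j).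
  by apply/funext => y; rewrite mxE.
by apply: continuous_at_sum => k _; apply: continuousM; exact: continuous_at_coord.
Qed.

Lemma continuous_at_addmx m n (f g : Z -> 'M[R]_(m, n)) :
  {for z, continuous f} -> {for z, continuous g} ->
  {for z, continuous (fun y => f y + g y)}.
Proof. by move=> cf cg; exact: continuousD. Qed.

Lemma continuous_at_trmx m n (f : Z -> 'M[R]_(m, n)) :
  {for z, continuous f} -> {for z, continuous (fun y => (f y)^T)}.
Proof.
move=> cf; apply: mx_continuous_at => i j.
have -> : (fun y => (f y)^T i j) = (fun y => f y j i).
  by apply/funext => y; rewrite mxE.
exact: continuous_at_coord.
Qed.

Lemma continuous_at_prod I (r : seq I) (F : I -> Z -> R) :
  (forall i, {for z, continuous (F i)}) ->
  {for z, continuous (fun y => \prod_(i <- r) F i y)}.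
Proof.
move=> cF; elim: r => [|i r IH].
  have -> : (fun y => \prod_(i <- [::]) F i y) = (fun=> 1).
    by apply/funext => y; rewrite big_nil.
  exact: cst_continuous.
have -> : (fun y => \prod_(j <- i :: r) F j y) =
    (fun y => F i y * \prod_(j <- r) F j y).
  by apply/funext => y; rewrite big_cons.
exact: continuousM.
Qed.

Lemma continuous_at_det n (f : Z -> 'M[R]_n) :
  {for z, continuous f} -> {for z, continuous (fun y => \det (f y))}.
Proof.
move=> cf; apply: continuous_at_sum => s _; apply: continuousM.
  exact: cst_continuous.
by apply: continuous_at_prod => i; exact: continuous_at_coord.
Qed.

Lemma continuous_at_invmx n (f : Z -> 'M[R]_n) : {for z, continuous f} ->
  f z \in unitmx -> {for z, continuous (fun y => invmx (f y))}.
Proof.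
move=> cf ufz; have cdet := continuous_at_det cf.
have dz : \det (f z) != 0 by rewrite -unitfE -unitmxE.
pose g y := (\det (f y))^-1 *: \adj (f y).
have cg : {for z, continuous g}.
  apply: mx_continuous_at => i j.
  have -> : (fun y => g y i j) = (fun y => (\det (f y))^-1 * \adj (f y) i j).
    by apply/funext => y; rewrite mxE.
  apply: continuousM; first exact: continuousV.
  have -> : (fun y => \adj (f y) i j) =
      (fun y => (-1) ^+ (j + i) * \det (row' j (col' i (f y)))).
    by apply/funext => y; rewrite mxE.
  apply: continuousM; first exact: cst_continuous.
  apply: continuous_at_det; apply: mx_continuous_at => k l.
  have -> : (fun y => row' j (col' i (f y)) k l) =
      (fun y => f y (lift j k) (lift i l)).
    by apply/funext => y; rewrite !mxE.
  exact: continuous_at_coord.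
(* [invmx] returns its argument on singular matrices, so the adjugate formula is available only near
   [z]. *)
have near : \forall y \near z, \det (f y) != 0.
  by apply: (cdet [set r | r != 0]); apply: open_nbhs_nbhs; split => //; exact: open_neq.
have fg y : \det (f y) != 0 -> invmx (f y) = g y.
  by move=> dy; rewrite /invmx unitmxE unitfE dy.
move=> A Ag; have /cg gA : nbhs (g z) A by rewrite -fg.
by apply: filterS2 near gA => y dy; rewrite /= fg.
Qed.

End MatrixContinuity.

Section FlagContinuity.
Variables (R : realType) (m M : nat).

Lemma flag_coord_continuous (i : 'I_m) :
  continuous (fun F : flagspace R m M => F i).
Proof. by move=> F; exact: (@proj_continuous _ (fun=> 'M[R]_M) i F). Qed.

Lemma continuous_at_flag (Z : topologicalType) (f : Z -> flagspace R m M) z :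
  (forall i, {for z, continuous (fun y => f y i)}) -> {for z, continuous f}.
Proof.
move=> cf; apply/cvg_sup => i.
move=> A [B [[C oC <-] /= Cfz] CA].
have h : nbhs z ((fun y => f y i) @^-1` C).
  by apply: (cf i C); apply: open_nbhs_nbhs; split.
have : nbhs z (f @^-1` A); last by [].
by apply: filterS h => y Cy; exact: CA.
Qed.

Lemma continuous_at_proj_act (Z : topologicalType) (f b : Z -> 'M[R]_M) z :
  {for z, continuous f} -> {for z, continuous b} ->
  is_proj (f z) -> b z \in unitmx ->
  {for z, continuous (fun y => proj_act (f y) (b y))}.
Proof.
move=> cf cb pf ub.
have cbt := continuous_at_trmx cb.
have cG : {for z, continuous (fun y => gram (f y) (b y))}.
  apply: continuousD.
    exact: (continuous_at_mulmx (continuous_at_mulmx (continuous_at_mulmx cf cb) cbt) cf).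
  by apply: continuousB; [exact: cst_continuous|exact: cf].
have cI := continuous_at_invmx cG (gram_unit pf ub).
exact: (continuous_at_mulmx (continuous_at_mulmx (continuous_at_mulmx
  (continuous_at_mulmx cbt cf) cI) cf) cb).
Qed.

End FlagContinuity.

(** * Charts, closures and the frontier condition *)

Section ChartTopology.
Variables (R : realType) (m M : nat) (e : 'I_m -> nat).
Implicit Types (F G : flagspace R m M) (x : 'M[R]_M).
Implicit Types I J : {ffun 'I_m -> {set 'I_M}}.

Lemma chart_continuous I x : mx_supp (blk_lt_rel I) x ->
  {for x, continuous (chart I : 'M[R]_M -> flagspace R m M)}.
Proof.
move=> Yx; apply: continuous_at_flag => i.
apply: (@continuous_at_proj_act _ _ _ (fun=> upto R I i) (fun x => 1%:M + x)).
- exact: cst_continuous.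
- by apply: continuousD; [exact: cst_continuous|exact: cvg_id].
- exact: upto_proj.
- exact: unip_unit Yx.
Qed.

Lemma corner_continuous I (i : 'I_m) :
  continuous (fun F : flagspace R m M => corner I F i).
Proof.
move=> F; apply: (continuous_at_addmx
  (f := fun F : flagspace R m M => upto R I i *m F i *m upto R I i)
  (g := fun=> 1%:M - upto R I i)); last exact: cst_continuous.
apply: (continuous_at_mulmx (f := fun F : flagspace R m M => upto R I i *m F i)
  (g := fun=> upto R I i)); last exact: cst_continuous.
apply: (continuous_at_mulmx (f := fun=> upto R I i)).
  exact: cst_continuous.
exact: flag_coord_continuous.
Qed.

Lemma chart_coord_continuous I F : chart_dom e I F ->
  {for F, continuous (chart_coord I : flagspace R m M -> 'M[R]_M)}.
Proof.
move=> [_ uQ]; apply: (continuous_at_addmx (f := fun F : flagspace R m M =>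
  \sum_(i < m) exact_blk R I i *m invmx (corner I F i) *m F i)
  (g := fun=> - 1%:M)); last exact: cst_continuous.
apply: continuous_at_sum => i _.
apply: (continuous_at_mulmx (f := fun F : flagspace R m M =>
  exact_blk R I i *m invmx (corner I F i)) (g := fun F : flagspace R m M => F i)).
  apply: (continuous_at_mulmx (f := fun=> exact_blk R I i)).
    exact: cst_continuous.
  apply: continuous_at_invmx; last exact: uQ.
  exact: corner_continuous.
exact: flag_coord_continuous.
Qed.

Lemma chart_dom_rel_open I : rel_open (Fl R M e) (chart_dom e I).
Proof.
exists [set F | \prod_(i < m) \det (corner I F i) != 0].
  apply: (@open_comp _ _ (fun F : flagspace R m M => \prod_(i < m) \det (corner I F i))
    [set r | r != 0]); last exact: open_neq.
  move=> F _; apply: continuous_at_prod => i; apply: continuous_at_det.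
  exact: corner_continuous.
apply/seteqP; split=> [F [FF uQ]|F [FF /= dF]]; split=> //.
  apply/prodf_neq0 => i _; rewrite -unitfE -unitmxE; exact: uQ.
by move=> i; rewrite unitmxE unitfE; move/prodf_neq0: dF; apply.
Qed.

Lemma dom_cell I J F : I \in OSP M e -> J \in OSP M e ->
  chart_dom e J F -> schubert_cell e I F -> J = I \/ (codim I < codim J)%N.
Proof.
move=> OI OJ dF cF; have [->|/eqP IJ] := eqVneq J I; first by left.
right; apply: (codim_lt OI OJ) => [i k kM|IJ']; last exact: IJ.
by rewrite -((schubert_cellP OI F).1 cF).2 // (dom_rank_le OJ dF).
Qed.

(** A point of the cell of [J] has a neighbourhood inside the chart centred at [J]. If it is a limit
    of the cell of [I], that chart meets the cell of [I], and the rank inequality in the chart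
    compares the codimensions. *)
Lemma cell_closure I J F : I \in OSP M e -> J \in OSP M e ->
  schubert_cell e J F -> closure (schubert_cell e I) F ->
  J = I \/ (codim I < codim J)%N.
Proof.
move=> OI OJ cJ clI; have dF := cell_dom OJ cJ.
have [C oC dE] := chart_dom_rel_open J.
have CF : nbhs F C by move: dF; rewrite dE => -[_ CF]; exact: open_nbhs_nbhs.
have [G [cG CG]] := clI _ CF.
have dG : chart_dom e J G by rewrite dE; split=> //; case: cG.
exact: dom_cell OI OJ dG cG.
Qed.

Lemma capmxMunit (A B b : 'M[R]_M) : b \in unitmx ->
  (A *m b :&: B *m b :=: (A :&: B) *m b)%MS.
Proof.
move=> ub; apply/eqmxP/andP; split.
  rewrite -[X in (X <= _)%MS](mulmxKV ub); apply: submxMr.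
  rewrite sub_capmx; apply/andP; split.
    by rewrite -[X in (_ <= X)%MS](mulmxK ub) submxMr // capmxSl.
  by rewrite -[X in (_ <= X)%MS](mulmxK ub) submxMr // capmxSr.
by rewrite sub_capmx !submxMr ?capmxSl ?capmxSr.
Qed.

Lemma schubert_cell_act I F G b : I \in OSP M e -> b \in unitmx ->
  (forall k, ((pid_mx k : 'M[R]_M) *m b :=: (pid_mx k : 'M[R]_M))%MS) ->
  (forall i, (G i :=: F i *m b)%MS) -> Fl R M e G ->
  schubert_cell e I F -> schubert_cell e I G.
Proof.
move=> OI ub Eb GE FG /(schubert_cellP OI)[_ rF].
apply/(schubert_cellP OI); split=> // i k kM.
rewrite -rF // -(mxrankMfree (F i :&: pid_mx k)%MS (_ : row_free b)).
  rewrite -(capmxMunit (F i) (pid_mx k) ub); apply: eqmx_rank; apply/eqmxP.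
  by apply: cap_eqmx => //; exact: eqmx_sym.
by rewrite row_free_unit.
Qed.

Lemma is_proj_Fl F i : Fl R M e F -> is_proj (F i).
Proof. by move=> FF; exact: FF.1. Qed.

Definition flag_act (b : 'M[R]_M) F : flagspace R m M := fun i => proj_act (F i) b.

Lemma flag_act_Fl b F : b \in unitmx -> Fl R M e F -> Fl R M e (flag_act b F).
Proof.
move=> ub FF; have aE i := proj_act_eqmx (is_proj_Fl i FF) ub.
split=> [i|]; first exact: proj_act_proj (is_proj_Fl i FF) ub.
split=> [i|i j ij]; rewrite !aE.
  by rewrite mxrankMfree ?row_free_unit // FF.2.1.
by apply: submxMr; exact: FF.2.2.
Qed.

Lemma pid_tangent x k : tangent x ->
  ((pid_mx k : 'M[R]_M) *m (1%:M + x) <= (pid_mx k : 'M[R]_M))%MS.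
Proof.
move=> tx; apply/sub_pidP => l l' kl'; rewrite pid_diagm mul_diagm !mxE.
case: ltnP => [lk|_]; last by rewrite mul0r.
have ll' : (l < l')%N by exact: leq_trans kl'.
by rewrite tx // (_ : (l == l') = false) ?addr0 ?mulr0 //; apply/negbTE; rewrite neq_ltn ll'.
Qed.

(** In the chart both flags have lower triangular coordinates, and (1 + x)^-1 (1 + x') carries one
    to the other while preserving every E_k. *)
Lemma cell_transitive J F F' : J \in OSP M e ->
  schubert_cell e J F -> schubert_cell e J F' ->
  exists b, [/\ b \in unitmx,
    forall k, ((pid_mx k : 'M[R]_M) *m b :=: (pid_mx k : 'M[R]_M))%MS & F' = flag_act b F].
Proof.
move=> OJ cF cF'; have dF := cell_dom OJ cF; have dF' := cell_dom OJ cF'.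
set x := chart_coord J F; set x' := chart_coord J F'.
have Yx := coord_supp OJ dF; have Yx' := coord_supp OJ dF'.
have tx := cell_tangent OJ cF; have tx' := cell_tangent OJ cF'.
have ux := unip_unit Yx; have ux' := unip_unit Yx'.
rewrite -/x in Yx tx ux; rewrite -/x' in Yx' tx' ux'.
have pidM y k : tangent y -> 1%:M + y \in unitmx ->
    ((pid_mx k : 'M[R]_M) *m (1%:M + y) :=: (pid_mx k : 'M[R]_M))%MS.
  move=> ty uy; apply/eqmxP; rewrite -(geq_leqif (mxrank_leqif_eq (pid_tangent k ty))).
  by rewrite mxrankMfree ?row_free_unit.
have ub : invmx (1%:M + x) *m (1%:M + x') \in unitmx.
  by rewrite unitmx_mul unitmx_inv ux.
exists (invmx (1%:M + x) *m (1%:M + x')); split=> // [k|].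
  rewrite mulmxA; apply: eqmx_trans _ (pidM x' k tx' ux'); apply: eqmxMr.
  apply: eqmx_trans (eqmxMr _ (eqmx_sym (pidM x k tx ux))) _.
  by rewrite mulmxK.
have fE i : F i = chart J x i by rewrite -{1}(coordK OJ dF).
have fE' i : F' i = chart J x' i by rewrite -{1}(coordK OJ dF').
apply/funext => i; apply: proj_eq.
- exact: is_proj_Fl dF'.1.
- exact: proj_act_proj (is_proj_Fl i dF.1) ub.
apply/eqmxP; apply: eqmx_sym; apply: eqmx_trans (proj_act_eqmx (is_proj_Fl i dF.1) ub) _.
rewrite fE fE'; apply: eqmx_trans (eqmxMr _ (chart_eqmx i Yx)) _.
apply: eqmx_trans _ (eqmx_sym (chart_eqmx i Yx')).
by rewrite mulmxA mulmxK.
Qed.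

Lemma flag_act_continuous b F : b \in unitmx -> Fl R M e F ->
  {for F, continuous (flag_act b)}.
Proof.
move=> ub FF; apply: continuous_at_flag => i.
apply: (continuous_at_proj_act (f := fun F : flagspace R m M => F i) (b := fun=> b)) => //.
- exact: flag_coord_continuous.
- exact: cst_continuous.
- exact: is_proj_Fl FF.
Qed.

(** The action of matrices preserving all E_k is continuous on flags, preserves the cell of [I] and
    is transitive on the cell of [J]; so one limit point in the latter makes all its points
    limits. *)
Lemma closure_cell_sub I J F : I \in OSP M e -> J \in OSP M e ->
  schubert_cell e J F -> closure (schubert_cell e I) F ->
  (schubert_cell e J : set (flagspace R m M)) `<=` closure (schubert_cell e I).
Proof.
move=> OI OJ cF clF F' cF'; have [b [ub Eb ->]] := cell_transitive OJ cF cF'.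
move=> A nA; have FF : Fl R M e F by case: cF.
have [G [cG AG]] := clF _ (flag_act_continuous ub FF nA).
exists (flag_act b G); split=> //.
have FG : Fl R M e G by case: cG.
apply: (schubert_cell_act OI ub Eb _ _ cG).
  by move=> i; apply: proj_act_eqmx ub; exact: is_proj_Fl FG.
exact: flag_act_Fl.
Qed.

End ChartTopology.

(** * Orthogonal conjugation of flags *)

Section Conjugation.
Variables (R : realType) (m M : nat) (e : 'I_m -> nat).
Implicit Types (F : flagspace R m M) (b : 'M[R]_M).

Definition conj_flag b F : flagspace R m M := fun i => b^T *m F i *m b.

Lemma conj_flag_eqmx b F (i : 'I_m) : b *m b^T = 1%:M ->
  (conj_flag b F i :=: F i *m b)%MS.
Proof.
move=> bb; have [_ ub] := mulmx1_unit bb.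
rewrite /conj_flag -mulmxA; apply/eqmxP/andP; split; first exact: submxMl.
by rewrite -{1}[F i *m b]mul1mx -bb -mulmxA submxMl.
Qed.

Lemma conj_flag_Fl b F : b *m b^T = 1%:M -> Fl R M e F -> Fl R M e (conj_flag b F).
Proof.
move=> bb FF; have [ub _] := mulmx1_unit bb.
split=> [i|].
  have [Ft FP] := FF.1 i; split; first by rewrite /conj_flag !trmx_mul trmxK Ft mulmxA.
  rewrite /conj_flag -!mulmxA [b *m (b^T *m _)]mulmxA bb mul1mx.
  by rewrite [F i *m (F i *m b)]mulmxA FP.
split=> [i|i j ij]; rewrite !conj_flag_eqmx //.
  by rewrite mxrankMfree ?row_free_unit // FF.2.1.
by apply: submxMr; exact: FF.2.2.
Qed.

Lemma conj_flag_continuous (Z : topologicalType) (o : Z -> 'M[R]_M)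
    (f : Z -> flagspace R m M) z :
  {for z, continuous o} -> {for z, continuous f} ->
  {for z, continuous (fun y => conj_flag (o y) (f y))}.
Proof.
move=> co cf; apply: continuous_at_flag => i.
have cfi : {for z, continuous (fun y => f y i)}.
  apply: (@continuous_comp _ _ _ f (fun F : flagspace R m M => F i)) => //.
  exact: flag_coord_continuous.
exact: (continuous_at_mulmx (continuous_at_mulmx (continuous_at_trmx co) cfi) co).
Qed.

End Conjugation.

(** * Stratifications with sign changes *)

Section Stratification.
Variables (R : realType) (T : topologicalType) (K : finType) (X : set T).
Variables (P : {set K}) (cell : K -> set T) (cd : K -> nat).
Implicit Types (S : {set K}) (I J : K).

Definition variety J := X `&` closure (cell J).
Definition around J := X `\` (variety J `\` cell J).
Definition away J := X `\` variety J.
Definition strata S : set T := [set x | exists2 J, J \in S & cell J x].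
(** By the frontier condition the union of such a family is open in [X], and a cell of maximal
    codimension can be removed from it. *)
Definition lower S : Prop :=
  {subset S <= P} /\
  forall J J', J \in S -> J' \in P -> (cd J' < cd J)%N -> J' \in S.

Hypothesis cellX : forall J, J \in P -> cell J `<=` X.
Hypothesis cover : forall x, X x -> exists2 J, J \in P & cell J x.
Hypothesis frontier : forall I J x, I \in P -> J \in P ->
  cell J x -> closure (cell I) x ->
  cell J `<=` closure (cell I) /\ (J = I \/ (cd I < cd J)%N).

Lemma strataX S : {subset S <= P} -> strata S `<=` X.
Proof. by move=> SP x [J JS]; apply: cellX; exact: SP. Qed.

Lemma strataP : strata P = X.
Proof.
apply/seteqP; split; first exact: strataX.
by move=> x /cover.
Qed.

Lemma strataS S S' : {subset S' <= S} -> strata S' `<=` strata S.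
Proof. by move=> SS x [J JS xJ]; exists J => //; exact: SS. Qed.

Lemma strata_rel_open (Y : set T) S : Y `<=` X -> lower S -> strata S `<=` Y ->
  rel_open Y (strata S).
Proof.
move=> YX [SP low] SY.
exists (~` \bigcup_(J in [set J | J \in P /\ J \notin S]) closure (cell J)).
  apply: closed_openC; apply: closed_bigcup; first exact: finite_finset.
  by move=> J _; exact: closed_closure.
apply/seteqP; split=> [x Sx|x [Yx nx]].
  split; first exact: SY.
  case: Sx => J0 J0S xJ0 [J [JP nJS] xJ].
  have [_ [e|lt]] := frontier JP (SP _ J0S) xJ0 xJ.
    by rewrite -e J0S in nJS.
  by rewrite (low _ _ J0S JP lt) in nJS.
have [J JP xJ] := cover (YX _ Yx); exists J => //.
apply: contrapT => /negP nJS; apply: nx; exists J => //.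
exact: subset_closure.
Qed.

Lemma away_rel_open J : rel_open (around J) (away J).
Proof.
exists (~` closure (cell J)); first exact/closed_openC/closed_closure.
apply/seteqP; split=> [x [Xx nv]|x [[Xx na] nc]].
  split; first by split=> // -[] /nv.
  by move=> cx; apply: nv.
by split=> // -[].
Qed.

Lemma around_away J : away J `<=` around J.
Proof. exact: rel_open_sub (away_rel_open J). Qed.

Section Top.
Variables (S : {set K}) (J : K).
Hypotheses (lowS : lower S) (JS : J \in S).
Hypothesis Jmax : forall J', J' \in S -> (cd J' <= cd J)%N.

Let JP : J \in P. Proof. by apply: lowS.1. Qed.

Lemma lower_rem : lower (S :\ J).
Proof.
split; first by move=> J' /setD1P[_]; exact: lowS.1.
move=> J1 J2 /setD1P[_ J1S] J2P lt; rewrite in_setD1 (lowS.2 _ _ J1S J2P lt) andbT.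
by apply/eqP => e; have := Jmax J1S; rewrite -e leqNgt lt.
Qed.

Lemma strata_around : strata S `<=` around J.
Proof.
move=> x [J' J'S xJ']; split; first by apply: cellX xJ'; exact: lowS.1.
move=> [[_ cx] nx]; have [_ [e|lt]] := frontier JP (lowS.1 _ J'S) xJ' cx.
  by apply: nx; rewrite -e.
by have := Jmax J'S; rewrite leqNgt lt.
Qed.

Lemma strata_away : strata S `&` away J = strata (S :\ J).
Proof.
apply/seteqP; split=> x.
  case=> [[J' J'S xJ'] [Xx nv]]; exists J' => //; rewrite in_setD1 J'S andbT.
  by apply/eqP => e; apply: nv; split=> //; rewrite -e; exact: subset_closure.
case=> J' /setD1P[/eqP J'J J'S] xJ'; split; first by exists J'.
split; first by apply: cellX xJ'; exact: lowS.1.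
move=> [_ cx]; have [_ [//|lt]] := frontier JP (lowS.1 _ J'S) xJ' cx.
by have := Jmax J'S; rewrite leqNgt lt.
Qed.

Lemma aroundE : around J = strata S `|` away J.
Proof.
apply/seteqP; split=> [x [Xx nx]|x [/strata_around//|/around_away//]].
have [xc|xc] := pselect (cell J x); first by left; exists J.
by right; split=> // vx; apply: nx.
Qed.

Lemma strata_rem : strata S = strata (S :\ J) `|` cell J.
Proof.
apply/seteqP; split=> [x [J' J'S xJ']|x [[J' /setD1P[_ J'S] xJ']|xJ]].
- have [<-|J'J] := eqVneq J' J; first by right.
  by left; exists J' => //; rewrite in_setD1 J'J.
- by exists J'.
- by exists J.
Qed.

Lemma strata_rem_sub : strata (S :\ J) `<=` strata S.
Proof. by apply: strataS => J' /setD1P[]. Qed.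

End Top.

Lemma lower_ind (Q : {set K} -> Prop) : Q finset.set0 ->
  (forall S J, lower S -> J \in S ->
     (forall J', J' \in S -> (cd J' <= cd J)%N) -> Q (S :\ J)%SET -> Q S) ->
  forall S, lower S -> Q S.
Proof.
move=> Q0 QS S; move en: #|S| => n; elim: n S en => [|n IH] S en low.
  by rewrite (cards0_eq en).
have [J0 J0S] : exists J0, J0 \in S by apply/finset.set0Pn; rewrite -card_gt0 en.
have [J JS Jmax] : exists2 J, J \in S & forall J', J' \in S -> (cd J' <= cd J)%N.
  by case: (arg_maxnP cd J0S) => J JS Jmax; exists J.
apply: (QS _ J) => //; apply: IH; last exact: lower_rem.
by have := cardsD1 J S; rewrite en JS add1n => -[].
Qed.

Variable theta : forall k, K -> cochain R T int k.
Arguments theta : clear implicits.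
Hypothesis thom : forall J, J \in P ->
  thom_class (around J) (away J) (theta (cd J) J).

Variables (L : finType) (g : L -> T -> T) (chi : K -> L -> bool).
Hypothesis gcont : forall l, continuous_on X (g l).
Arguments gcont : clear implicits.
Hypothesis gcell : forall l J x, J \in P -> cell J x -> cell J (g l x).
Hypothesis gK : forall l x, g l (g l x) = x.
Hypothesis gC : forall l l' x, g l (g l' x) = g l' (g l x).
Hypothesis gscale : forall J l, J \in P ->
  scales_class (around J) (away J) (theta (cd J) J) (g l) ((-1) ^+ chi J l).
Hypothesis ghtp : forall l (A : comNzRingType) n (c : cochain R T A n),
  cocycle X set0 c -> cohomologous X set0 (pull (g l) c) c.

Lemma gstrata l S x : {subset S <= P} -> strata S x -> strata S (g l x).
Proof. by move=> SP [J JS xJ]; exists J => //; apply: gcell xJ; exact: SP. Qed.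

Lemma gX l x : X x -> X (g l x).
Proof. by rewrite -strataP; apply: gstrata. Qed.

Lemma gaway l I x : I \in P -> away I x -> away I (g l x).
Proof.
move=> IP [Xx nx]; split; first exact: gX.
move=> [_ cgx]; apply: nx; split=> //; have [J JP xJ] := cover Xx.
have [sub _] := frontier IP JP (gcell l JP xJ) cgx.
exact: sub.
Qed.

Lemma continuous_on_sub (U V : set T) (f : T -> T) :
  U `<=` V -> continuous_on V f -> continuous_on U f.
Proof. by move=> UV cf x /UV; exact: cf. Qed.

Section TopClass.
Variables (S : {set K}) (J : K).
Hypotheses (lowS : lower S) (JS : J \in S).
Hypothesis Jmax : forall J', J' \in S -> (cd J' <= cd J)%N.

Let JP : J \in P. Proof. by apply: lowS.1. Qed.

(** The union of the cells in [S] is an open part of [around J] that contains the cell of [J] and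
    meets its variety nowhere else, so the Thom class restricts to it by excision. *)
Lemma thom_top : thom_class (strata S) (strata (S :\ J)%SET) (theta (cd J) J).
Proof.
rewrite -(strata_away lowS JS Jmax); apply: thom_restrict (thom JP).
- apply: strata_rel_open (lowS) _; first by move=> x [].
  exact: strata_around.
- exact: away_rel_open.
- exact: aroundE.
Qed.

Lemma gscale_top l : scales_class (strata S) (strata (S :\ J)%SET)
  (theta (cd J) J) (g l) ((-1) ^+ chi J l).
Proof.
apply: is_coboundary_sub (gscale l JP); first exact: strata_around.
by rewrite -(strata_away lowS JS Jmax) => x [].
Qed.

End TopClass.

(** * Extending an invariant Thom class to a fundamental class *)

Section Fundamental.
Variable I : K.
Hypotheses (IP : I \in P) (chiI : forall l, chi I l = false).
Hypothesis odd_next : forall J, J \in P -> cd J = (cd I).+1 ->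
  exists l, chi J l.

Let k := cd I.
Let S0 := [set J in P | (cd J <= k)%N]%SET.
Let V S := strata S `&` away I.

(** Invariance up to coboundary is part of the induction, since the next obstruction is controlled
    by it. Agreement with [theta] on the first strata is literal, so it survives every step
    unchanged. *)
Definition extends_fundamental S (c : cochain R T int k) : Prop :=
  [/\ cocycle (strata S) (V S) c,
      forall s, simplices (strata S0) s -> c s = theta k I s &
      forall l, cohomologous (strata S) (V S) (pull (g l) c) c].

Let gV l S x : {subset S <= P} -> V S x -> V S (g l x).
Proof.
move=> SP [Sx ax]; split; first exact: gstrata.
exact: gaway.
Qed.

Let pullS l S n (A : comNzRingType) (c : cochain R T A n) : {subset S <= P} ->
  cocycle (strata S) (V S) c -> cocycle (strata S) (V S) (pull (g l) c).
Proof.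
move=> SP; apply: pull_cocycle.
- by apply: continuous_on_sub _ (gcont l); exact: strataX.
- by move=> x [].
- by move=> x; exact: gstrata.
- by move=> x; exact: gV.
Qed.

Let S0P : {subset S0 <= P}. Proof. by move=> J; rewrite inE => /andP[]. Qed.

Let S0low : lower S0.
Proof.
split=> // J J'; rewrite !inE => /andP[_ Jk] -> lt /=.
exact: leq_trans (ltnW lt) Jk.
Qed.

Let IS0 : I \in S0. Proof. by rewrite inE IP leqnn. Qed.

Let S0max J : J \in S0 -> (cd J <= cd I)%N.
Proof. by rewrite inE => /andP[]. Qed.

Let V0 : V S0 = strata (S0 :\ I)%SET. Proof. exact: strata_away. Qed.

Lemma fundamental_base : extends_fundamental S0 (theta k I).
Proof.
split=> //.
  by rewrite V0; exact: (thom_top S0low IS0 S0max).1.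
move=> l; rewrite V0.
apply: is_coboundary_eq (gscale_top S0low IS0 S0max l) => s _.
by rewrite chiI mul1r.
Qed.

(** The obstruction to extending over [J] is the class of [coboundary c'] in degree k+1 of the pair
    (W, W'), which is zero unless [J] has codimension k+1. In that case it is a multiple a of the
    Thom class of [J]; invariance and a sign change reversing that class give 2a = 0. *)
Lemma fundamental_step_in S J : lower S -> J \in S ->
  (forall J', J' \in S -> (cd J' <= cd J)%N) -> J \notin S0 ->
  {subset S0 <= (S :\ J)%SET} -> cell J `<=` closure (cell I) ->
  (exists c, extends_fundamental (S :\ J)%SET c) ->
  exists c, extends_fundamental S c.
Proof.
move=> lowS JS Jmax JS0 S0S cJ [c [cc cE cg]].
have JP : J \in P by exact: lowS.1.
have Jk : (k < cd J)%N by move: JS0; rewrite inE JP -ltnNge.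
set W := strata S; set W' := strata (S :\ J)%SET.
have WW : W' `<=` W by exact: strata_rem_sub.
have SP' : {subset (S :\ J)%SET <= P} := (lower_rem lowS Jmax).1.
(* The added cell lies inside the variety of [I], so nothing new is away from it. *)
have VE : V S = V (S :\ J)%SET.
  apply/seteqP; split=> [x [Sx ax]|x [/WW Sx ax]] //; split=> //.
  move: Sx; rewrite (strata_rem JS) => -[//|/[dup] xJ /cJ cx].
  by case: ax => Xx []; split.
have VW' : V S `<=` W' by rewrite VE => x [].
have VW : V S `<=` W by exact: subset_trans VW' WW.
have [thc thA] := thom_top lowS JS Jmax; rewrite -/W -/W' in thc thA.
have gW l x : W x -> W (g l x) by apply: gstrata; exact: lowS.1.
have gW' l x : W' x -> W' (g l x) by exact: gstrata.
have cW l : continuous_on W (g l).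
  by apply: continuous_on_sub _ (gcont l); apply: strataX; exact: lowS.1.
pose c' := extend0 W' c.
have c'E s : simplices W' s -> c' s = c s by exact: extend0E.
have c'V : vanishes_on (V S) c'.
  by apply: extend0_vanishes => s Vs; apply: cc.1; apply: simplices_sub Vs;
    rewrite -VE => x [].
have gs l n (s : stdsimplex R n -> T) : simplices W' s -> simplices W' (g l \o s).
  by apply: (simplices_comp (cW l)) => //; exact: gW'.
have dc' : cocycle W W' (coboundary c').
  split; last by move=> s _; rewrite coboundary_coboundary.
  by move=> s Ws; rewrite (eq_coboundary c'E Ws) cc.2.
have [b b0 bE] : exists2 b : cochain R T int k, vanishes_on W' b &
    forall s, simplices W s -> coboundary c' s = coboundary b s.
  suff : is_coboundary W W' (coboundary c') by case=> b [b0 bE]; exists b.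
  have [deg gen fr] := thA int.
  have [ck|ck] := eqVneq (cd J) k.+1; last first.
    by apply: deg => // e; rewrite e eqxx in ck.
  have [l chil] := odd_next JP ck.
  have thc1 := thc; have gs1 := gscale_top lowS JS Jmax l.
  rewrite chil expr1 -/W -/W' in gs1.
  move: gen fr gs1 thc1; rewrite ck => gen fr gs1 thc1.
  have [a ca] := gen _ dc'.
  (* Over [W'] the cochain [c] and its pullback differ by a coboundary. Extending that coboundary to
     [W] shows that the obstruction itself is invariant relative to [W']. *)
  pose f : cochain R T int k := fun s => pull (g l) c' s - c' s.
  have fb : is_coboundary W' (V S) f.
    rewrite VE; apply: is_coboundary_eq (cg l) => s Ws.
    by rewrite /f /pull !c'E //; exact: gs.
  have [h [_ hE dh]] := coboundary_extend WW VW' fb.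
  have gdc : cohomologous W W' (pull (g l) (coboundary c')) (coboundary c').
    exists (fun s => f s - h s); split.
      by move=> s Ws; rewrite hE // subrr.
    by move=> s Ws; rewrite coboundaryB dh subr0 coboundaryB.
  have gca := pull_coboundary (cW l) WW (gW l) (gW' l) ca.
  have gth := cohomologousZ a (cohomologous_coef int gs1).
  have chain : is_coboundary W W' (fun s => (a + a) * coef int (theta k.+1 J) s).
    have := is_coboundaryB (is_coboundaryD gdc (is_coboundaryB ca gca)) gth.
    move=> /is_coboundaryN; apply: is_coboundary_eq => s _.
    by rewrite /pull /coef !intz; ring.
  have a0 : a = 0.
    by have /eqP := fr _ chain; rewrite -mulr2n mulrn_eq0 => /eqP.
  by apply: is_coboundary_eq ca => s _; rewrite a0 mul0r subr0.
exists (fun s => c' s - b s); split.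
- split=> s Ws; last by rewrite coboundaryB -bE // subrr.
  by rewrite c'V // b0 ?subrr //; exact: simplices_sub Ws.
- move=> s Ss; have Ws : simplices W' s by apply: simplices_sub Ss; exact: strataS.
  by rewrite c'E // b0 // subr0 cE.
move=> l; set c2 : cochain R T int k := fun s => c' s - b s.
have c2E s : simplices W' s -> c2 s = c s.
  by move=> Ws; rewrite /c2 c'E // b0 // subr0.
have cc2 : cocycle W (V S) c2.
  split=> s Ws; last by rewrite coboundaryB -bE // subrr.
  by rewrite /c2 c'V // b0 ?subrr //; exact: simplices_sub Ws.
pose f : cochain R T int k := fun s => pull (g l) c2 s - c2 s.
have fb : is_coboundary W' (V S) f.
  rewrite VE; apply: is_coboundary_eq (cg l) => s Ws.
  by rewrite /f /pull !c2E //; exact: gs.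
have [h [hb hE dh]] := coboundary_extend WW VW' fb.
(* What remains of the defect of invariance is a cocycle of the pair (W, W') in degree k, below the
   codimension of [J], where this pair has no cohomology. *)
have fc : cocycle W W' (fun s => f s - h s).
  split=> s Ws; first by rewrite hE // subrr.
  rewrite coboundaryB dh subr0 coboundaryB cc2.2 // subr0.
  by apply: (pullS l lowS.1 cc2).2.
have [deg _ _] := thA int.
have := is_coboundary_sub (@subset_refl _ W) VW' (deg _ _ _ fc).
have kJ : k <> cd J by move=> e; move: Jk; rewrite e ltnn.
move=> /(_ kJ) /(is_coboundaryD hb); apply: is_coboundary_eq => s _.
by rewrite addrC subrK.
Qed.

(** When the new cell misses the closure of the cell of [I] it lies in the region where the class
    must vanish, so the extension is pure excision and invariance follows the same way. *)
Lemma fundamental_step_out S J : lower S -> J \in S ->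
  (forall J', J' \in S -> (cd J' <= cd J)%N) -> J \notin S0 ->
  {subset S0 <= (S :\ J)%SET} -> (forall x, cell J x -> ~ closure (cell I) x) ->
  (exists c, extends_fundamental (S :\ J)%SET c) ->
  exists c, extends_fundamental S c.
Proof.
move=> lowS JS Jmax JS0 S0S nJ [c [cc cE cg]].
have JP : J \in P by exact: lowS.1.
set W := strata S; set W' := strata (S :\ J)%SET.
have WW : W' `<=` W by exact: strata_rem_sub.
have lowS' := lower_rem lowS Jmax.
have WX : W `<=` X by apply: strataX; exact: lowS.1.
have WE : W = W' `|` V S.
  apply/seteqP; split=> [x|x [/WW//|[]//]].
  rewrite /W (strata_rem JS) => -[|xJ]; [by left|right; split; first by exists J].
  by split=> [|[_ /nJ]]; [exact: cellX xJ|apply].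
have VE : W' `&` V S = V (S :\ J)%SET.
  by apply/seteqP; split=> [x [Wx [_ ax]]|x [Wx ax]]; split=> //; split=> //; exact: WW.
have rW : rel_open W W' by apply: strata_rel_open.
have rV : rel_open W (V S).
  exists (~` closure (cell I)); first exact/closed_openC/closed_closure.
  apply/seteqP; split=> [x [Sx [Xx nx]]|x [Sx nx]].
    by split=> // cx; apply: nx.
  by split=> //; split; [exact: WX|case].
have cW l : continuous_on W (g l) by exact: continuous_on_sub _ (gcont l).
have gs l n (s : stdsimplex R n -> T) : simplices W' s -> simplices W' (g l \o s).
  by apply: (simplices_comp (cW l)) => // x; apply: gstrata; exact: lowS'.1.
rewrite -VE in cc; have [c' cc' c'E] := excision_extend rW rV WE cc.
exists c'; split=> // [s Ss|l].
  have Ws : simplices W' s by apply: simplices_sub Ss; exact: strataS.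
  by rewrite c'E // cE.
apply: (excision_coboundary rW rV WE).
  by apply: cocycleB => //; apply: pullS => //; exact: lowS.1.
rewrite VE; apply: is_coboundary_eq (cg l) => s Ws.
by rewrite /pull !c'E //; exact: gs.
Qed.

(** The neighbourhood [around I] is covered by the first strata, where the extension equals [theta],
    and by [away I], where both vanish; excision identifies their classes. *)
Lemma fundamental_ex : exists2 c : cochain R T int (cd I),
  cocycle X (away I) c & cohomologous (around I) (away I) c (theta (cd I) I).
Proof.
suff h S : lower S -> {subset S0 <= S} -> exists c, extends_fundamental S c.
  have PP : lower P by split.
  have [c [cc cE _]] := h P PP S0P.
  have VP : V P = away I.
    by rewrite /V strataP; apply/seteqP; split=> [x []//|x ax]; split=> //; case: ax.
  rewrite VP strataP in cc; exists c => //.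
  have aX : around I `<=` X by move=> x [].
  have S0a := strata_around S0low IS0 S0max.
  apply: (excision_coboundary (strata_rel_open aX S0low S0a) (away_rel_open I)
    (aroundE S0low IS0 S0max)).
    apply: cocycleB; first exact: cocycle_sub cc.
    exact: (thom IP).1.
  by apply: is_coboundary0 => s Ss; rewrite cE // subrr.
move: S; apply: lower_ind => [sub|S J lowS JS Jmax IH S0S].
  by have := sub _ IS0; rewrite inE.
have [JS0|JS0] := boolP (J \in S0).
  suff <- : S0 = S by exists (theta k I); exact: fundamental_base.
  apply/eqP; rewrite finset.eqEsubset; apply/andP; split; apply/fintype.subsetP => J' J'S.
    exact: S0S.
  rewrite inE lowS.1 //=; apply: leq_trans (Jmax _ J'S) _.
  exact: S0max.
have S0S' : {subset S0 <= (S :\ J)%SET}.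
  by move=> J' J'S0; rewrite in_setD1 S0S // andbT; apply: contraNneq JS0 => <-.
have [[x [xJ cx]]|nx] := pselect (exists x, cell J x /\ closure (cell I) x).
  apply: fundamental_step_in (IH S0S') => //.
  by have [] := frontier IP (lowS.1 _ JS) xJ cx.
apply: fundamental_step_out (IH S0S') => // x xJ cx.
by apply: nx; exists x.
Qed.

End Fundamental.

(** * The rational basis *)

Section Rational.
Variables (B : finType) (D : {set B}) (dbl : B -> K).
Hypothesis dblP : forall i, i \in D -> dbl i \in P.
Hypothesis dbl_inj : {in D &, injective dbl}.
Hypothesis dbl_chi : forall i l, i \in D -> chi (dbl i) l = false.
Hypothesis dbl_even : forall i, i \in D -> ~~ odd (cd (dbl i)).
Hypothesis chi_split : forall J, J \in P -> (forall i, i \in D -> J <> dbl i) ->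
  exists l, chi J l.

Variable c : forall k, B -> cochain R T int k.
Arguments c : clear implicits.
Hypothesis c_cocycle : forall i, i \in D ->
  cocycle X (away (dbl i)) (c (cd (dbl i)) i).
Hypothesis c_theta : forall i, i \in D ->
  cohomologous (around (dbl i)) (away (dbl i)) (c (cd (dbl i)) i)
    (theta (cd (dbl i)) (dbl i)).

Definition comb n (a : B -> rat) : cochain R T rat n :=
  fun s => \sum_(i in D | cd (dbl i) == n) a i * coef rat (c n i) s.
Arguments comb : clear implicits.

Lemma cocycle_sum (A : comNzRingType) (U V : set T) n (J : finType) (p : pred J)
    (f : J -> cochain R T A n) : (forall j, p j -> cocycle U V (f j)) ->
  cocycle U V (fun s => \sum_(j | p j) f j s).
Proof.
move=> cf; split=> s Us; first by rewrite big1 // => j /cf[+ _]; apply.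
rewrite /coboundary; under eq_bigr do rewrite mulr_sumr.
by rewrite exchange_big big1 // => j /cf[_]; apply.
Qed.

Lemma comb_cocycle n a : cocycle X set0 (comb n a).
Proof.
apply: cocycle_sum => i /andP[ID /eqP <-]; apply/cocycleZ/cocycle_coef.
exact: cocycle_sub (@subset_refl _ X) (@sub0set _ _) (c_cocycle ID).
Qed.

Let pull0 l S n (A : comNzRingType) (z : cochain R T A n) : lower S ->
  is_coboundary (strata S) set0 z -> is_coboundary (strata S) set0 (pull (g l) z).
Proof.
move=> low; apply: pull_coboundary => //.
- by apply: continuous_on_sub _ (gcont l); apply: strataX; exact: low.1.
- by move=> x; apply: gstrata; exact: low.1.
Qed.

(** Relative to the lower strata [y] is a multiple of the Thom class, which the sign change
    reverses. Its invariance is known only absolutely, so the conclusion is absolute as well: [y] is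
    cohomologous to its own negative. *)
Lemma rational_step S J l n (y : cochain R T rat n) : lower S -> J \in S ->
  (forall J', J' \in S -> (cd J' <= cd J)%N) -> chi J l ->
  cocycle (strata S) (strata (S :\ J)%SET) y ->
  cohomologous (strata S) set0 (pull (g l) y) y ->
  is_coboundary (strata S) set0 y.
Proof.
move=> low JS Jmax chil cy gy.
have [_ thA] := thom_top low JS Jmax; have [deg gen _] := thA rat.
have gs := gscale_top low JS Jmax l; rewrite chil expr1 in gs.
set W := strata S in gy gs deg gen *; set W' := strata _ in gs deg gen cy.
have sub n' (z : cochain R T rat n') : is_coboundary W W' z -> is_coboundary W set0 z.
  by apply: is_coboundary_sub => // x [].
have [nJ|/eqP nJ] := eqVneq n (cd J); last by apply: sub; exact: deg.
move: gen gs; rewrite -nJ => gen gs; have [q yq] := gen _ cy.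
have yq0 := sub _ _ yq.
have gyq := pull0 l low yq0.
have gq := cohomologousZ q (sub _ _ (cohomologous_coef rat gs)).
(* The bracket is a sum of four coboundaries in which everything cancels except 2y. *)
have : is_coboundary W set0 (fun s => 2%:R^-1 * ((y s - q * coef rat (theta n J) s) -
    (pull (g l) y s - y s) + (pull (g l) y s - q * pull (g l) (coef rat (theta n J)) s) +
    (q * pull (g l) (coef rat (theta n J)) s - q * coef rat (fun s => -1 * theta n J s) s))).
  apply: is_coboundaryZ; apply: is_coboundaryD gq; apply: is_coboundaryD gyq.
  exact: is_coboundaryB yq0 gy.
apply: is_coboundary_eq => s _.
rewrite [coef rat (fun s => -1 * theta n J s) s]/coef rmorphM rmorphN1.
rewrite -/(coef rat (theta n J) s); by field.
Qed.

Lemma is_coboundary_set0 (A : comNzRingType) (V : set T) n (z : cochain R T A n) :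
  is_coboundary set0 V z.
Proof.
apply: is_coboundary0 => s [_ /(_ (s (vertex0 R n)))] h.
by exfalso; apply: h; exists (vertex0 R n).
Qed.

Lemma strata0 : strata finset.set0 = set0.
Proof. by apply/seteqP; split=> // x [J]; rewrite inE. Qed.

Lemma gcomb l S n a : lower S ->
  cohomologous (strata S) set0 (pull (g l) (comb n a)) (comb n a).
Proof.
move=> low; have := ghtp l (comb_cocycle n a).
by apply: is_coboundary_sub => //; apply: strataX; exact: low.1.
Qed.

(** Subtracting the combination found on the lower strata leaves a class [y] relative to them. If
    [J] is not doubled, [y] bounds by [rational_step]; if it is, [y] is a multiple of the Thom
    class, hence of the fundamental class, and one coefficient is adjusted. *)
Lemma rational_span S : lower S -> forall n (z : cochain R T rat n),
  cocycle (strata S) set0 z ->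
  (forall l, cohomologous (strata S) set0 (pull (g l) z) z) ->
  exists a, cohomologous (strata S) set0 z (comb n a).
Proof.
move: S; apply: lower_ind => [n z _ _|S J low JS Jmax IH n z cz gz].
  by exists (fun=> 0); rewrite strata0; exact: is_coboundary_set0.
set W := strata S in cz gz *; set W' := strata (S :\ J)%SET in IH.
have WW : W' `<=` W by exact: strata_rem_sub.
have zero : set0 `<=` W' by [].
have cz' : cocycle W' set0 z by exact: cocycle_sub cz.
have gz' l : cohomologous W' set0 (pull (g l) z) z.
  exact: is_coboundary_sub (gz l).
have [a za] := IH n z cz' gz'.
have [h [hb hE dh]] := coboundary_extend WW zero za.
pose y : cochain R T rat n := fun s => z s - comb n a s - h s.
have WX : W `<=` X by apply: strataX; exact: low.1.
have cc := cocycle_sub WX (@subset_refl _ set0) (comb_cocycle n a).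
have cy : cocycle W W' y.
  split=> s Ws; first by rewrite /y hE // subrr.
  by rewrite coboundaryB dh subr0 (cocycleB cz cc).2.
have gy l : cohomologous W set0 (pull (g l) y) y.
  have := is_coboundaryB (is_coboundaryB (gz l) (gcomb l n a low))
    (is_coboundaryB (pull0 l low hb) hb).
  by apply: is_coboundary_eq => s _; rewrite /y /pull; ring.
have conclude b : is_coboundary W set0 (fun s => y s - (comb n b s - comb n a s)) ->
    cohomologous W set0 z (comb n b).
  move=> /is_coboundaryD/(_ hb); apply: is_coboundary_eq => s _; rewrite /y; ring.
have [[i ID JI]|nI] := pselect (exists2 i, i \in D & J = dbl i); last first.
  have [|l chil] := chi_split (low.1 _ JS).
    by move=> i ID JI; apply: nI; exists i.
  exists a; apply: conclude.
  apply: is_coboundary_eq (rational_step low JS Jmax chil cy (gy l)) => s _; ring.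
have [_ thA] := thom_top low JS Jmax; have [deg gen _] := thA rat.
rewrite -/W -/W' in deg gen.
have sub n' (x : cochain R T rat n') : is_coboundary W W' x -> is_coboundary W set0 x.
  exact: is_coboundary_sub.
have [nJ|/eqP nJ] := eqVneq n (cd J); last first.
  exists a; apply: conclude.
  by apply: is_coboundary_eq (sub _ _ (deg _ _ nJ cy)) => s _; ring.
move: gen; rewrite -nJ => gen; have [q yq] := gen _ cy.
exists (fun j => if j == i then a j + q else a j); apply: conclude.
have ct : cohomologous W W' (c n i) (theta n J).
  have := c_theta ID; rewrite -JI -nJ; apply: is_coboundary_sub.
    exact: strata_around.
  by rewrite /W' -(strata_away low JS Jmax) => x [].
have := is_coboundaryB yq (cohomologousZ q (cohomologous_coef rat ct)).
move=> /sub; apply: is_coboundary_eq => s _.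
rewrite /comb -sumrB (bigD1 i) /=; last by rewrite ID -JI nJ eqxx.
rewrite eqxx big1 => [|j /andP[_ /negPf ->]]; last by rewrite subrr.
ring.
Qed.

(** Sign changes are averaged in one after another. With g f - f the coboundary of [h], the mean of
    b1 and its pullback minus h/2 is again a primitive of [f], and [h] is zero on the lower strata.
    There the involution gives invariance under the new map, and commutation preserves the earlier
    ones. *)
Lemma average S J n (f : cochain R T rat n.+1) (b : cochain R T rat n) :
  lower S -> (forall J', J' \in S -> (cd J' <= cd J)%N) ->
  (forall l, is_coboundary (strata S) (strata (S :\ J)%SET)
    (fun s => pull (g l) f s - f s)) ->
  (forall s, simplices (strata S) s -> f s = coboundary b s) ->
  forall ls : seq L, exists b' : cochain R T rat n,
    (forall s, simplices (strata S) s -> f s = coboundary b' s) /\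
    forall l s, l \in ls -> simplices (strata (S :\ J)%SET) s ->
      b' (g l \o s) = b' s.
Proof.
move=> low Jmax fg fb; set W := strata S in fg fb *; set W' := strata _ in fg *.
have WX : W `<=` X by apply: strataX; exact: low.1.
have WW : W' `<=` W by exact: strata_rem_sub.
have gW l k (s : stdsimplex R k -> T) : simplices W s -> simplices W (g l \o s).
  apply: (simplices_comp (continuous_on_sub WX (gcont l))) => // x.
  by apply: gstrata; exact: low.1.
have gW' l k (s : stdsimplex R k -> T) : simplices W' s -> simplices W' (g l \o s).
  apply: (simplices_comp (continuous_on_sub WX (gcont l))) => // x.
  by apply: gstrata; exact: (lower_rem low Jmax).1.
elim=> [|l ls [b1 [b1f b1g]]]; first by exists b.
have [h [h0 hE]] := fg l.
pose b' : cochain R T rat n := fun s => 2%:R^-1 * (b1 s + pull (g l) b1 s) - 2%:R^-1 * h s.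
exists b'; split.
  move=> s Ws; rewrite /b' coboundaryB !coboundaryZ coboundaryD -b1f // -hE //.
  rewrite -[coboundary (pull (g l) b1) s]/(coboundary b1 (g l \o s)) -b1f; last exact: gW.
  by rewrite /pull; by field.
have b'E s : simplices W' s -> b' s = 2%:R^-1 * (b1 s + b1 (g l \o s)).
  by move=> Ws; rewrite /b' h0 // mulr0 subr0.
move=> l' s; rewrite inE => /orP[/eqP ->|l'ls] Ws.
  rewrite (b'E s Ws) (b'E _ (gW' l _ _ Ws)).
  have -> : g l \o (g l \o s) = s by apply/funext => x /=; rewrite gK.
  by rewrite addrC.
rewrite (b'E s Ws) (b'E _ (gW' l' _ _ Ws)).
have -> : g l \o (g l' \o s) = g l' \o (g l \o s).
  by apply/funext => x /=; rewrite gC.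
by rewrite (b1g _ _ l'ls Ws) (b1g _ _ l'ls (gW' l _ _ Ws)).
Qed.

(* H^{n-1} of the lower strata has no invariant part when n is even, so
   averaging a primitive over the symmetries kills the obstruction. *)
Lemma coboundary_descend S J n (f : cochain R T rat n) :
  lower S -> (forall J', J' \in S -> (cd J' <= cd J)%N) ->
  ~~ odd n -> cocycle (strata S) (strata (S :\ J)%SET) f ->
  (forall l, is_coboundary (strata S) (strata (S :\ J)%SET)
    (fun s => pull (g l) f s - f s)) ->
  (forall n' (z : cochain R T rat n'), cocycle (strata (S :\ J)%SET) set0 z ->
     (forall l, cohomologous (strata (S :\ J)%SET) set0 (pull (g l) z) z) ->
     odd n' -> is_coboundary (strata (S :\ J)%SET) set0 z) ->
  is_coboundary (strata S) set0 f ->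
  is_coboundary (strata S) (strata (S :\ J)%SET) f.
Proof.
case: n f => [//|n] f low Jmax; rewrite /= negbK => on cf fg span [b [_ fb]].
have [b' [b'f b'g]] := average low Jmax fg fb (enum L).
have WW : strata (S :\ J)%SET `<=` strata S by exact: strata_rem_sub.
have cb : cocycle (strata (S :\ J)%SET) set0 b'.
  split=> s Ws.
    by case: Ws => _ /(_ (s (vertex0 R n))) h; exfalso; apply: h; exists (vertex0 R n).
  rewrite -b'f; last exact: simplices_sub Ws.
  by rewrite cf.1.
have gb l : cohomologous (strata (S :\ J)%SET) set0 (pull (g l) b') b'.
  apply: is_coboundary0 => s Ws; rewrite /pull b'g ?subrr //.
  by rewrite mem_enum.
(* On the lower strata the averaged primitive is an invariant cocycle of odd degree, hence a
   coboundary; removing it makes the primitive vanish there. *)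
have [h [_ hE dh]] := coboundary_extend WW (@sub0set _ _) (span _ _ cb gb on).
exists (fun s => b' s - h s); split=> s Ws.
  by rewrite hE // subrr.
by rewrite coboundaryB dh subr0 b'f.
Qed.

(** On the strata of [S], classes of cells outside [S] vanish identically, and the coefficients of
    earlier cells are 0 by induction. So only the multiple of the class of the top cell [J] is left
    to bound. *)
Lemma rational_free S : lower S -> forall n (a : B -> rat),
  is_coboundary (strata S) set0 (comb n a) ->
  forall i, i \in D -> dbl i \in S -> cd (dbl i) = n -> a i = 0.
Proof.
move: S; apply: lower_ind => [n a _ i _|S J low JS Jmax IH n a ca i ID IS In].
  by rewrite inE.
have WW : strata (S :\ J)%SET `<=` strata S by exact: strata_rem_sub.
have IH' := IH n a (is_coboundary_sub WW (@subset_refl _ set0) ca).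
have [JI|JI] := eqVneq (dbl i) J; last first.
  by apply: IH' => //; rewrite in_setD1 JI.
set W := strata S in ca WW *; set W' := strata (S :\ J)%SET in IH WW.
have W'away : W' `<=` away J by rewrite /W' -(strata_away low JS Jmax) => x [].
have Wc j : j \in D -> dbl j \notin S -> W `<=` away (dbl j).
  move=> jD jS x [J' J'S xJ']; split; first by apply: cellX xJ'; exact: low.1.
  move=> [_ cx]; have [_ [e|lt]] := frontier (dblP jD) (low.1 _ J'S) xJ' cx.
    by rewrite -e J'S in jS.
  by rewrite (low.2 _ _ J'S (dblP jD) lt) in jS.
pose cI := coef rat (c n i).
have cIc : cocycle X (away J) cI.
  by apply: cocycle_coef; have := c_cocycle ID; rewrite In JI.
have cIb : is_coboundary W set0 (fun s => a i * cI s).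
  apply: is_coboundary_eq ca => s Ws; rewrite /comb (bigD1 i) /=; last by rewrite ID In eqxx.
  rewrite big1 ?addr0 // => j /andP[/andP[jD /eqP jn] jI].
  have [jS|jS] := boolP (dbl j \in S).
    rewrite IH' ?mul0r // in_setD1 jS andbT -JI.
    by apply: contraNneq jI => /(dbl_inj jD ID) ->.
  have := c_cocycle jD; rewrite jn => -[c0 _].
  by rewrite /coef c0 ?mulr0 //; exact: simplices_sub (Wc j jD jS) Ws.
have nJ : n = cd J by rewrite -In JI.
have [_ thA] := thom_top low JS Jmax; have [_ _ fr] := thA rat.
have gs l := gscale_top low JS Jmax l.
rewrite -/W -/W' -nJ in fr gs.
have ct : cohomologous W W' (c n i) (theta n J).
  have := c_theta ID; rewrite In JI; apply: is_coboundary_sub.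
    exact: strata_around.
  by rewrite /W' -(strata_away low JS Jmax) => x [].
have WX : W `<=` X by apply: strataX; exact: low.1.
have ctq := cohomologous_coef rat ct.
(* It bounds absolutely; once it bounds relative to the lower strata, freeness of the Thom class
   gives the coefficient. *)
suff /is_coboundaryD/(_ (cohomologousZ (a i) (cohomologous_sym ctq))) h :
    is_coboundary W W' (fun s => a i * cI s).
  by apply: fr; apply: is_coboundary_eq h => s _; rewrite /cI; ring.
apply: coboundary_descend => //.
- by rewrite -In; exact: dbl_even.
- apply: cocycleZ; apply: cocycle_sub cIc => //.
- move=> l.
  have gct := pull_coboundary (continuous_on_sub WX (gcont l)) WW
    (fun x => gstrata l low.1) (fun x => gstrata l (lower_rem low Jmax).1) ctq.
  have gsq := cohomologous_coef rat (gs l).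
  rewrite -JI dbl_chi // expr0 in gsq.
  have := is_coboundaryZ (a i) (is_coboundaryB (is_coboundaryD gct gsq) ctq).
  apply: is_coboundary_eq => s _.
  rewrite [coef rat (fun s => 1 * theta n (dbl i) s) s]/coef mul1r /cI /pull /coef.
  by rewrite -JI; ring.
(* Invariant classes of the lower strata are combinations of doubled classes by [rational_span], and
   such combinations are empty in odd degree. *)
- move=> n' z cz gz; have [b zb] := rational_span (lower_rem low Jmax) cz gz.
  move=> on; apply: cohomologous_coboundary zb _; apply: is_coboundary0 => s _.
  rewrite /comb big1 // => j /andP[jD /eqP jn].
  by have := dbl_even jD; rewrite jn on.
Qed.

End Rational.

End Stratification.

Section ThomHomeo.
Variables (R : realType) (T T' : topologicalType).
Variables (U V : set T) (U' V' : set T') (f : T -> T') (k : T' -> T).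
Hypotheses (cf : continuous_on U f) (ck : continuous_on U' k).
Hypotheses (VU : V `<=` U) (VU' : V' `<=` U').
Hypotheses (fU : forall x, U x -> U' (f x)) (fV : forall x, V x -> V' (f x)).
Hypotheses (kU : forall x, U' x -> U (k x)) (kV : forall x, V' x -> V (k x)).
Hypothesis fK : forall x, U x -> k (f x) = x.

Lemma pullK (A : comNzRingType) n (c : cochain R T A n) s :
  simplices U s -> pull f (pull k c) s = c s.
Proof.
move=> [_ sU]; congr c; apply/funext => x /=.
by rewrite fK //; apply: sU; exists x.
Qed.

Hypothesis kK : forall x, U' x -> f (k x) = x.

Lemma pullK' (A : comNzRingType) n (c : cochain R T' A n) s :
  simplices U' s -> pull k (pull f c) s = c s.
Proof.
move=> [_ sU]; congr c; apply/funext => x /=.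
by rewrite kK //; apply: sU; exists x.
Qed.

Lemma thom_homeo j (tau : cochain R T' int j) :
  thom_class U' V' tau -> thom_class U V (pull f tau).
Proof.
move=> [ct th]; split; first exact: pull_cocycle cf VU fU fV _ _ ct.
move=> A; have [deg gen fr] := th A; split.
- move=> n c nj cc.
  have := pull_coboundary cf VU fU fV (deg _ _ nj (pull_cocycle ck VU' kU kV cc)).
  by apply: is_coboundary_eq => s Us; exact: pullK.
- move=> c cc; have [a ca] := gen _ (pull_cocycle ck VU' kU kV cc).
  exists a; apply: is_coboundary_eq (pull_coboundary cf VU fU fV ca) => s Us.
  by rewrite -[in RHS](pullK c Us).
- move=> a h; apply: fr.
  apply: is_coboundary_eq (pull_coboundary ck VU' kU kV h) => s Us.
  by rewrite /coef -[in RHS](pullK' tau Us).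
Qed.

Lemma scales_homeo j (tau : cochain R T' int j) g g' (e : int) :
  (forall x, U x -> f (g x) = g' (f x)) ->
  scales_class U' V' tau g' e -> scales_class U V (pull f tau) g e.
Proof.
move=> fg /(pull_coboundary cf VU fU fV); apply: is_coboundary_eq => s [_ sU].
rewrite /pull; congr (tau _ - _); apply/funext => x /=.
by rewrite fg //; apply: sU; exists x.
Qed.

End ThomHomeo.

(** * Sign changes on flags and Thom classes of the cells *)

Section Signs.
Variables (R : realType) (m M : nat) (e : 'I_m -> nat).
Implicit Types (F : flagspace R m M) (t : 'I_M -> bool).
Implicit Types I J : {ffun 'I_m -> {set 'I_M}}.

Definition sign_mx t : 'M[R]_M := diag_mx (\row_l (-1) ^+ t l).

Lemma sign_mxE t i j : sign_mx t i j = (-1) ^+ t i * (i == j)%:R.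
Proof. by rewrite !mxE; case: eqP => [->|]; rewrite ?mulr1 ?mulr0 ?mulr1n ?mulr0n. Qed.

Lemma sign_mx_tr t : (sign_mx t)^T = sign_mx t.
Proof. exact: tr_diag_mx. Qed.

Lemma mul_sign_mx t (A : 'M[R]_M) i j : (sign_mx t *m A) i j = (-1) ^+ t i * A i j.
Proof. by rewrite mul_diag_mx !mxE. Qed.

Lemma mulmx_sign t (A : 'M[R]_M) i j : (A *m sign_mx t) i j = A i j * (-1) ^+ t j.
Proof. by rewrite mul_mx_diag !mxE. Qed.

Lemma sign_mxK t : sign_mx t *m sign_mx t = 1%:M.
Proof.
apply/matrixP => i j; rewrite mul_sign_mx sign_mxE mxE mulrA -expr2 sqrr_sign.
by rewrite mul1r.
Qed.

Lemma sign_mx_orth t : sign_mx t *m (sign_mx t)^T = 1%:M.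
Proof. by rewrite sign_mx_tr sign_mxK. Qed.

Lemma sign_mx_unit t : sign_mx t \in unitmx.
Proof. by have [] := mulmx1_unit (sign_mxK t). Qed.

Lemma sign_mxC t t' : sign_mx t *m sign_mx t' = sign_mx t' *m sign_mx t.
Proof. exact: diag_mxC. Qed.

Lemma sign_mx_diagm t p : sign_mx t *m diagm R p = diagm R p *m sign_mx t.
Proof. exact: diag_mxC. Qed.

Definition flip t F : flagspace R m M := conj_flag (sign_mx t) F.

Lemma flipK t F : flip t (flip t F) = F.
Proof.
apply/funext => i; rewrite /flip /conj_flag sign_mx_tr !mulmxA sign_mxK mul1mx.
by rewrite -mulmxA sign_mxK mulmx1.
Qed.

Lemma flipC t t' F : flip t (flip t' F) = flip t' (flip t F).
Proof.
apply/funext => i; rewrite /flip /conj_flag !sign_mx_tr !mulmxA sign_mxC.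
by rewrite -[LHS]mulmxA [X in _ *m X]sign_mxC mulmxA.
Qed.

Lemma flip_continuous_flag t : continuous (flip t).
Proof.
move=> F; apply: (conj_flag_continuous (o := fun=> sign_mx t) (f := id)).
  exact: cst_continuous.
exact: cvg_id.
Qed.

Lemma flip_cell I t F : I \in OSP M e ->
  schubert_cell e I F -> schubert_cell e I (flip t F).
Proof.
move=> OI cF; apply: (schubert_cell_act OI (sign_mx_unit t) _ _ _ cF).
- move=> k; apply/eqmxP; rewrite pid_diagm -sign_mx_diagm submxMl /=.
  rewrite -[X in (X <= _)%MS](_ : sign_mx t *m
    (sign_mx t *m diagm R (fun l : 'I_M => (l < k)%N)) = _).
    exact: submxMl.
  by rewrite mulmxA sign_mxK mul1mx.
- by move=> i; apply: conj_flag_eqmx; exact: sign_mx_orth.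
- by apply: conj_flag_Fl; [exact: sign_mx_orth|case: cF].
Qed.

(** The sign matrix commutes with [upto i], and multiplying by it on the left does not change a row
    space; so flipping the flag of 1 + x conjugates x, which changes only the signs of its
    entries. *)
Lemma flip_chart I t (x : 'M[R]_M) : mx_supp (blk_lt_rel I) x ->
  flip t (chart I x) =
  chart I (flip_entries (fun i j => t i (+) t j) x) :> flagspace R m M.
Proof.
move=> Yx; set x' := flip_entries _ x.
have Yx' : mx_supp (blk_lt_rel I) x' by exact: flip_supp.
have x'E : x' = sign_mx t *m x *m sign_mx t.
  apply/matrixP => i j; rewrite mxE mulmx_sign mul_sign_mx.
  by rewrite signr_addb mulrAC -mulrA [x i j * _]mulrC.
have pc i := chart_proj i Yx.
apply/funext => i; apply: proj_eq.
- rewrite /flip /conj_flag; move: (chart I x i) (pc i) => C [ct cc]; split.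
    by rewrite !trmx_mul trmxK ct mulmxA.
  rewrite sign_mx_tr -!mulmxA [sign_mx t *m (sign_mx t *m _)]mulmxA sign_mxK mul1mx.
  by rewrite [C *m (C *m _)]mulmxA cc.
- exact: chart_proj.
apply/eqmxP; apply: eqmx_trans (conj_flag_eqmx _ i (sign_mx_orth t)) _.
apply: eqmx_trans (eqmxMr _ (chart_eqmx i Yx)) _.
apply: eqmx_trans _ (eqmx_sym (chart_eqmx i Yx')).
have -> : upto R I i *m (1%:M + x') = sign_mx t *m (upto R I i *m (1%:M + x) *m sign_mx t).
  rewrite !mulmxA sign_mx_diagm -!mulmxA; congr (_ *m _).
  by rewrite mulmxDl mulmxDr mul1mx sign_mxK x'E !mulmxA.
by apply: eqmx_sym; apply: eqmxMfull; rewrite row_full_unit sign_mx_unit.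
Qed.

Hypotheses (m_gt0 : (0 < m)%N) (sum_e : (\sum_j e j = M)%N).

Notation X := (Fl R M e).
Notation cell := (schubert_cell e : _ -> set (flagspace R m M)).

Lemma cell_frontier I J F : I \in OSP M e -> J \in OSP M e ->
  cell J F -> closure (cell I) F ->
  cell J `<=` closure (cell I) /\ (J = I \/ (codim I < codim J)%N).
Proof.
move=> OI OJ cF clF; split; first exact: closure_cell_sub cF clF.
exact: cell_closure cF clF.
Qed.

(** The class of [thom_linear] is carried through the chart to its domain, where the cell
    corresponds to the vanishing of the normal entries, and then by excision to all of [around J],
    together with its signs. *)
Lemma cell_thom J : J \in OSP M e ->
  exists2 tau : cochain R (flagspace R m M) int (codim J),
    thom_class (around X cell J) (away X cell J) tau &
    forall t, scales_class (around X cell J) (away X cell J) tau (flip t)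
      ((-1) ^+ count (fun p => t p.1 (+) t p.2) (normal_pairs (blk J))).
Proof.
move=> OJ; set D := blk_lt_rel J; set ps := normal_pairs (blk J).
have psD p : p \in ps -> D p.1 p.2.
  by rewrite mem_filter => /andP[/andP[_ lt] _].
have ups : uniq ps by rewrite filter_uniq // enum_uniq.
have [tau th sc] := thom_linear R ups psD.
set V' := mx_supp D `&` nonzero_at ps in th sc.
pose V := chart_dom e J `\` cell J.
have kU x : mx_supp D x -> chart_dom e J (chart J x : flagspace R m M).
  exact: (chart_dom_chart OJ).
have tangentP (x : 'M[R]_M) : mx_supp D x -> ~ nonzero_at ps x -> tangent x.
  move=> Yx nx l l' ll'; have [lt|nlt] := boolP (D l l'); last exact: Yx.
  apply: contrapT => /eqP xne; apply: nx; apply/hasP; exists (l, l') => //.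
  by rewrite mem_filter /= ll' mem_enum andbT.
have fV F : V F -> V' (chart_coord J F).
  move=> [dF nF]; split; first exact: (coord_supp OJ).
  apply: contrapT => /tangentP h; apply: nF; rewrite -(coordK OJ dF).
  by apply: chart_cell => //; [exact: (coord_supp OJ)|apply: h; exact: (coord_supp OJ)].
have kV x : V' x -> V (chart J x).
  move=> [Yx /hasP[p pps xp]]; split; first exact: kU.
  move=> /(cell_tangent OJ); rewrite (chartK OJ Yx) => tx.
  move: pps; rewrite mem_filter => /andP[/andP[lt _] _].
  by rewrite tx // eqxx in xp.
have cf : continuous_on (chart_dom e J) (chart_coord J : flagspace R m M -> _).
  by move=> F; exact: chart_coord_continuous.
have ck : continuous_on (mx_supp D) (chart J : _ -> flagspace R m M).
  by move=> x; exact: chart_continuous.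
have VU : V `<=` chart_dom e J by move=> F [].
have VU' : V' `<=` mx_supp D by move=> x [].
have fU F : chart_dom e J F -> mx_supp D (chart_coord J F) by exact: (coord_supp OJ).
have thV : thom_class (chart_dom e J) V (pull (chart_coord J) tau).
  apply: (thom_homeo cf ck VU VU' fU fV kU kV) th.
    by move=> F; exact: (coordK OJ).
  by move=> x; exact: (chartK OJ).
have scV t : scales_class (chart_dom e J) V (pull (chart_coord J) tau) (flip t)
    ((-1) ^+ count (fun p => t p.1 (+) t p.2) ps).
  apply: (scales_homeo cf VU fU fV) (sc (fun i j => t i (+) t j)) => F dF.
  rewrite -{1}(coordK OJ dF) flip_chart; last exact: (coord_supp OJ).
  by rewrite (chartK OJ) //; apply: flip_supp; exact: (coord_supp OJ).
have domX : chart_dom e J `<=` X by move=> F [].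
(* Inside its chart the variety is just the cell: another cell in the closure would have larger
   codimension than [J], while one meeting the chart has smaller codimension. *)
have dom_away : chart_dom e J `&` away X cell J = V.
  apply/seteqP; split=> [F [dF [_ nF]]|F [dF nF]]; split=> //.
    by move=> cF; apply: nF; split; [exact: domX|exact: subset_closure].
  split; first exact: domX.
  move=> [_ clF]; have [I OI cI] := cell_cover m_gt0 sum_e (domX _ dF).
  have [IJ|lt] := cell_closure OJ OI cI clF; first by rewrite IJ in cI.
  have [JI|lt'] := dom_cell OI OJ dF cI; first by rewrite JI in nF.
  by move: (ltn_trans lt lt'); rewrite ltnn.
have dom_around : chart_dom e J `<=` around X cell J.
  move=> F dF; split; first exact: domX.
  move=> [vF nF]; have [_ []] : (chart_dom e J `&` away X cell J) F; last by [].
  by rewrite dom_away.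
have aroundE : around X cell J = chart_dom e J `|` away X cell J.
  apply/seteqP; split=> [F [XF nF]|F [/dom_around//|[XF nF]]]; last by split=> // -[].
  have [vF|vF] := pselect (variety X cell J F); last by right.
  left; apply: (cell_dom OJ); apply: contrapT => ncF.
  by apply: nF.
have rO : rel_open (around X cell J) (chart_dom e J).
  have [C oC dE] := chart_dom_rel_open R e J.
  exists C => //; apply/seteqP; split=> [F dF|F [[XF _] CF]].
    by split; [exact: dom_around|move: dF; rewrite dE => -[]].
  by rewrite dE.
have rV : rel_open (around X cell J) (away X cell J) by exact: away_rel_open.
rewrite -dom_away in thV scV.
have [tau' th' sc'] := thom_excision rO rV aroundE thV.
have szs : size ps = codim J by exact: size_normal_pairs OJ.
have flipX t F : X F -> X (flip t F).
  by apply: conj_flag_Fl; exact: sign_mx_orth.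
have flipcell t I F : I \in OSP M e -> cell I (flip t F) -> cell I F.
  by move=> OI /(flip_cell t OI); rewrite flipK.
have flipaway t F : away X cell J F -> away X cell J (flip t F).
  move=> [XF nF]; split; first exact: flipX.
  move=> [_ clF]; apply: nF; split=> //.
  have [I OI cI] := cell_cover m_gt0 sum_e XF.
  have [sub _] := cell_frontier OJ OI (flip_cell t OI cI) clF.
  exact: sub.
have flipdom t F : chart_dom e J F -> chart_dom e J (flip t F).
  move=> dF; rewrite -(coordK OJ dF) flip_chart; last exact: (coord_supp OJ).
  by apply: kU; apply: flip_supp; exact: (coord_supp OJ).
have sc'' t : scales_class (around X cell J) (away X cell J) tau' (flip t)
    ((-1) ^+ count (fun p => t p.1 (+) t p.2) ps).
  apply: sc' (scV t).
  - by move=> F _; exact: flip_continuous_flag.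
  - by move=> F; rewrite aroundE => -[/(flipdom t)|/(flipaway t)]; [left|right].
  - exact: flipdom.
  - exact: flipaway.
clear sc'; move: tau' th' sc''; rewrite szs => tau' th' sc''.
by exists tau'.
Qed.

End Signs.

(** * Rotations of a coordinate plane *)

Section Rotation.
Variables (R : realType) (m M : nat) (e : 'I_m -> nat) (p q : 'I_M).
Hypothesis pq : p != q.

Definition rot_plane : 'M[R]_M := delta_mx p p + delta_mx q q.
Definition rot_gen : 'M[R]_M := delta_mx p q - delta_mx q p.
(** Written with the projector P on the plane and the quarter turn J, so that orthogonality reduces
    to P P = P, P J = J P = J and J J = - P. *)
Definition rotation (c s : R) : 'M[R]_M :=
  1%:M + ((c - 1) *: rot_plane + s *: rot_gen).

Lemma rotation_orth c s : c ^+ 2 + s ^+ 2 = 1 ->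
  rotation c s *m (rotation c s)^T = 1%:M.
Proof.
move=> cs; have qp : q != p by rewrite eq_sym.
have PP : rot_plane *m rot_plane = rot_plane.
  rewrite /rot_plane mulmxDl !mulmxDr !mul_delta_mx !mul_delta_mx_cond.
  by rewrite (negPf pq) (negPf qp) !mulr0n addr0 add0r.
have PJ : rot_plane *m rot_gen = rot_gen.
  rewrite /rot_plane /rot_gen mulmxDl !mulmxBr !mul_delta_mx !mul_delta_mx_cond.
  by rewrite (negPf pq) (negPf qp) !mulr0n subr0 add0r.
have JP : rot_gen *m rot_plane = rot_gen.
  rewrite /rot_plane /rot_gen mulmxBl !mulmxDr !mul_delta_mx !mul_delta_mx_cond.
  by rewrite (negPf pq) (negPf qp) !mulr0n addr0 add0r.
have JJ : rot_gen *m rot_gen = - rot_plane.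
  rewrite /rot_plane /rot_gen mulmxBl !mulmxBr !mul_delta_mx !mul_delta_mx_cond.
  by rewrite (negPf pq) (negPf qp) !mulr0n sub0r subr0 opprD.
have Pt : rot_plane^T = rot_plane by rewrite /rot_plane raddfD /= !trmx_delta.
have Jt : rot_gen^T = - rot_gen.
  by rewrite /rot_gen raddfB /= !trmx_delta opprB.
have -> : (rotation c s)^T = 1%:M + ((c - 1) *: rot_plane + s *: - rot_gen).
  rewrite -Jt -{1}Pt; apply/matrixP => i j.
  by rewrite !mxE eq_sym.
rewrite /rotation.
set a := c - 1; set P := rot_plane in PP PJ JP JJ *; set J := rot_gen in PJ JP JJ *.
have UU : (a *: P + s *: J) *m (a *: P + s *: - J) = (a ^+ 2 + s ^+ 2) *: P.
  rewrite mulmxDl !mulmxDr -!scalemxAl -!scalemxAr !mulmxN PP PJ JP JJ opprK.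
  rewrite !scalerN !scalerA scalerDl -!expr2 [s * a]mulrC.
  by rewrite addrA addrNK.
rewrite mulmxDl mul1mx mulmxDr mulmx1 UU.
rewrite scalerN; have -> : 1%:M + (a *: P - s *: J) +
    (a *: P + s *: J + (a ^+ 2 + s ^+ 2) *: P) =
    1%:M + (a + a + (a ^+ 2 + s ^+ 2)) *: P + (s *: J - s *: J).
  by apply/matrixP => i j; rewrite !(mxE, mulrN); ring.
rewrite subrr addr0 (_ : a + a + (a ^+ 2 + s ^+ 2) = 0) ?scale0r ?addr0 //.
have s2 : s ^+ 2 = 1 - c ^+ 2 by rewrite -cs; ring.
by rewrite s2 /a; ring.
Qed.

Lemma rotation1 : rotation 1 0 = 1%:M.
Proof. by rewrite /rotation subrr !scale0r !addr0. Qed.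

Lemma rotationN1 : rotation (-1) 0 = sign_mx R (fun l => (l == p) || (l == q)).
Proof.
apply/matrixP => i j; rewrite sign_mxE /rotation scale0r addr0 !mxE.
have [<-|ij] := eqVneq i j; last first.
  have off k : (i == k) && (j == k) = false.
    by apply: contraNF ij => /andP[/eqP -> /eqP ->].
  by rewrite !off !mulr0 addr0 mulr0 addr0.
rewrite !andbb mulr1; have [->|ip] := eqVneq i p.
  by rewrite (negPf pq) /= expr1; ring.
by case: (i == q); rewrite /= ?expr1 ?expr0; ring.
Qed.

Lemma rotation_continuous (Z : topologicalType) (c s : Z -> R) z :
  {for z, continuous c} -> {for z, continuous s} ->
  {for z, continuous (fun y => rotation (c y) (s y))}.
Proof.
move=> cc cs; apply: continuous_at_addmx; first exact: cst_continuous.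
apply: continuous_at_addmx.
  apply: continuousZr_tmp; apply: continuousB => //; exact: cst_continuous.
exact: continuousZr_tmp.
Qed.

(** Rotation through the angle pi t ends at the sign change. The intermediate rotations do not
    respect the cells, so this concerns the absolute cohomology of the whole flag manifold only. *)
Lemma flip_homotopic (A : comNzRingType) n
    (c : cochain R (flagspace R m M) A n) :
  cocycle (Fl R M e) set0 c ->
  cohomologous (Fl R M e) set0
    (pull (flip (fun l => (l == p) || (l == q))) c) c.
Proof.
move=> cc; pose h (F : flagspace R m M) (t : R) :=
  conj_flag (rotation (cos (pi * t)) (sin (pi * t))) F.
have ch F t : {for (F, t), continuous (fun y : flagspace R m M * R => h y.1 y.2)}.
  have ct (f : R -> R) : continuous f ->
      {for (F, t), continuous (fun y : flagspace R m M * R => f (pi * y.2))}.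
    move=> cf; apply: (@continuous_comp _ _ _ (fun y : flagspace R m M * R => pi * y.2) f).
      by apply: continuousM; [exact: cst_continuous|exact: cvg_snd].
    exact: cf.
  apply: (conj_flag_continuous
    (o := fun y : flagspace R m M * R => rotation (cos (pi * y.2)) (sin (pi * y.2)))
    (f := fst)); last exact: cvg_fst.
  by apply: rotation_continuous; apply: ct; [exact: continuous_cos|exact: continuous_sin].
have := homotopy_cohomologous (h := h) (U := Fl R M e) (V := set0)
  (U' := Fl R M e) (V' := set0) (@sub0set _ _) (fun F t _ _ => ch F t) _
  (fun _ _ => False_ind _) cc.
have hX F t : Fl R M e F -> 0 <= t <= 1 -> Fl R M e (h F t).
  by move=> FF _; apply: conj_flag_Fl => //; apply: rotation_orth; exact: cos2Dsin2.
move=> /(_ hX); apply: is_coboundary_eq => s _.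
congr (c _ - c _); apply/funext => x /=; rewrite /h.
  by rewrite mulr1 cospi sinpi rotationN1.
rewrite mulr0 cos0 sin0 rotation1; apply/funext => i.
by rewrite /conj_flag trmx1 mul1mx mulmx1.
Qed.

End Rotation.

(** * Double Schubert varieties *)

Section DoubleSchubert.
Variables (R : realType) (m N : nat) (d : 'I_m -> nat).
Hypotheses (m_gt0 : (0 < m)%N) (sum_d : (\sum_j d j = N)%N).
Variable theta : forall k : nat, {ffun 'I_m -> {set 'I_(2 * N)}} ->
  cochain R (flagspace R m (2 * N)) int k.
Arguments theta : clear implicits.
Hypothesis theta_coor : coorientations (twice d) theta.

Notation K := {ffun 'I_m -> {set 'I_(2 * N)}}.
Notation X := (Fl R (2 * N) (twice d)).
Notation P := (OSP (2 * N) (twice d)).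
Notation cell := (@schubert_cell R m (2 * N) (twice d)).
Notation dbl := (@doubled m N).

Let sum_e : (\sum_j twice d j = 2 * N)%N.
Proof. by rewrite /twice -big_distrr /= sum_d. Qed.

Definition pair_flip (k : 'I_N) (F : flagspace R m (2 * N)) :=
  flip (fun l : 'I_(2 * N) => in_pair k l) F.

Definition normal_sign (J : K) (k : 'I_N) : bool :=
  odd (count (fun p : 'I_(2 * N) * 'I_(2 * N) => pair_sign k p.1 p.2)
    (normal_pairs (blk J))).

Let cellX (J : K) : J \in P -> cell J `<=` X.
Proof. by move=> _ F []. Qed.

Let cover F : X F -> exists2 J, J \in P & cell J F.
Proof. exact: cell_cover. Qed.

Let frontier I J F : I \in P -> J \in P -> cell J F -> closure (cell I) F ->
  cell J `<=` closure (cell I) /\ (J = I \/ (codim I < codim J)%N).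
Proof. exact: cell_frontier. Qed.

Let gcont k : continuous_on X (pair_flip k).
Proof.
move=> F _; exact: flip_continuous_flag.
Qed.

Let gcell k J F : J \in P -> cell J F -> cell J (pair_flip k F).
Proof. exact: flip_cell. Qed.

Let thom_scale J : J \in P ->
  thom_class (around X cell J) (away X cell J) (theta (codim J) J) /\
  (forall k, scales_class (around X cell J) (away X cell J) (theta (codim J) J)
    (pair_flip k) ((-1) ^+ normal_sign J k)).
Proof.
move=> JP; have [tau ttau stau] := cell_thom R m_gt0 sum_e JP.
have [tth sc] := generates_thom ttau (theta_coor JP).
split=> // k; apply: sc.
- by move=> F _; exact: flip_continuous_flag.
- exact: around_away.
- move=> F [XF nF]; split; first exact: (gX cellX cover gcell).
  move=> [[_ cF] nc]; apply: nF; split.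
    split=> //.
    have [J' J'P xJ'] := cover XF.
    have [sub _] := frontier JP J'P (gcell k J'P xJ') cF.
    exact: sub.
  by move=> /(gcell k JP).
- move=> F; exact: (gaway cellX cover frontier gcell).
- rewrite /normal_sign signr_odd; exact: stau.
Qed.

Let thom J : J \in P ->
  thom_class (around X cell J) (away X cell J) (theta (codim J) J).
Proof. by case/thom_scale. Qed.

Let gscale J k : J \in P ->
  scales_class (around X cell J) (away X cell J) (theta (codim J) J)
    (pair_flip k) ((-1) ^+ normal_sign J k).
Proof. by case/thom_scale. Qed.

Let ghtp k (A : comNzRingType) n (c : cochain R (flagspace R m (2 * N)) A n) :
  cocycle X set0 c -> cohomologous X set0 (pull (pair_flip k) c) c.
Proof.
have p_lt : (2 * k < 2 * N)%N by have := ltn_ord k; lia.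
have q_lt : ((2 * k).+1 < 2 * N)%N by have := ltn_ord k; lia.
have pq : Ordinal p_lt != Ordinal q_lt by apply/eqP => /(congr1 val) /=; lia.
move=> cc; have := flip_homotopic pq cc; congr cohomologous.
congr (pull _ c); apply/funext => F; congr flip.
apply/funext => l; rewrite /in_pair -!val_eqE /=.
by have := odd_double_half l; case: (odd l); lia.
Qed.

Let dblP I : I \in OSP N d -> dbl I \in P.
Proof. exact: doubled_OSP. Qed.

Let dbl_inj : {in OSP N d &, injective dbl}.
Proof.
move=> I J OI OJ IJ; apply: (blk_inj OI OJ) => l.
have p_lt : (2 * l < 2 * N)%N by have := ltn_ord l; lia.
have -> : l = half_ord (Ordinal p_lt) by apply: val_inj => /=; lia.
by rewrite -(blk_doubled _ OI) -(blk_doubled _ OJ) IJ.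
Qed.

Let dbl_chi I k : I \in OSP N d -> normal_sign (dbl I) k = false.
Proof. by move=> OI; apply/negbTE; exact: (pair_sign_doubled k OI). Qed.

Let dbl_even I : I \in OSP N d -> ~~ odd (codim (dbl I)).
Proof. exact: codim_doubled_even. Qed.

Let chi_split J : J \in P -> (forall I, I \in OSP N d -> J <> dbl I) ->
  exists k, normal_sign J k.
Proof.
move=> JP nJ; have [k kN oJ] := pair_sign_split JP nJ.
by exists (Ordinal kN).
Qed.

Lemma doubled_fundamental_class I : I \in OSP N d ->
  exists c : cochain R (flagspace R m (2 * N)) int (codim (dbl I)),
    fundamental_class (twice d) theta c.
Proof.
move=> OI; have odd_next J : J \in P -> codim J = (codim (dbl I)).+1 ->
    exists k, normal_sign J k.
  move=> JP cJ; apply: chi_split => // I' OI' JI'.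
  by have := dbl_even OI'; rewrite -JI' cJ /= (dbl_even OI).
have [c c1 c2] := fundamental_ex cellX cover frontier thom gcont gcell gscale
  (dblP OI) (fun k => dbl_chi k OI) odd_next.
by exists c.
Qed.

Definition below k : {set K} := [set J in P | (codim J < k)%N]%SET.

Lemma below_lower k : lower P (@codim m (2 * N)) (below k).
Proof.
split=> [J|J J']; first by rewrite inE => /andP[].
by rewrite !inE => /andP[_ Jk] -> J'J; exact: ltn_trans J'J Jk.
Qed.

Lemma stratum_ltE k : stratum_lt (twice d) k = strata cell (below k).
Proof.
apply/seteqP; split=> F.
  by move=> [J [JP Jk] cF]; exists J => //; rewrite inE JP.
by move=> [J]; rewrite inE => /andP[JP Jk] cF; exists J.
Qed.

(** The incidence coefficients vanish because the class extends: on the strata up to codimension k,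
    [theta] differs from a cocycle of the whole manifold by a coboundary. Extending that coboundary
    by [h] yields a primitive of [coboundary theta] that vanishes on these strata. *)
Lemma doubled_schubert_cycle I : I \in OSP N d ->
  schubert_cycle (twice d) theta (dbl I).
Proof.
move=> OI; have [c [c1 c2]] := doubled_fundamental_class OI.
rewrite /schubert_cycle /vassiliev_cocycle /vassiliev_differential.
set k := codim (dbl I) in c c1 c2 *.
have IP := dblP OI.
have -> : @realization R m (2 * N) (twice d) theta k (fun J => (J == dbl I)%:R) = theta k (dbl I).
  apply/funext => s; rewrite /realization (bigD1 (dbl I)) /= ?IP ?eqxx //.
  by rewrite mul1r big1 ?addr0 // => J /andP[_ /negbTE ->]; rewrite mul0r.
have -> : @realization R m (2 * N) (twice d) theta k.+1 (fun=> 0) = (fun=> 0).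
  by apply/funext => s; rewrite /realization big1 // => J _; rewrite mul0r.
rewrite !stratum_ltE.
set W' := strata cell (below k.+1); set W := strata cell (below k.+2).
have W'W : W' `<=` W.
  apply: strataS => J; rewrite !inE => /andP[-> Jk]; exact: leqW.
have WX : W `<=` X by apply: (strataX cellX); exact: (below_lower _).1.
have Iin : dbl I \in below k.+1 by rewrite inE IP ltnS leqnn.
have W'around : W' `<=` around X cell (dbl I).
  apply: (strata_around cellX frontier (below_lower _) Iin) => J.
  by rewrite inE => /andP[_].
have cb := is_coboundary_sub W'around (@sub0set _ _) c2.
have [h [_ eh dh]] := coboundary_extend W'W (@sub0set _ _) cb.
exists (fun s => theta k (dbl I) s - c s + h s); split=> s Ws.
  by rewrite -eh // addrC subrKA subrr.
rewrite subr0 coboundaryD coboundaryB dh addr0.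
by rewrite (c1.2 s (simplices_sub WX Ws)) subr0.
Qed.

Variable c : forall k : nat, {ffun 'I_m -> {set 'I_N}} ->
  cochain R (flagspace R m (2 * N)) int k.
Arguments c : clear implicits.
Hypothesis c_fundamental : forall I, I \in OSP N d ->
  fundamental_class (twice d) theta (c (codim (dbl I)) I).

Let c_cocycle I : I \in OSP N d ->
  cocycle X (away X cell (dbl I)) (c (codim (dbl I)) I).
Proof. by move=> /c_fundamental[]. Qed.

Let c_theta I : I \in OSP N d ->
  cohomologous (around X cell (dbl I)) (away X cell (dbl I))
    (c (codim (dbl I)) I) (theta (codim (dbl I)) (dbl I)).
Proof. by move=> /c_fundamental[]. Qed.

Let lowerP : lower P (@codim m (2 * N)) P.
Proof. by split. Qed.

Let XE : strata cell P = X.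
Proof. exact: strataP cellX cover. Qed.

Lemma doubled_rational_free : classes_free X (OSP N d)
  (fun I => codim (dbl I)) (fun k I s => (c k I s)%:~R : rat).
Proof.
move=> a ca I OI.
apply: (rational_free cellX cover frontier thom gcont gcell _ _ gscale ghtp dblP
  dbl_inj dbl_chi dbl_even chi_split c_cocycle c_theta lowerP (n := codim (dbl I))
  _ OI (dblP OI) erefl).
- by move=> k F; exact: flipK.
- by move=> k k' F; exact: flipC.
- by rewrite XE; exact: ca.
Qed.

(** An integral relation is read over the rationals, where the coefficients already vanish. *)
Lemma doubled_integral_free : classes_free X (OSP N d)
  (fun I => codim (dbl I)) c.
Proof.
move=> a ca I OI; apply/eqP; rewrite -(intr_eq0 rat); apply/eqP.
apply: (doubled_rational_free (a := fun J => (a J)%:~R)) OI => k.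
apply: is_coboundary_eq (is_coboundary_coef rat (ca k)) => s _.
by rewrite /coef rmorph_sum; apply: eq_bigr => J _; rewrite rmorphM.
Qed.

Lemma doubled_rational_span : classes_span X (OSP N d)
  (fun I => codim (dbl I)) (fun k I s => (c k I s)%:~R : rat).
Proof.
move=> n z; rewrite -XE => cz.
apply: (rational_span cellX cover frontier thom gcont gcell gscale ghtp chi_split
  c_cocycle c_theta lowerP cz) => k.
by move: cz; rewrite XE; exact: ghtp.
Qed.

End DoubleSchubert.

Theorem theorem3p11 (R : realType) (m N : nat) (d : 'I_m -> nat)
    (m_gt0 : (0 < m)%N) (d_gt0 : forall j, (0 < d j)%N)
    (sum_d : (\sum_j d j = N)%N)
    (theta : forall k : nat, {ffun 'I_m -> {set 'I_(2 * N)}} ->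
                cochain R (flagspace R m (2 * N)) int k)
    (theta_coor : coorientations (twice d) theta) :
  (forall I, I \in OSP N d ->
     schubert_cycle (twice d) theta (doubled I)) /\
  (forall I, I \in OSP N d ->
     exists c : cochain R (flagspace R m (2 * N)) int (codim (doubled I)),
       fundamental_class (twice d) theta c) /\
  (forall c : forall k : nat, {ffun 'I_m -> {set 'I_N}} ->
                cochain R (flagspace R m (2 * N)) int k,
     (forall I, I \in OSP N d ->
        fundamental_class (twice d) theta
          (c (codim (doubled I)) I)) ->
     classes_free (Fl R (2 * N) (twice d)) (OSP N d)
       (fun I => codim (doubled I)) c /\
     classes_free (Fl R (2 * N) (twice d)) (OSP N d)
       (fun I => codim (doubled I)) (fun k I s => (c k I s)%:~R : rat) /\
     classes_span (Fl R (2 * N) (twice d)) (OSP N d)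
       (fun I => codim (doubled I)) (fun k I s => (c k I s)%:~R : rat)).
Proof.
split; first exact: doubled_schubert_cycle.
split; first exact: doubled_fundamental_class.
move=> c fc; split; first exact: doubled_integral_free fc.
split; first exact: doubled_rational_free fc.
exact: doubled_rational_span fc.
Qed.
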